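(* Consider Model $M_{[0,1]}$ with the notation of the context. For every fixed $t\in\mathbb{R}$ there exists a constant $C(t)<\infty$ such that, for all sufficiently large $n$, $$d_{\mathrm{TV}}\bigl(\mathcal L(W_n(t)),\,\mathrm{Poisson}(e^{-t})\bigr)\le C(t)\,\frac{(\log\log n)^2}{\log n}.$$
   Context: Model $M_{[0,1]}$ (round-robin tournament of $n$ equally strong players). Let $D\subset[0,1]$ be a countable set (finite or countably infinite) with $|D|>1$. For $i\ne j$, $X_{ij}$ is a $D$-valued random variable (the reward of player $i$ against player $j$) with $X_{ij}+X_{ji}=1$; in particular $a\in D$ implies $1-a\in D$. The $\binom n2$ random vectors $\{(X_{ij},X_{ji}):1\le i<j\le n\}$ are independent. All $X_{ij}$ ($i\neq j$) have the same distribution, not depending on $n$, which charges every point of $D$ and is symmetric about $1/2$: $0<\mathbb P(X_{ij}=a)=\mathbb P(X_{ji}=a)=\mathbb P(X_{ij}=1-a)$ for all $a\in D$. Put $\mu=\mathbb E(X_{ij})$ and $\sigma=\sqrt{\mathrm{Var}(X_{ij})}$. The score of player $i$ is $s_i(n)=\sum_{j\ne i,\,1\le j\le n}X_{ij}$ and the normalized score is $s_i^\star(n)=\dfrac{s_i(n)-(n-1)\mu}{\sqrt{n-1}\,\sigma}$. For $t\in\mathbb R$ put $$a_n=(2\log n)^{-1/2},\quad b_n=(2\log n)^{1/2}-\frac{\log\log n+\log(4\pi)}{2(2\log n)^{1/2}},\quad x_n(t)=b_n+a_nt,$$ where $\log$ is the natural logarithm, and $W_n(t)=\sum_{i=1}^n\mathbf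 1\{s_i^\star(n)>x_n(t)\}$. $\mathcal L(W)$ denotes the law of $W$. For laws of nonnegative-integer-valued random variables $X,Y$, $d_{\mathrm{TV}}(X,Y)=\frac12\sum_{k\ge0}|\mathbb P(X=k)-\mathbb P(Y=k)|$. *)

(* Defs.v *)
From HB Require Import structures.
From mathcomp Require Import all_boot all_order all_algebra.
From mathcomp Require Import all_classical all_reals all_analysis.
From mathcomp Require Import measurable_realfun.

Set Implicit Arguments.
Unset Strict Implicit.
Unset Printing Implicit Defensive.

Import Order.TTheory GRing.Theory Num.Theory.
Import numFieldNormedType.Exports.

Local Open Scope classical_set_scope.
Local Open Scope ring_scope.

Definition mutually_independent d d' (T : measurableType d)
    (T' : measurableType d') (R : realType) (P : probability T R)
    (I : finType) (A : {pred I}) (Y : I -> T -> T') : Prop :=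
  forall (J : {set I}) (B : I -> set T'),
    J \subset A -> (forall i, measurable (B i)) ->
    P (\bigcap_(i in [set` J]) (Y i @^-1` B i)) =
      (\prod_(i in J) P (Y i @^-1` B i))%E.

(* The round-robin tournament of n players, for a fixed n. The common law [nu]
   of the rewards is a parameter so that it can be shared by all n. The diagonal
   rewards [X i i] are unconstrained and never used. *)
Record round_robin (R : realType) (D : set R) (nu : probability R R)
    d (T : measurableType d) (P : probability T R) (n : nat)
    (X : 'I_n -> 'I_n -> {RV P >-> R}) : Prop := {
  reward_valued : forall i j, i != j -> forall w, D (X i j w) ;
  reward_sum : forall i j, i != j -> forall w, X i j w + X j i w = 1 ;
  reward_indep : mutually_independent P
    [pred ij : 'I_n * 'I_n | (ij.1 < ij.2)%N]
    (fun ij w => (X ij.1 ij.2 w, X ij.2 ij.1 w)) ;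
  reward_law : forall i j, i != j -> forall B, measurable B ->
    distribution P (X i j) B = nu B ;
  reward_charge : forall i j, i != j -> forall a, D a ->
    (0 < P [set w | X i j w = a])%E ;
  reward_exch : forall i j, i != j -> forall a, D a ->
    P [set w | X i j w = a] = P [set w | X j i w = a] ;
  reward_sym : forall i j, i != j -> forall a, D a ->
    P [set w | X i j w = a] = P [set w | X i j w = 1 - a] }.

Section threshold.
Context (R : realType).
Implicit Types (n : nat) (t : R).

Definition a_ n : R := (Num.sqrt (2 * ln n%:R))^-1.

Definition b_ n : R :=
  Num.sqrt (2 * ln n%:R) -
  (ln (ln n%:R) + ln (4 * pi)) / (2 * Num.sqrt (2 * ln n%:R)).

Definition threshold n t : R := b_ n + a_ n * t.

End threshold.

Section scores.
Context (R : realType) d (T : measurableType d) (P : probability T R) (n : nat).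
Variables (X : 'I_n -> 'I_n -> {RV P >-> R}) (mu sigma t : R).

Definition score (i : 'I_n) (w : T) : R := \sum_(j < n | j != i) X i j w.

Definition norm_score (i : 'I_n) (w : T) : R :=
  (score i w - (n%:R - 1) * mu) / (Num.sqrt (n%:R - 1) * sigma).

Definition exceedances (w : T) : nat :=
  (\sum_(i < n) (threshold n t < norm_score i w)%R)%N.

Lemma measurable_norm_score i : measurable_fun [set: T] (norm_score i).
Proof.
apply: measurable_funM => //; apply: measurable_funB => //.
rewrite (_ : score i = fun w => \sum_(j < n) if j != i then X i j w else 0).
  by apply: measurable_sum => j; case: (j != i).
by apply/funext => w; rewrite /score big_mkcond.
Qed.

Lemma measurable_exceedances : measurable_fun [set: T] exceedances.
Proof.
rewrite /exceedances; elim: (index_enum _) => [|i s ih].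
  by rewrite (_ : (fun _ => _) = cst 0%N)//; apply/funext => w; rewrite big_nil.
rewrite (_ : (fun _ => _) = fun w =>
    ((threshold n t < norm_score i w)%R +
     \sum_(j <- s) (threshold n t < norm_score j w)%R)%N); last first.
  by apply/funext => w; rewrite big_cons.
apply: measurable_fun_addn => //.
apply: (measurableT_comp (f := nat_of_bool)) => //.
by apply: measurable_fun_ltr => //; exact: measurable_norm_score.
Qed.

HB.instance Definition _ :=
  isMeasurableFun.Build _ _ _ _ exceedances measurable_exceedances.

End scores.

Definition dTV (R : realType) (p q : probability nat R) : \bar R :=
  ((2^-1)%:E * \sum_(0 <= k <oo) `|p [set k] - q [set k]|)%E.

(* Main.v *)
(** Let W be the number of exceedances.  For a player i, consider the number of
    players j <> i whose score without the game against i exceeds the threshold.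
    It is independent of the result of player i and differs from W only if player
    i exceeds or if some player's game against i decides about the exceedance.  So
    Stein's equation for the Poisson law of parameter e^-t, whose solutions are
    bounded, reduces the theorem to
      n P(S > z) = e^-t + O((log log n)^2 / log n)
    for the sum S of n - 2 centered rewards and z = sigma sqrt(n-1) x_n(t) +- 1/2.

    This moderate deviation estimate comes from Lindeberg's replacement method in
    the form of the heat flow: u(s,y) = Q((z - y) / sqrt s), with Q the Gaussian
    tail, satisfies E u(s, y + X) = u(s + sigma^2, y) up to an error that is
    dominated by a multiple of exp(theta (y - z) + theta^2 s / 2).  Exponentials are
    eigenfunctions of the averaging over a reward X, hence the errors can be summed
    over all rewards; for theta = sqrt(2 log n) / (sigma sqrt n) their sum is
    negligible with respect to 1 / n.  Starting from a small s > 0 smooths the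
    indicator of S > z at a negligible cost, and Mills' ratio evaluates Q. *)

Require Import Defs.
From HB Require Import structures.
From mathcomp Require Import all_boot all_order all_algebra.
From mathcomp Require Import all_classical all_reals all_analysis.
From mathcomp Require Import measurable_realfun ring lra.

Set Implicit Arguments.
Unset Strict Implicit.
Unset Printing Implicit Defensive.

Import Order.TTheory GRing.Theory Num.Theory.
Import numFieldNormedType.Exports.

Local Open Scope classical_set_scope.
Local Open Scope ring_scope.

(** * The Gaussian tail *)

(** A Berry-Esseen bound has an absolute error of order n^(-1/2), while the probability to be
    estimated has order 1/n; hence errors that carry the exponential weight of the tail. At the
    cutoff this weight is about exp(-2L + L) = 1/n, with L = log n. The other factors are the number
    of steps, about n, and s^(-3/2) for the initial s, so that s = sigma^2 n / L^6 leaves a relative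
    error n^(-1/2) up to powers of L. The rate comes from the threshold alone: x_n(t) = sqrt(2L) + d
    / sqrt(2L) with d of order log L, and d^2 / (4L) is the largest term that x_n(t)^2 / 2 leaves
    over. All other errors are of smaller order. The dependence between the scores costs no
    covariance estimate. The expected number of players for whom the game against i decides is at
    most n (hi - lo), where hi and lo are the exceedance probabilities of a player who is granted
    reward 1 or 0 in that game; n hi and n lo both approximate e^-t at the claimed rate. *)

Section gaussian_tail.
Context {R : realType}.
Implicit Types x y : R.

Lemma derivable_nonincr (f df : R -> R) a :
  (forall x, a < x -> is_derive x 1 f (df x)) ->
  (forall x, a < x -> df x <= 0) ->
  forall x y, a < x -> x <= y -> f y <= f x.
Proof.
move=> fdf df0 x y ax xy.
have [z|| c cxy] := @MVT_segment R f df x y xy.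
- by rewrite in_itv/= => /andP[xz _]; apply: fdf; exact: lt_trans xz.
- apply: derivable_within_continuous => z /[!in_itv]/= /andP[xz _].
  by have [] := fdf z (lt_le_trans ax xz).
move=> fyx; rewrite -subr_le0 fyx mulr_le0_ge0 ?subr_ge0//.
by apply: df0; move: cxy; rewrite in_itv/= => /andP[xc _]; exact: lt_le_trans xc.
Qed.

(** Both of Mills' inequalities come from this: the difference of their sides tends to 0 at infinity
    and has an explicit derivative of constant sign, so that no integral has to be estimated. *)
Lemma derivable_nonincr_ge0 (f df : R -> R) a :
  (forall x, a < x -> is_derive x 1 f (df x)) ->
  (forall x, a < x -> df x <= 0) ->
  f x @[x --> +oo] --> 0 ->
  forall x, a < x -> 0 <= f x.
Proof.
move=> fdf df0 f0 x ax.
apply: (@cvgr_to_le _ _ _ _ _ _ _ f0).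
near=> y; apply: (derivable_nonincr fdf df0) => //.
Unshelve. all: by end_near. Qed.

Definition gdensity x : R := expR (- x ^+ 2 / 2) / Num.sqrt (2 * pi).

(** Written as 1 minus a distribution function: the fundamental theorem of calculus with lower limit
    -oo gives the derivative, and the limits of a [cdf] give the limits. *)
Definition gtail x : R :=
  1 - \int[lebesgue_measure]_(t in `]-oo, x]) normal_pdf 0 1 t.

Lemma normal_pdf01 x : normal_pdf 0 1 x = gdensity x.
Proof.
rewrite normal_pdfE ?oner_neq0//= /normal_peak /normal_fun /gdensity subr0.
by rewrite expr1n mul1r mulrC mulr_natl.
Qed.

Lemma gdensity_gt0 x : 0 < gdensity x.
Proof.
by rewrite /gdensity divr_gt0 ?expR_gt0// sqrtr_gt0 mulr_gt0 ?pi_gt0.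
Qed.

Lemma gdensityN x : gdensity (- x) = gdensity x.
Proof. by rewrite /gdensity sqrrN. Qed.

Lemma gdensity_le_expR x : gdensity x <= expR (- x ^+ 2 / 2).
Proof.
rewrite /gdensity ler_pdivrMr ?sqrtr_gt0 ?mulr_gt0 ?pi_gt0//.
rewrite ler_peMr ?expR_ge0// -[leLHS]sqrtr1 ler_wsqrtr//.
by have := pi_ge2 R; lra.
Qed.

Lemma is_derive_gdensity x : is_derive x 1 gdensity (- x * gdensity x).
Proof.
have h : is_derive x 1 (expR \o (fun y => - y ^+ 2 / 2))
    (expR (- x ^+ 2 / 2) * (- x)).
  apply: is_derive1_comp.
  have -> : (fun y : R => - y ^+ 2 / 2) = cst (- 2^-1) * (@id R ^+ 2).
    by apply/funext => y; rewrite !fctE /GRing.scale; field.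
  apply: is_derive_eq; rewrite /GRing.scale/=.
  by field.
have -> : gdensity = cst (Num.sqrt (2 * pi))^-1 *
    (expR \o (fun y => - y ^+ 2 / 2)).
  by apply/funext => y; rewrite /gdensity /= mulrC.
by apply: is_derive_eq; rewrite !fctE /GRing.scale/=; ring.
Qed.

Lemma is_derive_gtail x : is_derive x 1 gtail (- gdensity x).
Proof.
have [||||dF F'] := @continuous_FTC1 R (normal_pdf 0 1) -oo%O x (x + 1).
- by rewrite ltrDl.
- apply: (integrableS _ _ (subsetT _)) => //.
  exact: integrable_normal_pdf.
- by rewrite ltNyr.
- exact: continuous_normal_pdf (oner_neq0 _) _.
have dF' : is_derive x 1 (fun x =>
    \int[lebesgue_measure]_(t in `]-oo, x]) normal_pdf 0 1 t) (gdensity x).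
  by rewrite -normal_pdf01; apply: (DeriveDef dF); rewrite -derive1E F'.
rewrite -sub0r; exact: (is_deriveB (is_derive_cst _ _ _) dF').
Qed.

(** The identity as a random variable under the standard normal law; its [cdf] is 1 - [gtail]. *)
Let gidf : measurableTypeR R -> R := idfun.
#[local] HB.instance Definition _ :=
  @isMeasurableFun.Build _ _ _ _ gidf (@measurable_id _ _ setT).
Let gid : {RV (@normal_prob R 0 1) >-> R} := gidf.

Let gtailE x : gtail x = 1 - fine (cdf gid x).
Proof. by []. Qed.

Lemma cvg_gtail_pinfty : gtail x @[x --> +oo] --> (0 : R).
Proof.
rewrite -(subrr (1:R)); apply: cvgB; first exact: cvg_cst.
by apply: fine_cvg; exact: (cvg_cdfy1 gid).
Qed.

Lemma cvg_gtail_ninfty : gtail (- x) @[x --> +oo] --> (1 : R).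
Proof.
rewrite -[X in _ --> X](@subr0 R); apply: cvgB; first exact: cvg_cst.
have /cvgNy_compNP := cvg_cdfNy0 gid.
by move=> /fine_cvg; exact.
Qed.

Lemma gtail_ge0 x : 0 <= gtail x.
Proof.
rewrite gtailE subr_ge0 -lee_fin fineK ?cdf_le1//.
exact: fin_num_measure.
Qed.

Lemma gtail_le1 x : gtail x <= 1.
Proof.
by rewrite gtailE gerBl fine_ge0.
Qed.

Lemma gtail_nonincr x y : x <= y -> gtail y <= gtail x.
Proof.
apply: (@derivable_nonincr _ (- gdensity) (x - 1)) => [z _|z _|].
- exact: is_derive_gtail.
- by rewrite oppr_le0 ltW// gdensity_gt0.
- by rewrite ltrBlDr ltrDl.
Qed.

Lemma cvg_gdensity : gdensity x @[x --> +oo] --> (0 : R).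
Proof.
apply: (@squeeze_cvgr _ _ _ _ (cst 0) (fun x => expR (- x))); first last.
- exact: cvgr_expR.
- exact: cvg_cst.
near=> x; rewrite ltW ?gdensity_gt0//=.
rewrite (le_trans (gdensity_le_expR x))// ler_expR.
have : 2 <= x by near: x; exact: nbhs_pinfty_ge.
by nra.
Unshelve. all: by end_near. Qed.

Lemma cvg_gdensity_div (g : R -> R) : (\forall x \near +oo, `|g x| <= 1) ->
  gdensity x * g x @[x --> +oo] --> (0 : R).
Proof.
move=> g1; apply/cvgr0Pnorm_le => e e0.
have /cvgr0Pnorm_le/(_ _ e0) := cvg_gdensity.
apply: filterS2 g1 => x gx dx.
by rewrite normrM -[leRHS]mulr1 ler_pM.
Qed.

(** Stated for any antiderivative that vanishes at infinity, because it serves both the upper tail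
    and, in [gtailN_lb], the reflected lower tail; the symmetry of the integral is thereby
    avoided. *)
Lemma mills_ub_gen (G : R -> R) x :
  (forall x, is_derive x 1 G (- gdensity x)) -> G x @[x --> +oo] --> (0 : R) ->
  0 < x -> G x <= gdensity x / x.
Proof.
move=> dG G0 x0; rewrite -subr_ge0.
have := @derivable_nonincr_ge0 (fun x => gdensity x / x - G x)
  (fun x => - gdensity x / x ^+ 2) 0.
apply; last exact: x0.
- move=> y y0.
  have dV : is_derive y 1 (fun z : R => z^-1) (- y ^- 2 *: 1).
    apply: (@is_deriveV R id) => //; exact: lt0r_neq0.
  have -> : (fun x => gdensity x / x - G x) = gdensity * (fun z : R => z^-1) - G.
    by [].
  have := dG y; have := is_derive_gdensity y => ? ?.
  apply: is_derive_eq; rewrite /GRing.scale/= .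
  by field; rewrite gt_eqF.
- move=> y y0; rewrite mulNr oppr_le0 divr_ge0// ?exprn_ge0 ?(ltW y0)//.
  by rewrite ltW// gdensity_gt0.
- rewrite -[X in _ --> X](@subr0 R); apply: cvgB => //.
  apply: cvg_gdensity_div; near=> y.
  have y1 : 1 <= y by near: y; exact: nbhs_pinfty_ge.
  by rewrite ger0_norm ?invr_ge0 ?(le_trans _ y1)// invf_le1// (lt_le_trans _ y1).
Unshelve. all: by end_near. Qed.

Lemma mills_lb x : 0 < x -> gdensity x / x * (1 - x ^- 2) <= gtail x.
Proof.
move=> x0; rewrite -subr_ge0.
have := @derivable_nonincr_ge0
  (fun x => gtail x - gdensity x * (x^-1 - x^-1 * (x^-1 * x^-1)))
  (fun x => - 3 * gdensity x / x ^+ 4) 0.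
have -> : gdensity x / x * (1 - x ^- 2) =
  gdensity x * (x^-1 - x^-1 * (x^-1 * x^-1)).
  by field; rewrite gt_eqF.
apply; last exact: x0.
- move=> y y0.
  have dV : is_derive y 1 (fun z : R => z^-1) (- y ^- 2 *: 1).
    apply: (@is_deriveV R id) => //; exact: lt0r_neq0.
  set i := (fun z : R => z^-1) in dV.
  have -> : (fun x => gtail x - gdensity x * (x^-1 - x^-1 * (x^-1 * x^-1)))
      = gtail - gdensity * (i - i * (i * i)).
    by [].
  have := is_derive_gtail y; have := is_derive_gdensity y => ? ?.
  apply: is_derive_eq; rewrite /GRing.scale/= /i !fctE.
  by field; rewrite gt_eqF.
- move=> y y0; rewrite !mulNr oppr_le0 divr_ge0// ?exprn_ge0 ?(ltW y0)//.
  by rewrite mulr_ge0// ltW// gdensity_gt0.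
- rewrite -[X in _ --> X](@subr0 R); apply: cvgB => //; first exact: cvg_gtail_pinfty.
  apply: cvg_gdensity_div; near=> y.
  have y1 : 1 <= y by near: y; exact: nbhs_pinfty_ge.
  have : 0 < y^-1 by rewrite invr_gt0 (lt_le_trans _ y1).
  have : y^-1 <= 1 by rewrite invf_le1// (lt_le_trans _ y1).
  move: (y^-1) => z z1 z0.
  by rewrite ger0_norm; nra.
Unshelve. all: by end_near. Qed.

Lemma mills_ub x : 0 < x -> gtail x <= gdensity x / x.
Proof.
apply: mills_ub_gen; [exact: is_derive_gtail|exact: cvg_gtail_pinfty].
Qed.

Lemma gtailN_lb x : 0 < x -> 1 - gdensity x / x <= gtail (- x).
Proof.
move=> x0; rewrite lerBlDr addrC -lerBlDr.
apply: (@mills_ub_gen (fun x => 1 - gtail (- x))); last exact: x0.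
- move=> y.
  have -> : (fun x => 1 - gtail (- x)) = cst 1 - (gtail \o -%R) by [].
  rewrite -[X in is_derive _ _ _ X]sub0r; apply: is_deriveB.
  rewrite -[X in is_derive _ _ _ X]opprK -mulrN1 -(gdensityN y).
  apply: is_derive1_comp; exact: is_derive_gtail.
- rewrite -(subrr (1:R)); apply: cvgB; first exact: cvg_cst.
  exact: cvg_gtail_ninfty.
Qed.

End gaussian_tail.

(** * The heat kernel *)

Section taylor.
Context {R : realType}.
Implicit Types (f : R -> R) (a h M : R).

(** The induction step for Taylor's formula: the derivative of a remainder of order k is the
    remainder of order k - 1 of the derivative, and bounds pass up by the mean value theorem. *)
Lemma norm_le_of_deriv f df (B dB : R -> R) h : 0 <= h ->
  (forall x, 0 <= x <= h -> is_derive x 1 f (df x)) ->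
  (forall x, 0 <= x <= h -> is_derive x 1 B (dB x)) ->
  (forall x, 0 <= x <= h -> `|df x| <= dB x) ->
  f 0 = 0 -> B 0 = 0 -> `|f h| <= B h.
Proof.
move=> h0 fdf BdB dfdB f0 B0.
have main (g dg : R -> R) : (forall x, 0 <= x <= h -> is_derive x 1 g (dg x)) ->
    (forall x, 0 <= x <= h -> dg x <= dB x) -> g 0 = 0 -> g h <= B h.
  move=> gdg dgdB g0.
  have dBg x : 0 <= x <= h -> is_derive x 1 (B - g) (dB x - dg x).
    by move=> xh; apply: is_deriveB; [exact: BdB|exact: gdg].
  have [x||c ch E] := @MVT_segment R (B - g) (fun x => dB x - dg x) 0 h h0.
  - rewrite in_itv/= => /andP[x0 xh]; apply: dBg; by rewrite !ltW.
  - apply: derivable_within_continuous => x /[!in_itv]/= xh.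
    by have [] := dBg x xh.
  move: E; rewrite !fctE g0 B0 !subr0 => E.
  rewrite -subr_ge0 E mulr_ge0// subr_ge0; apply: dgdB.
  by move: ch; rewrite in_itv.
rewrite ler_norml; apply/andP; split; last first.
  by apply: (main f df) => // x xh; rewrite (le_trans (ler_norm _))// dfdB.
rewrite lerNl; apply: (main (- f) (fun x => - df x)) => [x xh|x xh|].
- by apply: is_deriveN; exact: fdf.
- by rewrite (le_trans _ (dfdB _ xh))// -normrN ler_norm.
- by rewrite !fctE f0 oppr0.
Qed.

Let is_derive_shiftl f df a x : is_derive (a + x) 1 f df ->
  is_derive x 1 (fun x => f (a + x)) df.
Proof.
move=> fdf; have -> : (fun x => f (a + x)) = f \o shift a.
  by apply/funext => y; rewrite /= addrC.
rewrite -[df]mulr1; apply: is_derive1_comp; last exact: is_derive_shift.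
by rewrite /= addrC.
Qed.

Let is_deriveXc (c : R) n (x : R) :
  is_derive x 1 (fun x => c * x ^+ n.+1) (c * n.+1%:R * x ^+ n).
Proof.
have -> : (fun x => c * x ^+ n.+1) = cst c * (@id R) ^+ n.+1.
  by apply/funext => y; rewrite !fctE.
by apply: is_derive_eq; rewrite /GRing.scale/= ?fctE; ring.
Qed.

Lemma taylor1_ge0 (f0 f1 : R -> R) a h M : 0 <= h ->
  (forall x, a <= x <= a + h -> is_derive x 1 f0 (f1 x)) ->
  (forall x, a <= x <= a + h -> `|f1 x| <= M) ->
  `|f0 (a + h) - f0 a| <= M * h.
Proof.
move=> h0 f01 f1M.
have itv x : 0 <= x <= h -> a <= a + x <= a + h.
  by rewrite lerD2l lerDl.
apply: (@norm_le_of_deriv (fun x => f0 (a + x) - f0 a) (fun x => f1 (a + x))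
  (fun x => M * x ^+ 1) (fun x => M * 1%:R * x ^+ 0)); first exact: h0.
- move=> x /itv xh; rewrite -[f1 _]subr0.
  exact: (is_deriveB (is_derive_shiftl (f01 _ xh)) (is_derive_cst _ _ _)).
- by move=> x /itv/f1M; rewrite expr0 !mulr1.
- by rewrite addr0 subrr.
- by rewrite expr1 mulr0.
Qed.

Lemma taylor2_ge0 (f0 f1 f2 : R -> R) a h M : 0 <= h ->
  (forall x, a <= x <= a + h -> is_derive x 1 f0 (f1 x)) ->
  (forall x, a <= x <= a + h -> is_derive x 1 f1 (f2 x)) ->
  (forall x, a <= x <= a + h -> `|f2 x| <= M) ->
  `|f0 (a + h) - f0 a - f1 a * h| <= M * h ^+ 2 / 2.
Proof.
move=> h0 f01 f12 f2M.
have itv x : 0 <= x <= h -> a <= a + x <= a + h.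
  by rewrite lerD2l lerDl.
rewrite [leRHS]mulrAC.
apply: (@norm_le_of_deriv (fun x => f0 (a + x) - f0 a - f1 a * x)
  (fun x => f1 (a + x) - f1 a)
  (fun x => M / 2 * x ^+ 2) (fun x => M / 2 * 2 * x ^+ 1)); first exact: h0.
- move=> x /itv xh.
  have := is_deriveB (is_deriveB (is_derive_shiftl (f01 _ xh)) (is_derive_cst (f0 a) _ _))
    (is_deriveXc (f1 a) 0 x).
  by rewrite subr0 expr0 !mulr1.
- by move=> x _; exact: is_deriveXc.
- move=> x xh; rewrite divfK// expr1; case/andP: (xh) => x0 xh'.
  have sub y : a <= y <= a + x -> a <= y <= a + h.
    by move=> /andP[-> /le_trans]; apply; rewrite lerD2l.
  by apply: (@taylor1_ge0 f1 f2 a x M x0) => y /sub; [exact: f12|exact: f2M].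
- by rewrite addr0 subrr mulr0 subr0.
- by rewrite expr2 !mulr0.
Qed.

Let taylor3_ge0 (f0 f1 f2 f3 : R -> R) a h M : 0 <= h ->
  (forall x, a <= x <= a + h -> is_derive x 1 f0 (f1 x)) ->
  (forall x, a <= x <= a + h -> is_derive x 1 f1 (f2 x)) ->
  (forall x, a <= x <= a + h -> is_derive x 1 f2 (f3 x)) ->
  (forall x, a <= x <= a + h -> `|f3 x| <= M) ->
  `|f0 (a + h) - f0 a - f1 a * h - f2 a / 2 * h ^+ 2| <= M * h ^+ 3 / 6.
Proof.
move=> h0 f01 f12 f23 f3M.
have itv x : 0 <= x <= h -> a <= a + x <= a + h.
  by rewrite lerD2l lerDl.
rewrite [leRHS]mulrAC.
apply: (@norm_le_of_deriv (fun x => f0 (a + x) - f0 a - f1 a * x - f2 a / 2 * x ^+ 2)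
  (fun x => f1 (a + x) - f1 a - f2 a * x)
  (fun x => M / 6 * x ^+ 3) (fun x => M / 6 * 3 * x ^+ 2)); first exact: h0.
- move=> x /itv xh.
  have := is_deriveB (is_deriveB (is_deriveB (is_derive_shiftl (f01 _ xh))
     (is_derive_cst (f0 a) _ _)) (is_deriveXc (f1 a) 0 x)) (is_deriveXc (f2 a / 2) 1 x).
  by rewrite subr0 expr0 !mulr1 divfK// expr1.
- by move=> x _; exact: is_deriveXc.
- move=> x xh; case/andP: (xh) => x0 xh'.
  have -> : M / 6 * 3 * x ^+ 2 = M * x ^+ 2 / 2 by field.
  have sub y : a <= y <= a + x -> a <= y <= a + h.
    by move=> /andP[-> /le_trans]; apply; rewrite lerD2l.
  by apply: (@taylor2_ge0 f1 f2 f3 a x M x0) => y /sub; [exact: f12|exact: f23|exact: f3M].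
- by rewrite addr0 subrr !mulr0 expr2 !mulr0 !subr0.
- by rewrite exprS mul0r mulr0.
Qed.

Lemma taylor3 (f0 f1 f2 f3 : R -> R) a h M :
  (forall x : R, is_derive x 1 f0 (f1 x)) ->
  (forall x : R, is_derive x 1 f1 (f2 x)) ->
  (forall x : R, is_derive x 1 f2 (f3 x)) ->
  (forall x, `|x - a| <= `|h| -> `|f3 x| <= M) ->
  `|f0 (a + h) - f0 a - f1 a * h - f2 a / 2 * h ^+ 2| <= M * `|h| ^+ 3 / 6.
Proof.
move=> f01 f12 f23 f3M; have [h0|h0] := leP 0 h.
  rewrite (ger0_norm h0); apply: (@taylor3_ge0 f0 f1 f2 f3 a h M h0) => x /andP[ax xh].
  by apply: f3M; rewrite (ger0_norm h0) ger0_norm ?subr_ge0// lerBlDl.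
have dN (g dg : R -> R) : (forall x : R, is_derive x 1 g (dg x)) ->
    forall x : R, is_derive x 1 (fun y => g (- y)) (- dg (- x)).
  move=> gdg x; rewrite -mulrN1; exact: is_derive1_comp.
have dNN (g dg : R -> R) : (forall x : R, is_derive x 1 g (dg x)) ->
    forall x : R, is_derive x 1 (fun y => - g (- y)) (dg (- x)).
  move=> gdg x; rewrite -[dg _]opprK; apply: is_deriveN; exact: dN.
have h0' : 0 <= - h by rewrite oppr_ge0 ltW.
(* A negative step is reflected: the functions (-1)^k f_k(-y) are again successive derivatives, with
   base point -a and step -h > 0. *)
have := @taylor3_ge0 (fun y => f0 (- y)) (fun y => - f1 (- y))
  (fun y => f2 (- y)) (fun y => - f3 (- y)) (- a) (- h) M h0'
  (fun x _ => dN _ _ f01 x) (fun x _ => dNN _ _ f12 x) (fun x _ => dN _ _ f23 x).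
rewrite -opprD !opprK mulrNN sqrrN (ltr0_norm h0); apply => x xh.
rewrite normrN; apply: f3M.
by rewrite (ltr0_norm h0) ler0_norm; lra.
Qed.

End taylor.

Section heat_kernel.
Context {R : realType}.
Implicit Types (x y z s h th v w V : R).

(* A solution of [d/ds u = 1/2 d^2/dy^2 u] that tends to the indicator of [z < y] as
   [s] tends to 0. *)
Definition heat z s y : R := gtail ((z - y) / Num.sqrt s).

Let is_derive_space (H : R -> R) dH z s y :
  (forall w : R, is_derive w 1 H (dH w)) ->
  is_derive y 1 (fun y => H ((z - y) / Num.sqrt s))
    (dH ((z - y) / Num.sqrt s) * - (Num.sqrt s)^-1).
Proof.
move=> HdH; apply: is_derive1_comp.
have -> : (fun y => (z - y) / Num.sqrt s) =
    (cst z - @id R) * cst (Num.sqrt s)^-1 by [].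
by apply: is_derive_eq; rewrite /GRing.scale/= ?fctE; ring.
Qed.

Let is_derive_time (H : R -> R) dH z s y : 0 < s ->
  (forall w : R, is_derive w 1 H (dH w)) ->
  is_derive s 1 (fun s => H ((z - y) / Num.sqrt s))
    (dH ((z - y) / Num.sqrt s) * - ((z - y) / Num.sqrt s / (2 * s))).
Proof.
move=> s0 HdH; apply: is_derive1_comp.
have sq0 : Num.sqrt s != 0 by rewrite gt_eqF// sqrtr_gt0.
have dsq := is_derive1_sqrt s0.
have dV : is_derive s 1 (fun s => (Num.sqrt s)^-1)
    (- (Num.sqrt s) ^- 2 *: (2 * Num.sqrt s)^-1) by exact: is_deriveV.
have -> : (fun s => (z - y) / Num.sqrt s) =
    cst (z - y) * (fun s => (Num.sqrt s)^-1) by [].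
apply: is_derive_eq; rewrite /GRing.scale/= ?fctE.
rewrite -[X in _ = - (_ / _ / (_ * X))](sqr_sqrtr (ltW s0)).
by field.
Qed.

(** At w = (z - y) / sqrt s, this over s is the second space derivative of [heat], and this over 2s
    is the time derivative: the heat equation. *)
Let gmoment w : R := w * gdensity w.

Let is_derive_gmoment w : is_derive w 1 gmoment ((1 - w ^+ 2) * gdensity w).
Proof.
have -> : gmoment = @id R * gdensity by [].
have := is_derive_gdensity w => ?.
by apply: is_derive_eq; rewrite /GRing.scale/= ?fctE; ring.
Qed.

(* [3 r <= 9/2 + r^2/2] with [r = |w - v|] absorbs the cubic factor. *)
Lemma tilt_bound w v : 0 <= v ->
  (1 + `|w|) ^+ 3 * expR (- w ^+ 2 / 2) <=
  expR (9 / 2) * (1 + v) ^+ 3 * expR (- (v * w) + v ^+ 2 / 2).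
Proof.
move=> v0; set r := `|w - v|.
have r0 : 0 <= r by exact: normr_ge0.
have wr : `|w| <= r + v.
  by have := ler_normD (w - v) v; rewrite subrK (ger0_norm v0).
have h1 : 1 + `|w| <= expR r * (1 + v).
  have := expR_ge1Dx r; nra.
have h2 : expR r ^+ 3 <= expR (9 / 2 + (w - v) ^+ 2 / 2).
  rewrite -expRM_natl ler_expR -(real_normK (num_real (w - v))) -/r.
  have := sqr_ge0 (r - 3); nra.
have -> : expR (- (v * w) + v ^+ 2 / 2) =
    expR ((w - v) ^+ 2 / 2) * expR (- w ^+ 2 / 2).
  by rewrite -expRD; congr expR; field.
rewrite mulrA; apply: ler_wpM2r; first exact: expR_ge0.
have -> : expR (9 / 2) * (1 + v) ^+ 3 * expR ((w - v) ^+ 2 / 2) =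
  expR (9 / 2 + (w - v) ^+ 2 / 2) * (1 + v) ^+ 3 by rewrite expRD; ring.
apply: (@le_trans _ _ (expR r ^+ 3 * (1 + v) ^+ 3)).
  by rewrite -exprMn lerXn2r// nnegrE ?addr_ge0// mulr_ge0 ?expR_ge0// addr_ge0.
by apply: ler_wpM2r => //; rewrite exprn_ge0// addr_ge0.
Qed.

Let poly_density_bound (p w v : R) : 0 <= v -> `|p| <= (1 + `|w|) ^+ 3 ->
  `|p * gdensity w| <=
  expR (9 / 2) * (1 + v) ^+ 3 * expR (- (v * w) + v ^+ 2 / 2).
Proof.
move=> v0 pw; apply: le_trans (tilt_bound w v0).
by rewrite normrM ler_pM// gtr0_norm ?gdensity_gt0// gdensity_le_expR.
Qed.

(** Common constant of the remainders in space and in time. The power s0^(3/2) is the scale of the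
    third space derivative, V bounds th * sqrt s, and [expR 1] absorbs the change of the exponential
    between the base point and the intermediate point of Taylor's formula. *)
Definition heat_err V s0 : R :=
  expR (9 / 2) * expR 1 * (1 + V) ^+ 3 / (s0 * Num.sqrt s0).

Lemma heat_err_ge0 V s0 : 0 <= V -> 0 <= s0 -> 0 <= heat_err V s0.
Proof.
move=> V0 s00; apply: divr_ge0; last by rewrite mulr_ge0 ?sqrtr_ge0.
by apply: mulr_ge0; [rewrite mulr_ge0 ?expR_ge0|rewrite exprn_ge0 ?addr_ge0].
Qed.

(** [tilt_bound] with v = th * sqrt s: in the original variables its exponential is exp(th (y - z) +
    th^2 s / 2), whose rate in y is the same for all s. *)
Let heat_err_bound V s0 s th p w e x y z c : 1 <= s0 -> s0 <= s -> 0 <= th ->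
  th * Num.sqrt s <= V -> `|p| <= (1 + `|w|) ^+ 3 -> w = (z - y) / Num.sqrt s ->
  - (th * (z - y)) + th ^+ 2 * s / 2 <= e + 1 ->
  s0 * Num.sqrt s0 <= c ->
  `|p * gdensity w / c| <= heat_err V s0 * expR e.
Proof.
move=> s1 ss t0 tV pw wE ew sc.
have sq0 : 0 < Num.sqrt s by rewrite sqrtr_gt0; lra.
have s00 : 0 < s0 * Num.sqrt s0 by rewrite mulr_gt0 ?sqrtr_gt0; lra.
have v0 : 0 <= th * Num.sqrt s by rewrite mulr_ge0 ?sqrtr_ge0.
have c0 : 0 < c by exact: lt_le_trans sc.
rewrite normrM normfV (gtr0_norm c0) ler_pdivrMr//.
apply: (le_trans (poly_density_bound v0 pw)).
have -> : - (th * Num.sqrt s * w) + (th * Num.sqrt s) ^+ 2 / 2 =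
   - (th * (z - y)) + th ^+ 2 * s / 2.
  rewrite wE exprMn sqr_sqrtr; last lra.
  by field; rewrite gt_eqF.
apply: (@le_trans _ _ (expR (9 / 2) * (1 + V) ^+ 3 * expR (e + 1))).
  apply: ler_pM; rewrite ?ler_expR ?expR_ge0//.
    by rewrite mulr_ge0 ?expR_ge0// exprn_ge0// addr_ge0.
  apply: ler_wpM2l; rewrite ?expR_ge0// lerXn2r// ?nnegrE ?addr_ge0//; lra.
rewrite /heat_err expRD.
set E := _ / (s0 * _); set X := expR e.
have -> : expR (9 / 2) * (1 + V) ^+ 3 * (X * expR 1) =
   E * X * (s0 * Num.sqrt s0).
  by rewrite /E; field; apply/andP; split; rewrite gt_eqF// ?sqrtr_gt0; lra.
apply: ler_wpM2l => //; rewrite mulr_ge0 ?expR_ge0//.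
by apply: heat_err_ge0; [exact: le_trans tV|lra].
Qed.

Lemma heat_space z s0 s y th V : 1 <= s0 -> s0 <= s -> 0 <= th <= 1 ->
  th * Num.sqrt s <= V ->
  forall h, `|h| <= 2^-1 ->
  `|heat z s (y + h) - heat z s y
    - gdensity ((z - y) / Num.sqrt s) / Num.sqrt s * h
    - (z - y) / Num.sqrt s * gdensity ((z - y) / Num.sqrt s) / s / 2 * h ^+ 2|
  <= heat_err V s0 * expR (- (th * (z - y)) + th ^+ 2 * s / 2).
Proof.
move=> s1 ss /andP[t0 t1] tV h h2.
have s0' : 0 < s by lra.
have sq0 : 0 < Num.sqrt s by rewrite sqrtr_gt0.
set B := _ * expR _.
have B0 : 0 <= B.
  rewrite mulr_ge0 ?expR_ge0// heat_err_ge0//; last lra.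
  by rewrite (le_trans _ tV)// mulr_ge0// ltW.
apply: (@le_trans _ _ (B * `|h| ^+ 3 / 6)); last first.
  have k1 : `|h| ^+ 3 <= 1 by rewrite exprn_ile1// (le_trans h2)//; lra.
  have := mulr_ge0 B0 (_ : 0 <= 1 - `|h| ^+ 3); rewrite subr_ge0 => /(_ k1).
  by lra.
apply: (@taylor3 R (heat z s)
   (fun y => gdensity ((z - y) / Num.sqrt s) / Num.sqrt s)
   (fun y => (z - y) / Num.sqrt s * gdensity ((z - y) / Num.sqrt s) / s)
   (fun y => - ((1 - ((z - y) / Num.sqrt s) ^+ 2) *
              gdensity ((z - y) / Num.sqrt s) / (s * Num.sqrt s)))).
- move=> x; apply: is_derive_eq (is_derive_space z s x is_derive_gtail) _.
  by rewrite mulrNN.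
- move=> x; have dg := is_derive_space z s x is_derive_gdensity.
  have -> : (fun y => gdensity ((z - y) / Num.sqrt s) / Num.sqrt s) =
    (fun y => gdensity ((z - y) / Num.sqrt s)) * cst (Num.sqrt s)^-1 by [].
  apply: is_derive_eq; rewrite /GRing.scale/= ?fctE.
  rewrite -[X in _ = _ / X](sqr_sqrtr (ltW s0')).
  by field; rewrite gt_eqF.
- move=> x; have dg := is_derive_space z s x is_derive_gmoment.
  have -> : (fun y => (z - y) / Num.sqrt s * gdensity ((z - y) / Num.sqrt s) / s) =
    (fun y => gmoment ((z - y) / Num.sqrt s)) * cst s^-1 by [].
  apply: is_derive_eq; rewrite /GRing.scale/= ?fctE.
  by field; rewrite !gt_eqF.
- move=> x xy; rewrite normrN; apply: (@heat_err_bound _ _ s th _ _ _ x x z) => //.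
  + set w := (z - x) / _; have w0 := normr_ge0 w.
    rewrite (le_trans (ler_normB _ _))// normr1 normrX; nra.
  + move: (le_trans xy h2); rewrite ler_norml => /andP[h3 h4].
    nra.
  + have q : Num.sqrt s0 <= Num.sqrt s by rewrite ler_wsqrtr.
    by apply: ler_pM; rewrite ?sqrtr_ge0//; lra.
Qed.

Lemma heat_time z s0 s y th V h : 1 <= s0 -> s0 <= s -> 0 <= th <= 1 ->
  0 <= h <= 4^-1 -> th * Num.sqrt (s + h) <= V ->
  `|heat z (s + h) y - heat z s y
    - (z - y) / Num.sqrt s * gdensity ((z - y) / Num.sqrt s) / s / 2 * h|
  <= heat_err V s0 * expR (- (th * (z - y)) + th ^+ 2 * s / 2).
Proof.
move=> s1 ss /andP[t0 t1] /andP[h0 h4] tV.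
have s0' : 0 < s by lra.
set B := _ * expR _.
have B0 : 0 <= B.
  rewrite mulr_ge0 ?expR_ge0// heat_err_ge0//; last lra.
  by rewrite (le_trans _ tV)// mulr_ge0// sqrtr_ge0.
apply: (@le_trans _ _ (B * h ^+ 2 / 2)); last first.
  have k1 : h ^+ 2 <= 1 by rewrite exprn_ile1//; lra.
  have := mulr_ge0 B0 (_ : 0 <= 1 - h ^+ 2); rewrite subr_ge0 => /(_ k1).
  by lra.
have H2 := (@taylor2_ge0 R (fun s => heat z s y)
   (fun s => (z - y) / Num.sqrt s * gdensity ((z - y) / Num.sqrt s) / s / 2)
   (fun s => (((z - y) / Num.sqrt s) ^+ 3 - 3 * ((z - y) / Num.sqrt s)) *
              gdensity ((z - y) / Num.sqrt s) / (4 * s ^+ 2)) s h B h0); apply: H2.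
- move=> x /andP[sx _]; have x0 : 0 < x by lra.
  apply: is_derive_eq (is_derive_time z y x0 is_derive_gtail) _.
  by rewrite /=; field; rewrite !gt_eqF// sqrtr_gt0.
- move=> x /andP[sx _]; have x0 : 0 < x by lra.
  have dg := is_derive_time z y x0 is_derive_gmoment.
  have dV : is_derive x 1 (fun s : R => s^-1) (- x ^- 2 *: 1).
    by apply: (@is_deriveV R id) => //; exact: lt0r_neq0.
  have -> : (fun s => (z - y) / Num.sqrt s * gdensity ((z - y) / Num.sqrt s) / s / 2) =
    (fun s => gmoment ((z - y) / Num.sqrt s)) * (fun s => s^-1) * cst 2^-1 by [].
  apply: is_derive_eq; rewrite /GRing.scale/= ?fctE /gmoment.
  have xq : Num.sqrt x != 0 by rewrite gt_eqF// sqrtr_gt0.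
  by field; rewrite xq (gt_eqF x0).
- move=> x /andP[sx xh]; apply: (@heat_err_bound _ _ x th _ _ _ y y z) => //.
  + lra.
  + by rewrite (le_trans _ tV)// ler_wpM2l// ler_wsqrtr.
  + set w := (z - y) / _; have w0 := normr_ge0 w.
    rewrite (le_trans (ler_normB _ _))// normrX (normrM 3) (@ger0_norm _ (3 : R))//.
    nra.
  + nra.
  + have r1 : 1 <= Num.sqrt s0 by rewrite -[leLHS]sqrtr1 ler_wsqrtr.
    have : Num.sqrt s0 ^+ 2 = s0 by rewrite sqr_sqrtr//; lra.
    move: (Num.sqrt s0) r1 => r r1 rE; have rs : r <= s0 by nra.
    by nra.
Qed.

End heat_kernel.

(** * Comparison of sums of rewards with the heat flow *)

Section averaging.
Context {R : realType} (nu : probability R R).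
Local Open Scope ereal_scope.
Implicit Types (f g : R -> \bar R) (m : nat).

(* 1/2 is the mean of the rewards. *)
Definition avg f (y : R) : \bar R := \int[nu]_x f (y + (x - 2^-1))%R.

(** For nonnegative functions with values in the extended reals, averages always exist, so the
    iterates are monotone and additive without integrability conditions. *)
Definition nnm f := (forall y, 0 <= f y) /\ measurable_fun setT f.

Lemma nnm_EFin (f : R -> R) : (forall y, 0 <= f y)%R -> measurable_fun setT f ->
  nnm (EFin \o f).
Proof. by move=> f0 mf; split=> [y|]; [rewrite lee_fin|exact/measurable_EFinP]. Qed.

Lemma nnmD f g : nnm f -> nnm g -> nnm (f \+ g).
Proof.
by move=> [f0 mf] [g0 mg]; split=> [y|]; [exact: adde_ge0|exact: emeasurable_funD].
Qed.

Let mshift (y : R) : measurable_fun setT (fun x : R => y + (x - 2^-1))%R.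
Proof. by apply: measurable_funD => //; apply: measurable_funB. Qed.

Let mcomp f y : measurable_fun setT f ->
  measurable_fun setT (fun x : R => f (y + (x - 2^-1))%R).
Proof. by move=> mf; exact: measurableT_comp mf (mshift y). Qed.

Lemma nnm_avg f : nnm f -> nnm (avg f).
Proof.
move=> [f0 mf]; split=> [y|]; first exact: integral_ge0.
have := @measurable_fun_fubini_tonelli_F _ _ _ _ R nu
  (fun p : R * R => f (p.1 + (p.2 - 2^-1))%R).
apply => //.
apply: (measurableT_comp mf).
apply: measurable_funD => //; apply: measurable_funB => //.
Qed.

Lemma avg_le f g : nnm f -> nnm g -> (forall y, f y <= g y) ->
  forall y, avg f y <= avg g y.
Proof.
move=> [f0 mf] [g0 mg] fg y.
by apply: ge0_le_integral => //; exact: mcomp.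
Qed.

Lemma avgD f g y : nnm f -> nnm g -> avg (f \+ g) y = avg f y + avg g y.
Proof.
move=> [f0 mf] [g0 mg].
by rewrite /avg -ge0_integralD//; exact: mcomp.
Qed.

Lemma avgZ (c : R) f y : (0 <= c)%R -> nnm f ->
  avg (fun x => c%:E * f x) y = c%:E * avg f y.
Proof.
by move=> c0 [f0 mf]; rewrite /avg ge0_integralZl_EFin//; exact: mcomp.
Qed.

Lemma nnm_iter_avg m f : nnm f -> nnm (iter m avg f).
Proof. by move=> nf; elim: m => // m ih; exact: nnm_avg. Qed.

Lemma iter_avg_le m f g : nnm f -> nnm g -> (forall y, f y <= g y) ->
  forall y, iter m avg f y <= iter m avg g y.
Proof.
move=> nf ng fg; elim: m => [//|m ih] y.
by apply: avg_le => //; exact: nnm_iter_avg.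
Qed.

Lemma iter_avgD m f g y : nnm f -> nnm g ->
  iter m avg (f \+ g) y = iter m avg f y + iter m avg g y.
Proof.
move=> nf ng; elim: m y => [//|m ih] y /=.
rewrite -avgD; [|exact: nnm_iter_avg|exact: nnm_iter_avg].
by congr avg; apply/funext => x; exact: ih.
Qed.

Lemma nnmZ (c : R) f : (0 <= c)%R -> nnm f -> nnm (fun x => c%:E * f x).
Proof.
move=> c0 [f0 mf]; split=> [y|]; first by rewrite mule_ge0.
exact: measurable_funeM.
Qed.

Lemma iter_avgZ m (c : R) f y : (0 <= c)%R -> nnm f ->
  iter m avg (fun x => c%:E * f x) y = c%:E * iter m avg f y.
Proof.
move=> c0 nf; elim: m y => [//|m ih] y /=.
rewrite -avgZ//; last exact: nnm_iter_avg.
by congr avg; apply/funext => x; exact: ih.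
Qed.

Lemma iter_avg_le1 m f : nnm f -> (forall y, f y <= 1) ->
  forall y, iter m avg f y <= 1.
Proof.
move=> nf f1; elim: m => [//|m ih] y /=.
have n1 : nnm (cst 1) by split=> [?|]; [exact: lee01|exact: measurable_cst].
apply: le_trans (avg_le (nnm_iter_avg m nf) n1 ih y) _.
by rewrite /avg integral_cst// mul1e; exact: probability_le1.
Qed.

End averaging.

Section lindeberg.
Context {R : realType} (nu : probability R R) (v : R).
Local Notation I01 := [set` `[(0 : R), 1]].
Hypothesis nu01 : nu I01 = 1%E.
Hypothesis nu_mean : \int[nu]_(x in I01) (x - 2^-1) = 0.
Hypothesis nu_var : \int[nu]_(x in I01) ((x - 2^-1) ^+ 2) = v.

Implicit Types (x y z s h th V : R) (m : nat).

Let bnd_int (f : R -> R) M : measurable_fun I01 f ->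
  (forall x, x \in I01 -> `|f x| <= M) ->
  nu.-integrable I01 (EFin \o f).
Proof.
move=> mf fM; apply: measurable_bounded_integrable => //.
  by rewrite [ltLHS]nu01 ltry.
exists M; split; first exact: num_real.
by move=> N MN x /= x01; rewrite (le_trans (fM x _)) ?mem_setE// ltW.
Qed.

Let itv_half x : x \in I01 -> `|x - 2^-1| <= 2^-1.
Proof.
by rewrite mem_setE in_itv/= => /andP[x0 x1]; rewrite ler_norml; lra.
Qed.

Let integrable_dev : nu.-integrable I01 (EFin \o (fun x : R => x - 2^-1)).
Proof.
apply: (bnd_int (M := 2^-1)); last by move=> x; exact: itv_half.
exact: measurable_funB.
Qed.

Let integrable_dev2 :
  nu.-integrable I01 (EFin \o (fun x : R => (x - 2^-1) ^+ 2)).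
Proof.
apply: (bnd_int (M := 1)); last first.
  move=> x /itv_half; rewrite normrX => h.
  by rewrite exprn_ile1// (le_trans h)//; lra.
by apply: measurable_funX; exact: measurable_funB.
Qed.

Lemma variance_itv : 0 <= v <= 4^-1.
Proof.
rewrite -nu_var; apply/andP; split.
  by apply: Rintegral_ge0 => x _; exact: sqr_ge0.
have -> : 4^-1 = \int[nu]_(x in I01) (4^-1 : R).
  by rewrite Rintegral_cst// [X in fine X]nu01 mulr1.
apply: le_Rintegral => //.
- apply: (bnd_int (M := 4^-1)) => // x _; rewrite ger0_norm; lra.
- by move=> x /mem_set /itv_half; rewrite ler_norml => /andP[? ?]; nra.
Qed.

Let avgE (f : R -> \bar R) y : nnm f ->
  avg nu f y = (\int[nu]_(x in I01) f (y + (x - 2^-1))%R)%E.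
Proof.
move=> [f0 mf].
have mC : measurable (~` I01 : set R).
  by apply: measurableC; exact: measurable_itv.
rewrite /avg (@ge0_negligible_integral _ _ _ _ _ (~` I01)) //.
- by rewrite setDE setCK setTI.
- apply: (measurableT_comp mf).
  by apply: measurable_funD => //; apply: measurable_funB.
- by have := probability_setC nu (measurable_itv `[(0 : R), 1]); rewrite nu01 subee.
Qed.

(** The linear term averages to 0 because the mean reward is 1/2. The approximation itself bounds f
    on the range of the rewards, hence f is integrable there. *)
Lemma avg_quadratic (f : R -> R) y a b c M :
  measurable_fun setT f -> (forall x, 0 <= f x) ->
  (forall h, `|h| <= 2^-1 -> `|f (y + h) - (a + b * h + c * h ^+ 2)| <= M) ->
  exists2 r, avg nu (EFin \o f) y = r%:E & `|r - (a + c * v)| <= M.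
Proof.
move=> mf f0 fM.
pose q x := a + b * (x - 2^-1) + c * (x - 2^-1) ^+ 2.
have mfy : measurable_fun I01 (fun x : R => f (y + (x - 2^-1))).
  apply: measurable_funTS; apply: (measurableT_comp mf).
  by apply: measurable_funD => //; apply: measurable_funB.
have bint := integrableZl (measurable_itv `[(0 : R), 1]) b integrable_dev.
have cint := integrableZl (measurable_itv `[(0 : R), 1]) c integrable_dev2.
have kint k : nu.-integrable I01 (EFin \o cst k).
  by apply: (bnd_int (M := `|k|)) => //; exact: measurable_cst.
have abint k : nu.-integrable I01
    (EFin \o (fun x : R => k + b * (x - 2^-1))).
  exact: integrableD (kint k) bint.
have qint k : nu.-integrable I01
    (EFin \o (fun x : R => k + b * (x - 2^-1) + c * (x - 2^-1) ^+ 2)).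
  exact: integrableD (abint k) cint.
have Eq k : \int[nu]_(x in I01)
    (k + b * (x - 2^-1) + c * (x - 2^-1) ^+ 2) = k + c * v.
  rewrite RintegralD//.
  rewrite RintegralD//; last exact: kint.
  rewrite !RintegralZl//.
  by rewrite nu_mean nu_var mulr0 addr0 Rintegral_cst// [X in fine X]nu01 mulr1.
have fint : nu.-integrable I01
    (EFin \o (fun x : R => f (y + (x - 2^-1)))).
  apply: (bnd_int (M := `|a| + `|b| + `|c| + M)) => // x /itv_half x2.
  have := fM _ x2; set h := x - 2^-1 in x2 *; set F := f _ => FM.
  have h1 : `|h| <= 1 by rewrite (le_trans x2)//; lra.
  have -> : F = a + b * h + c * h ^+ 2 + (F - (a + b * h + c * h ^+ 2)) by ring.
  rewrite (le_trans (ler_normD _ _))// lerD// (le_trans (ler_normD _ _))// lerD//.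
    rewrite (le_trans (ler_normD _ _))// lerD// normrM.
    by rewrite ler_piMr.
  by rewrite normrM normrX ler_piMr// exprn_ile1.
set r := \int[nu]_(x in I01) f (y + (x - 2^-1)).
exists r; rewrite {}/r.
  rewrite avgE; last exact: nnm_EFin.
  by rewrite /Rintegral fineK// integrable_fin_num.
rewrite ler_norml; apply/andP; split.
  rewrite lerBrDl.
  rewrite (_ : a + c * v - M = (a - M) + c * v); last by ring.
  rewrite -(Eq (a - M)); apply: le_Rintegral => //.
  move=> x /mem_set /itv_half /fM; rewrite ler_norml => /andP[+ _].
  by rewrite lerBrDl; lra.
rewrite lerBlDl (_ : a + c * v + M = (a + M) + c * v); last by ring.
rewrite -(Eq (a + M)); apply: le_Rintegral => //.
move=> x /mem_set /itv_half /fM; rewrite ler_norml => /andP[_].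
by rewrite lerBlDl; lra.
Qed.

Lemma measurable_heat (z s : R) : measurable_fun setT (heat z s).
Proof.
apply: nondecreasing_measurable => // x y xy.
by apply: gtail_nonincr; rewrite ler_wpM2r ?invr_ge0 ?sqrtr_ge0// lerB.
Qed.

Let nnm_heat z s : nnm (EFin \o heat z s).
Proof. apply: nnm_EFin; [move=> y; exact: gtail_ge0|exact: measurable_heat]. Qed.

(** The constant c sits in the exponent because averaging is bounded by an increase of c alone; the
    iterates then follow by induction on their number. *)
Definition tilt K c th y : R := K * expR (c + th * y).

Let measurable_tilt K c th : measurable_fun setT (tilt K c th).
Proof.
apply: measurable_funM => //; apply: measurableT_comp => //.
by apply: measurable_funD => //; apply: measurable_funM.
Qed.

Let nnm_exp (K c th : R) : 0 <= K -> nnm (EFin \o tilt K c th).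
Proof.
move=> K0; apply: nnm_EFin (measurable_tilt _ _ _).
by move=> y; rewrite mulr_ge0 ?expR_ge0.
Qed.

Lemma avg_exp (th K c y : R) : 0 <= th <= 1 -> 0 <= K ->
  (avg nu (EFin \o tilt K c th) y <=
   (K * expR (c + (th ^+ 2 * v / 2 + th ^+ 3) + th * y))%:E)%E.
Proof.
move=> /andP[t0 t1] K0.
pose a := K * expR (c + th * y).
have a0 : 0 <= a by rewrite mulr_ge0 ?expR_ge0.
have dexp : forall x : R, is_derive x 1 expR (expR x) by exact: is_derive_expR.
have [h h2|r -> ] := @avg_quadratic (tilt K c th) y
   a (a * th) (a * th ^+ 2 / 2) (a * th ^+ 3)
   (measurable_tilt K c th)
   (fun y => mulr_ge0 K0 (expR_ge0 _)).
  (* The third derivative is at most 2 for arguments up to 1/2, since exp(-x) >= 1 - x >= 1/2. *)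
  have := @taylor3 R expR expR expR expR 0 (th * h) 2 dexp dexp dexp.
  rewrite add0r expR0 => H.
  rewrite /tilt (_ : _ - _ = a * (expR (th * h) - 1 - 1 * (th * h) - 1 / 2 * (th * h) ^+ 2)).
    rewrite normrM (ger0_norm a0) ler_wpM2l//.
    have th2 : `|th * h| <= 2^-1.
      by rewrite normrM (ger0_norm t0) -[leRHS]mul1r ler_pM.
    apply: (le_trans (H _)).
      move=> x; rewrite subr0 => xh; rewrite gtr0_norm ?expR_gt0//.
      rewrite -[leLHS]invrK -expRN -[leRHS]invrK lef_pV2 ?posrE ?expR_gt0//.
      have := expR_ge1Dx (- x); have := ler_norm x.
      by move: (le_trans xh th2); lra.
    rewrite normrM exprMn (ger0_norm t0).
    have h3 : `|h| ^+ 3 <= 1 by rewrite exprn_ile1// (le_trans h2)//; lra.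
    have := exprn_ge0 3 t0; move: (th ^+ 3) (`|h| ^+ 3) h3 (exprn_ge0 3 (normr_ge0 h)).
    by move=> A B *; nra.
  by rewrite mulrDr addrA expRD /a; field.
rewrite ler_norml => /andP[_ rM]; rewrite lee_fin.
apply: (@le_trans _ _ (a * (1 + (th ^+ 2 * v / 2 + th ^+ 3)))).
  by rewrite lerBlDl in rM; rewrite (le_trans rM)// le_eqVlt; apply/orP; left;
    apply/eqP; field.
rewrite /a -mulrA ler_wpM2l//.
rewrite (_ : c + _ + _ = (c + th * y) + (th ^+ 2 * v / 2 + th ^+ 3)); last by ring.
by rewrite [leRHS]expRD ler_wpM2l ?expR_ge0// expR_ge1Dx.
Qed.

Lemma iter_avg_exp m (th K c y : R) : 0 <= th <= 1 -> 0 <= K ->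
  (iter m (avg nu) (EFin \o tilt K c th) y <=
   (K * expR (c + m%:R * (th ^+ 2 * v / 2 + th ^+ 3) + th * y))%:E)%E.
Proof.
move=> t01 K0; elim: m c y => [|m ih] c y; first by rewrite mul0r addr0.
rewrite iterSr.
apply: (@le_trans _ _ (iter m (avg nu) (EFin \o
    tilt K (c + (th ^+ 2 * v / 2 + th ^+ 3)) th) y)).
  apply: iter_avg_le => [|| x]; [|exact: nnm_exp|exact: avg_exp].
  by apply: nnm_avg; exact: nnm_exp.
rewrite (le_trans (ih _ _))// lee_fin ler_wpM2l// ler_expR lerD2r.
by rewrite -addrA lerD2l -[m.+1%:R]natr1; lra.
Qed.

(** The coefficient of h^2 in [heat_space] is the coefficient of h in [heat_time]. After averaging,
    h^2 becomes v, so both expansions have the same main term, and the factor 2 counts their two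
    remainders. *)
Lemma heat_step z s0 s th V y : 1 <= s0 -> s0 <= s -> 0 <= th <= 1 ->
  th * Num.sqrt (s + v) <= V ->
  exists2 r, avg nu (EFin \o heat z s) y = r%:E &
    `|r - heat z (s + v) y| <=
    2 * heat_err V s0 * expR (- (th * z) + th ^+ 2 * s / 2 + th * y).
Proof.
move=> s1 ss t01 tV; have /andP[v0 v4] := variance_itv.
have /andP[t0 _] := t01.
have tV' : th * Num.sqrt s <= V.
  by rewrite (le_trans _ tV)// ler_wpM2l// ler_wsqrtr// lerDl.
pose g := gdensity ((z - y) / Num.sqrt s).
have [h h2|r rE rM] := @avg_quadratic (heat z s) y (heat z s y) (g / Num.sqrt s)
  ((z - y) / Num.sqrt s * g / s / 2)
  (heat_err V s0 * expR (- (th * (z - y)) + th ^+ 2 * s / 2))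
  (measurable_heat z s) (fun x => gtail_ge0 _).
  have := heat_space z y s1 ss t01 tV' h2.
  by rewrite !opprD !addrA.
exists r => //.
have := @heat_time R z s0 s y th V v s1 ss t01 (variance_itv) tV.
rewrite -/g (_ : - (th * z) + th ^+ 2 * s / 2 + th * y =
  - (th * (z - y)) + th ^+ 2 * s / 2); last by ring.
move: rM; set B := _ * expR _; set k := _ * v => rM kM.
have -> : r - heat z (s + v) y = (r - (heat z s y + k)) -
  (heat z (s + v) y - heat z s y - k) by ring.
rewrite (le_trans (ler_normB _ _))// (le_trans (lerD rM kM))//.
by rewrite -mulrA -/B; lra.
Qed.

(* The errors of the single steps are multiples of exponentials, which [avg] merely
   rescales, so that they can be summed along the [m] steps. *)
Lemma lindeberg z s0 s th V m y : 1 <= s0 -> s0 <= s -> 0 <= th <= 1 ->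
  th * Num.sqrt (s + m%:R * v) <= V -> 0 <= V ->
  let e := (m%:R * (2 * heat_err V s0 *
    expR (- (th * z) + th ^+ 2 * (s + m%:R * v) / 2 + m%:R * th ^+ 3 + th * y))) in
  (iter m (avg nu) (EFin \o heat z s) y <= (heat z (s + m%:R * v) y + e)%:E)%E /\
  ((heat z (s + m%:R * v) y)%:E <= iter m (avg nu) (EFin \o heat z s) y + e%:E)%E.
Proof.
move=> s1 + t01 + V0; have /andP[v0 v4] := variance_itv.
have /andP[t0 _] := t01.
have t20 : 0 <= th ^+ 2 by rewrite exprn_ge0.
have t30 : 0 <= th ^+ 3 by rewrite exprn_ge0.
elim: m s y => [|m ih] s y ss tV /=.
  by rewrite !mul0r !addr0.
have mv : s + m.+1%:R * v = s + v + m%:R * v by rewrite -natr1; ring.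
have mv0 : 0 <= m%:R * v by rewrite mulr_ge0.
have tV' : th * Num.sqrt (s + v) <= V.
  by rewrite (le_trans _ tV)// ler_wpM2l// ler_wsqrtr// mv lerDl.
have [|| ih1 ih2] := ih (s + v) y.
- by rewrite (le_trans ss)// lerDl.
- by rewrite -mv.
(* The innermost average is replaced by the flow over time v, at the cost [es]. The induction
   hypothesis then starts from s + v, while [es] is averaged m more times. *)
rewrite -iterS iterSr mv.
set K := 2 * heat_err V s0 in ih1 ih2 *.
have K0 : 0 <= K.
  by rewrite mulr_ge0// heat_err_ge0//; lra.
pose es := tilt K (- (th * z) + th ^+ 2 * s / 2) th.
have nes : nnm (EFin \o es) by exact: nnm_exp.
pose E k := expR (- (th * z) + th ^+ 2 * (s + v + m%:R * v) / 2
   + k%:R * th ^+ 3 + th * y).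
have EM : E m <= E m.+1.
  by rewrite ler_expR lerD2r lerD2l ler_wpM2r// ler_nat.
have iesM : (iter m (avg nu) (EFin \o es) y <= (K * E m.+1)%:E)%E.
  apply: (le_trans (iter_avg_exp _ _ _ t01 K0)).
  rewrite lee_fin ler_wpM2l// ler_expR lerD2r -[m.+1%:R]natr1.
  have : 0 <= th ^+ 2 * v by rewrite mulr_ge0.
  lra.
rewrite -/(E m) in ih1 ih2; rewrite -/(E m.+1).
have KE0 : 0 <= K * E m.+1 by rewrite mulr_ge0 ?expR_ge0.
have eE : m%:R * (K * E m) + K * E m.+1 <= m.+1%:R * (K * E m.+1).
  rewrite -natr1 mulrDl mul1r lerD2r ler_wpM2l// ler_wpM2l//.
split.
  apply: (@le_trans _ _ (iter m (avg nu) ((EFin \o heat z (s + v)) \+ (EFin \o es)) y)).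
    apply: iter_avg_le; first exact: nnm_avg.
      exact: nnmD.
    move=> x; have [r -> ] := heat_step z x s1 ss t01 tV'.
    rewrite ler_norml => /andP[_]; rewrite lerBlDl => rM.
    by rewrite /= -EFinD lee_fin.
  rewrite iter_avgD//.
  apply: (le_trans (leeD ih1 iesM)).
  by rewrite -EFinD lee_fin -addrA lerD2l.
apply: (le_trans ih2).
apply: (@le_trans _ _ (iter m (avg nu) (avg nu (EFin \o heat z s)) y
    + (K * E m.+1)%:E + (m%:R * (K * E m))%:E)%E); last first.
  rewrite -addeA -EFinD leeD2l// lee_fin addrC//.
rewrite leeD2r//.
apply: (@le_trans _ _ (iter m (avg nu) (avg nu (EFin \o heat z s) \+ (EFin \o es)) y)).
  apply: iter_avg_le => //; first by apply: nnmD => //; exact: nnm_avg.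
  move=> x; have [r /= -> ] := heat_step z x s1 ss t01 tV'.
  rewrite ler_norml => /andP[+ _]; rewrite lerNl opprB lerBlDl => rM.
  by rewrite -EFinD lee_fin.
rewrite iter_avgD//; last exact: nnm_avg.
by rewrite leeD2l.
Qed.

Definition above (z y : R) : \bar R := (if z < y then 1 else 0)%:E.

(** The probability that a sum of m independent centered rewards exceeds z, expressed by [nu] alone,
    so that its asymptotics do not involve the probability spaces of the tournaments. *)
Definition tail m z : R := fine (iter m (avg nu) (above z) 0).

Lemma nnm_above z : nnm (above z).
Proof.
apply: (@nnm_EFin _ (fun y => if z < y then 1 else 0)) => [y|].
  by case: ifP.
by apply: measurable_fun_ifT => //; exact: measurable_fun_ltr.
Qed.

Lemma tailE m z : (iter m (avg nu) (above z) 0%R = (tail m z)%:E)%E.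
Proof.
rewrite /tail fineK// ge0_fin_numE; last by have [+ _] := nnm_iter_avg nu m (nnm_above z).
rewrite (@le_lt_trans _ _ 1%E) ?ltry//.
by apply: iter_avg_le1; [exact: nnm_above|move=> y; rewrite lee_fin; case: ifP].
Qed.

Lemma tail_ge0 m z : 0 <= tail m z.
Proof. by rewrite -lee_fin -tailE; have [+ _] := nnm_iter_avg nu m (nnm_above z). Qed.

(** The error of [lindeberg] from s = s0 at y = 0. *)
Definition clt_err V s0 th m z : R := m%:R * (2 * heat_err V s0 *
    expR (- (th * z) + th ^+ 2 * (s0 + m%:R * v) / 2 + m%:R * th ^+ 3)).

Lemma clt_err_ge0 V s0 th m z : 0 <= V -> 0 <= s0 -> 0 <= clt_err V s0 th m z.
Proof.
move=> V0 s0_ge0; apply: mulr_ge0 => //; apply: mulr_ge0 (expR_ge0 _).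
by apply: mulr_ge0 => //; exact: heat_err_ge0.
Qed.

(** For y > z the smoothed indicator with cutoff z - eta is at least [gtail] at -eta / sqrt s0,
    which [gtailN_lb] shows to be close to 1. *)
Lemma tail_ub z eta s0 th V m : 1 <= s0 -> 0 <= th <= 1 -> 0 < eta ->
  th * Num.sqrt (s0 + m%:R * v) <= V -> 0 <= V ->
  (1 - gdensity (eta / Num.sqrt s0) / (eta / Num.sqrt s0)) * tail m z <=
  gtail ((z - eta) / Num.sqrt (s0 + m%:R * v)) + clt_err V s0 th m (z - eta).
Proof.
move=> s1 t01 eta0 tV V0.
have sq0 : 0 < Num.sqrt s0 by rewrite sqrtr_gt0; lra.
set q := eta / _; have q0 : 0 < q by rewrite divr_gt0.
set c := 1 - _.
have [+ _] := lindeberg (z - eta) 0 s1 (lexx _) t01 tV V0.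
rewrite {2}/heat subr0 mulr0 addr0 => H.
have [c0|c0] := ltP c 0.
  apply: (@le_trans _ _ 0); first by rewrite nmulr_rle0// tail_ge0.
  rewrite addr_ge0 ?gtail_ge0//.
  by apply: clt_err_ge0 => //; lra.
rewrite -lee_fin; apply: le_trans H.
rewrite EFinM -tailE -iter_avgZ//; last exact: nnm_above.
apply: iter_avg_le => //; first by apply: nnmZ => //; exact: nnm_above.
move=> y; rewrite /above -EFinM lee_fin.
have [zy|] := ltP z y; last by rewrite mulr0 gtail_ge0.
rewrite mulr1 (le_trans (gtailN_lb q0))// gtail_nonincr//.
by rewrite /q -mulNr ler_wpM2r ?invr_ge0 ?sqrtr_ge0//; lra.
Qed.

(** The smoothed indicator with cutoff z + eta is at most 1, but does not vanish for y <= z; there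
    it is dominated by a small multiple of an exponential, whose averages [iter_avg_exp] bounds. *)
Lemma tail_lb z eta s0 th V m : 1 <= s0 -> 0 <= th <= 1 -> Num.sqrt s0 <= eta ->
  th * Num.sqrt (s0 + m%:R * v) <= V -> 0 <= V ->
  gtail ((z + eta) / Num.sqrt (s0 + m%:R * v)) <=
  tail m z + clt_err V s0 th m (z + eta) +
  expR (- eta ^+ 2 / (4 * s0)) *
  expR (- (th * (z + eta)) + th ^+ 2 * s0 + m%:R * (th ^+ 2 * v / 2 + th ^+ 3)).
Proof.
move=> s1 t01 eta0 tV V0.
have sq0 : 0 < Num.sqrt s0 by rewrite sqrtr_gt0; lra.
have s0E : Num.sqrt s0 ^+ 2 = s0 by rewrite sqr_sqrtr//; lra.
have [_ +] := lindeberg (z + eta) 0 s1 (lexx _) t01 tV V0.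
rewrite {1}/heat subr0 mulr0 addr0 => H.
rewrite addrAC -lee_fin; apply: (le_trans H).
rewrite EFinD leeD2r//.
set K := expR (- _ / _); have K0 : 0 <= K by exact: expR_ge0.
set c := - (th * _) + _.
rewrite EFinD -tailE.
have := iter_avg_exp m c 0 t01 K0; rewrite mulr0 addr0 => H2.
apply: le_trans (leeD2l _ H2).
have := nnm_above z => na; have := nnm_exp c th K0 => ne.
rewrite -iter_avgD//; apply: iter_avg_le => //; first exact: nnmD.
move=> y; rewrite /above /= -EFinD lee_fin.
have [zy|yz] := ltP z y.
  by rewrite ler_wpDr ?gtail_le1// mulr_ge0 ?expR_ge0.
rewrite add0r /heat; set w := z + eta - y.
have ew : eta <= w by rewrite /w; lra.
have w1 : 1 <= w / Num.sqrt s0 by rewrite ler_pdivlMr// mul1r (le_trans eta0).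
have w0 : 0 < w / Num.sqrt s0 by lra.
apply: (le_trans (mills_ub w0)).
apply: (@le_trans _ _ (gdensity (w / Num.sqrt s0))).
  by rewrite ler_pdivrMr// ler_peMr// ltW// gdensity_gt0.
apply: (le_trans (gdensity_le_expR _)).
rewrite /tilt /K -expRD ler_expR expr_div_n s0E.
rewrite (_ : c + th * y = - (th * w) + th ^+ 2 * s0); last by rewrite /c /w; ring.
have s00 : 0 < s0 by lra.
have ew2 : eta ^+ 2 / (4 * s0) <= w ^+ 2 / (4 * s0).
  rewrite ler_wpM2r ?invr_ge0 ?mulr_ge0 ?(ltW s00)//.
  by rewrite lerXn2r// nnegrE; lra.
(* Of the two halves w^2 / (4 s0) of the Gaussian exponent, one is at least eta^2 / (4 s0), and the
   other is at least th w - th^2 s0 by this square. *)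
have := sqr_ge0 (w / (2 * Num.sqrt s0) - th * Num.sqrt s0).
have -> : (w / (2 * Num.sqrt s0) - th * Num.sqrt s0) ^+ 2 =
  w ^+ 2 / (4 * Num.sqrt s0 ^+ 2) - th * w + th ^+ 2 * Num.sqrt s0 ^+ 2.
  by field; rewrite gt_eqF.
rewrite s0E.
rewrite !mulNr => sq.
have -> : w ^+ 2 / s0 / 2 = w ^+ 2 / (4 * s0) + w ^+ 2 / (4 * s0).
  by field; rewrite gt_eqF.
lra.
Qed.

End lindeberg.

(** * Asymptotics of the tail of the sums *)

Section growth.
Context {R : realType}.

Lemma cvg_ln_pinfty : @ln R x @[x --> +oo] --> +oo.
Proof.
apply/cvgryPge => A; near=> x.
have x0 : expR A <= x by near: x; exact: nbhs_pinfty_ge (num_real _).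
by rewrite -ler_expR lnK// posrE (lt_le_trans (expR_gt0 _) x0).
Unshelve. all: by end_near. Qed.

Lemma expR_dominates (K c : R) k : 0 < c ->
  \forall x \near +oo, K * x ^+ k <= expR (c * x).
Proof.
move=> c0; near=> x.
have x1 : 1 <= x by near: x; exact: nbhs_pinfty_ge (num_real _).
have x0 : 0 <= x by rewrite (le_trans _ x1).
apply: le_trans (expR_ge1Dxn k (mulr_ge0 (ltW c0) x0)).
apply: (@le_trans _ _ ((c * x) ^+ k.+1 / k.+1`!%:R)); last by rewrite lerDr.
pose f : R := k.+1`!%:R; have f0 : 0 < f by rewrite ltr0n fact_gt0.
have -> : (c * x) ^+ k.+1 / k.+1`!%:R = (x * (c ^+ k.+1 / f)) * x ^+ k.
  by rewrite exprMn [x ^+ k.+1]exprS -/f; ring.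
rewrite ler_wpM2r ?exprn_ge0// -ler_pdivrMr; last by rewrite divr_gt0 ?exprn_gt0.
rewrite /f; near: x; exact: nbhs_pinfty_ge (num_real _).
Unshelve. all: by end_near. Qed.

Lemma near_ln (P : set R) :
  (\forall x \near +oo, P x) -> \forall x \near +oo, P (ln x).
Proof. by move=> h; exact: cvg_ln_pinfty h. Qed.

End growth.

(** * The Gaussian tail at the threshold *)

Section level.
Context {R : realType}.
Implicit Types t L r : R.

(* [level t (ln n%:R)] is convertible to [threshold n t]. *)
Definition level t L : R := Num.sqrt (2 * L) -
  (ln L + ln (4 * pi)) / (2 * Num.sqrt (2 * L)) + (Num.sqrt (2 * L))^-1 * t.

(** Of order ln L; its square divided by L is the final rate. *)
Let drift t L : R := t - (ln L + ln (4 * pi)) / 2.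

Definition drift_bound t : R := `|t| + 1 + ln (4 * pi).

Lemma ln4pi_ge0 : 0 <= ln (4 * pi : R).
Proof. by apply: ln_ge0; have := pi_ge2 R; lra. Qed.

Lemma drift_bound_ge1 t : 1 <= drift_bound t.
Proof. by rewrite /drift_bound; have := ln4pi_ge0; have := normr_ge0 t; lra. Qed.

Let levelE t L : 0 < L ->
  level t L = Num.sqrt (2 * L) + drift t L / Num.sqrt (2 * L).
Proof.
move=> L0; rewrite /level /drift; field.
by rewrite gt_eqF// sqrtr_gt0 mulr_gt0.
Qed.

Lemma level_drift_le t L : 1 <= ln L ->
  `|t - (ln L + ln (4 * pi)) / 2| <= drift_bound t * ln L.
Proof.
move=> l1; have k0 := ln4pi_ge0; rewrite /drift_bound.
rewrite (le_trans (ler_normB _ _))//.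
rewrite [X in _ + X]ger0_norm; last by apply: divr_ge0 => //; lra.
have := normr_ge0 t; move: (ln (4 * pi)) k0 `|t| => k k0 T T0.
by nra.
Qed.

Let expR_sub1 (D : R) : `|D| <= 2^-1 -> `|expR (- D) - 1| <= 2 * `|D|.
Proof.
move=> D2; have := expR_ge1Dx (- D); have := expR_ge1Dx D.
have := expRxMexpNx_1 D; have := expR_gt0 D; have := expR_gt0 (- D).
move: D2; rewrite !ler_norml => /andP[Dl Du].
move: (expR D) (expR (- D)) => E F F0 E0 EF E1 F1.
have aD := ler_norm D; have aND := ler_norm (- D).
rewrite normrN in aND.
apply/andP; split; first lra.
suff : F <= 1 + 2 * `|D| by lra.
have [D0|D0] := leP 0 D; first nra.
rewrite ltr0_norm//; nra.
Qed.

(** Put B = sqrt(2L) and x = B (1 + e). Then x^2 / 2 = L + 2Le + Le^2, where 2Le = B (x - B) is the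
    drift plus B r. The logarithms in the drift cancel the product of sqrt(2 pi) and B, so that
    exp(-t) remains. *)
Lemma level_density t L r : 0 < L -> 0 < level t L + r ->
  expR L * (gdensity (level t L + r) / (level t L + r)) =
  expR (- t) * (expR (- (Num.sqrt (2 * L) * r +
     L * ((level t L + r) / Num.sqrt (2 * L) - 1) ^+ 2)) /
     ((level t L + r) / Num.sqrt (2 * L))).
Proof.
move=> L0 x0; have B0 : 0 < Num.sqrt (2 * L) by rewrite sqrtr_gt0 mulr_gt0.
have B2 : Num.sqrt (2 * L) ^+ 2 = 2 * L by rewrite sqr_sqrtr// mulr_ge0// ltW.
have LE : L = Num.sqrt (2 * L) ^+ 2 / 2 by rewrite B2; field.
have sq : Num.sqrt (2 * pi) * Num.sqrt (2 * L) = expR ((ln L + ln (4 * pi)) / 2).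
  have p0 : 0 < (pi : R) by exact: pi_gt0.
  rewrite -sqrtrM ?mulr_ge0 ?(ltW p0)//.
  have -> : 2 * pi * (2 * L) = L * (4 * pi) by ring.
  rewrite -lnM ?posrE ?mulr_gt0//.
  rewrite -[LHS]lnK ?posrE ?sqrtr_gt0 ?mulr_gt0//; congr expR.
  rewrite -[X in ln X = _](@ger0_norm _ _ (sqrtr_ge0 _)).
  rewrite -[in RHS](@sqr_sqrtr _ (L * (4 * pi))) ?mulr_ge0 ?(ltW p0) ?(ltW L0)//.
  rewrite lnXn ?sqrtr_gt0 ?mulr_gt0// ger0_norm ?sqrtr_ge0//.
  by rewrite mulr2n; field.
have xE := levelE t L0; set x := level t L + r in x0 *.
have rE : r = x - (Num.sqrt (2 * L) + drift t L / Num.sqrt (2 * L)).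
  by rewrite /x xE; ring.
rewrite /gdensity.
have -> : expR L * (expR (- x ^+ 2 / 2) / Num.sqrt (2 * pi) / x) =
  expR (L - x ^+ 2 / 2) / (Num.sqrt (2 * pi) * Num.sqrt (2 * L)) /
    (x / Num.sqrt (2 * L)).
  rewrite expRD !mulNr; field.
  by rewrite !gt_eqF// sqrtr_gt0 mulr_gt0// pi_gt0.
rewrite sq -expRN -expRD mulrA -expRD; congr (expR _ / _).
rewrite rE /drift; move: B2 B0; move: (Num.sqrt (2 * L)) => B B2 B0.
have -> : L = B ^+ 2 / 2 by rewrite B2; field.
by field; rewrite gt_eqF.
Qed.

(** Uniform in r because smoothing and the omitted game perturb the argument of the tail. A shift r
    multiplies the density by about exp(-sqrt(2L) r), hence the scale K / L. *)
Lemma level_tail t (K : R) : 0 <= K -> exists2 C : R, 0 <= C &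
  \forall L \near +oo, forall r, `|Num.sqrt (2 * L) * r| <= K / L ->
  0 < level t L + r /\
  `|expR L * gtail (level t L + r) - expR (- t)| <= C * (ln L ^+ 2 / L).
Proof.
move=> K0; pose A := drift_bound t + K; pose A2 := K + A ^+ 2.
have A1 : 1 <= A by rewrite /A; have := drift_bound_ge1 t; lra.
have A20 : 0 <= A2 by rewrite /A2 addr_ge0// sqr_ge0.
(* With D the exponent and e the relative deviation from sqrt(2L), |D| <= A2 del and |e| <= A del
   for del = (ln L)^2 / L. The density has relative error 4|D| + 2|e|, and Mills' x^-2 <= 2 del
   gives the last 2. *)
exists (expR (- t) * (4 * A2 + 2 * A + 2)).
  by rewrite mulr_ge0 ?expR_ge0//; lra.
near=> L.
have l1 : 1 <= ln L.
  near: L; apply: (near_ln (P := fun x => 1 <= x)).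
  exact: nbhs_pinfty_ge (num_real _).
(* Together with (ln L)^3 <= L this makes A del + A2 del at most 1/4. *)
have lA : 4 * (A + A2) <= ln L.
  near: L; apply: (near_ln (P := fun x => 4 * (A + A2) <= x)).
  exact: nbhs_pinfty_ge (num_real _).
have L00 : 0 < L by near: L; exact: nbhs_pinfty_gt (num_real _).
have l3 : ln L ^+ 3 <= L.
  rewrite -[leRHS]lnK ?posrE// -[ln L ^+ 3]mul1r -[X in expR X]mul1r.
  near: L; apply: (near_ln (P := fun x => 1 * x ^+ 3 <= expR (1 * x))).
  exact: expR_dominates.
move=> r rK.
have L1 : 1 <= L by rewrite (le_trans _ l3)// exprn_ege1.
have L0 : 0 < L by lra.
set B := Num.sqrt (2 * L) in rK *.
have B0 : 0 < B by rewrite sqrtr_gt0 mulr_gt0.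
have B2 : B ^+ 2 = 2 * L by rewrite sqr_sqrtr// mulr_ge0// ltW.
have xE := levelE t L0; rewrite -/B in xE.
set x := level t L + r; pose e := x / B - 1.
have xB : x = B * (1 + e) by rewrite /e; field; rewrite gt_eqF.
have eE : e = drift t L / (2 * L) + B * r / (2 * L).
  rewrite -B2 /e /x xE; field; exact: lt0r_neq0.
pose del := ln L ^+ 2 / L.
have l2L : ln L / L <= del.
  by rewrite ler_wpM2r ?invr_ge0 ?(ltW L0)//; nra.
have iL : L^-1 <= del.
  by rewrite /del ler_peMl ?invr_ge0 ?(ltW L0)// exprn_ege1.
have del4 : 4 * (A + A2) * del <= 1.
  rewrite /del mulrA ler_pdivrMr// mul1r (le_trans _ l3)// [leRHS]exprS.
  by rewrite ler_wpM2r// sqr_ge0.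
have del0 : 0 <= del by rewrite (le_trans _ iL)// invr_ge0 ltW.
have eA : `|e| <= A * (ln L / L).
  have L2 : 0 < 2 * L by rewrite mulr_gt0.
  have n2 (y : R) : `|y / (2 * L)| = `|y| * (2 * L)^-1.
    by rewrite normrM normfV (gtr0_norm L2).
  rewrite eE (le_trans (ler_normD _ _))// !n2.
  have d := level_drift_le t l1.
  have i2 : (2 * L)^-1 <= L^-1 by rewrite lef_pV2 ?posrE ?mulr_gt0//; lra.
  have i20 : 0 <= (2 * L)^-1 by rewrite invr_ge0; lra.
  rewrite /A [leRHS]mulrDl; apply: lerD.
    rewrite mulrA; apply: ler_pM => //.
  apply: (@le_trans _ _ (K / L * 1)).
    apply: ler_pM => //; rewrite invf_le1//; lra.
  rewrite mulr1 ler_wpM2l// ler_peMl ?invr_ge0 ?(ltW L0)//.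
have eA2 : `|e| <= A * del by rewrite (le_trans eA)// ler_wpM2l//; lra.
have e2 : `|e| <= 4^-1 by nra.
pose D := B * r + L * e ^+ 2.
have DA : `|D| <= A2 * del.
  rewrite /D (le_trans (ler_normD _ _))// /A2 mulrDl lerD//.
    by rewrite (le_trans rK)// ler_wpM2l.
  rewrite normrM (gtr0_norm L0) normrX.
  have -> : A ^+ 2 * del = L * (A * (ln L / L)) ^+ 2.
    by rewrite /del; field; rewrite gt_eqF.
  rewrite ler_wpM2l ?(ltW L0)// lerXn2r// nnegrE.
  by rewrite (le_trans _ eA).
have D2 : `|D| <= 4^-1 by nra.
have e1 : 2^-1 <= 1 + e by move: e2; rewrite ler_norml => /andP[]; lra.
have e0 : 0 < 1 + e by clear -e1; lra.
have x0 : 0 < x by rewrite xB mulr_gt0.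
split => //.
have := mills_ub x0; have := mills_lb x0.
have := level_density L0 x0.
rewrite -/B -/x -/e -/D (_ : x / B = 1 + e); last by rewrite /e; ring.
set g := gdensity x / x => gE glb gub.
have gB : `|expR L * g - expR (- t)| <= expR (- t) * ((4 * A2 + 2 * A) * del).
  rewrite gE -[X in _ - X]mulr1 -mulrBr normrM gtr0_norm ?expR_gt0//.
  rewrite ler_wpM2l ?expR_ge0//.
  have -> : expR (- D) / (1 + e) - 1 = (expR (- D) - 1 - e) / (1 + e).
    by field; rewrite gt_eqF.
  rewrite normrM normfV [`|1 + e|]gtr0_norm// ler_pdivrMr//.
  have D2' : `|D| <= 2^-1 by clear -D2; lra.
  rewrite (le_trans (ler_normB _ _))// (le_trans (lerD (expR_sub1 D2') (lexx _)))//.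
  have h1 : 0 <= A2 * del by rewrite mulr_ge0.
  have h2 : 0 <= A * del by rewrite (le_trans _ eA2).
  clear -h1 h2 e1 DA eA2; nra.
have x2 : x ^- 2 <= 2 * del.
  rewrite (@le_trans _ _ (2 / L))//; last by rewrite ler_wpM2l.
  rewrite -[leRHS]invf_div lef_pV2 ?posrE ?exprn_gt0// ?divr_gt0//.
  have e14 : 4^-1 <= (1 + e) ^+ 2 by clear -e1; nra.
  by rewrite xB exprMn B2; clear -e14 L0; nra.
have g0 : 0 <= expR L * g.
  by rewrite mulr_ge0 ?expR_ge0// divr_ge0 ?(ltW x0)// ltW// gdensity_gt0.
have E0 := expR_ge0 L.
have h1 : expR L * gtail x <= expR L * g by rewrite ler_wpM2l.
have h2 : expR L * g * (1 - x ^- 2) <= expR L * gtail x.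
  by rewrite -mulrA ler_wpM2l.
have xi0 : 0 <= x ^- 2 by rewrite invr_ge0 sqr_ge0.
have Q0 : 0 <= A2 * del by rewrite mulr_ge0.
have Q1 : 0 <= A * del by rewrite (le_trans _ eA2).
have T0 := expR_gt0 (- t).
move: gB h1 h2 xi0 x2 g0; rewrite !ler_norml => /andP[].
move: (expR L * g) (expR L * gtail x) (x ^- 2) => G H X Gl Gu h1 h2 X0 X2 G0.
have d1 : del <= 4^-1 by clear -del4 del0 A1 A20; nra.
have TX : 0 <= expR (- t) * (2 * del - X) by rewrite mulr_ge0 ?subr_ge0// ltW.
have Td : 0 <= expR (- t) * del by rewrite mulr_ge0// ltW.
rewrite -/del -[expR (- t) * _ * _]mulrA [(_ + 2) * del]mulrDl mulrDr.
move: Gl Gu; set q := expR (- t) * ((4 * A2 + 2 * A) * del) => Gl Gu.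
apply/andP; split; last by clear -Gu h1 Td; lra.
(* For the lower bound G (1 - X): if G <= exp(-t), the loss G X is at most exp(-t) X; otherwise G
   may be lowered to exp(-t). *)
have [GT|GT] := leP G (expR (- t)).
  have : 0 <= (expR (- t) - G) * X by rewrite mulr_ge0// subr_ge0.
  by clear -Gl h2 TX => GX; lra.
have : 0 <= (G - expR (- t)) * (1 - X).
  by rewrite mulr_ge0// subr_ge0 ?(ltW GT)//; clear -X2 d1; lra.
have q0 : 0 <= q by apply: mulr_ge0 (ltW T0) _; clear -Q0 Q1; lra.
by move=> GX; clear -h2 TX q0 GX; lra.
Unshelve. all: by end_near. Qed.

End level.

(** * Choice of the smoothing and tilting parameters *)

Section scaling.
Context {R : realType}.
Variables (t L sg c : R) (m : nat).
Hypothesis sg0 : 0 < sg.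
Hypothesis mE : m%:R = expR L - 2.
Hypothesis c2 : `|c| <= 2^-1.
Hypothesis L64 : 64 <= L.
Hypothesis sgL : 1 <= sg * L.
Hypothesis Lexp : L ^+ 16 <= expR (4^-1 * L).
Hypothesis ln1 : 1 <= ln L.
Hypothesis lnL : drift_bound t * ln L <= L / 16.

(** N is the number of players and rN its square root; sg * p is the standard deviation of a full
    score, and sg * w that of the smoothed sum over n - 2 games. *)
Let N := expR L.
Let rN := expR (2^-1 * L).
Let B := Num.sqrt (2 * L).
Let p := Num.sqrt (N - 1).
Let w := Num.sqrt (N / L ^+ 6 + N - 2).

(* Here L = ln n.  The smoothing variance is negligible with respect to the
   variance n sg^2 of the sum, the window is L times its square root and is
   negligible with respect to sg sqrt n / sqrt L, and the tilting parameter is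
   the one that brings the mean of the sum to the cutoff. *)
Definition cutoff : R := p * sg * level t L + c.
Definition window : R := sg * rN / L ^+ 2.
Definition smooth_var : R := sg ^+ 2 * N / L ^+ 6.
Definition tilt_param : R := B / (sg * rN).

Let L0 : 0 < L. Proof. by apply: lt_le_trans L64. Qed.
Let L1 : 1 <= L. Proof. by apply: le_trans L64; rewrite ler1n. Qed.
Let rN0 : 0 < rN. Proof. exact: expR_gt0. Qed.
Let NE : N = rN ^+ 2.
Proof. by rewrite /N /rN -expRM_natl; congr expR; field. Qed.

Let rN_ge k : (k <= 16)%N -> L ^+ k <= rN.
Proof.
move=> k16; apply: (@le_trans _ _ (L ^+ 16)); first exact: ler_weXn2l.
by rewrite (le_trans Lexp)// ler_expR ler_wpM2r ?(ltW L0)//; lra.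
Qed.

Let rN64 : 64 <= rN.
Proof. by rewrite (le_trans L64)// (le_trans _ (@rN_ge 1 _)). Qed.

Let rN_sq : 64 * rN <= rN ^+ 2.
Proof. by rewrite expr2 ler_wpM2r// ltW. Qed.

Let B0 : 0 < B. Proof. by rewrite sqrtr_gt0 mulr_gt0. Qed.
Let B2 : B ^+ 2 = 2 * L. Proof. by rewrite sqr_sqrtr// mulr_ge0// ltW. Qed.
Let BL : B <= L.
Proof.
rewrite -(@ler_pXn2r _ 2) ?nnegrE ?(ltW B0) ?(ltW L0)// B2 expr2.
by rewrite ler_wpM2r ?(ltW L0)// (le_trans _ L64)// ler_nat.
Qed.

Let NL6 : 1 <= N / L ^+ 6.
Proof.
rewrite ler_pdivlMr ?exprn_gt0// mul1r (le_trans (@rN_ge 6 _))// NE.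
by move: rN_sq rN64; lra.
Qed.

Let N4 : N / 4 <= N - 2.
Proof. by rewrite NE; move: rN_sq rN64; lra. Qed.

Let w2 : w ^+ 2 = N / L ^+ 6 + N - 2.
Proof.
rewrite sqr_sqrtr// -addrA addr_ge0//; first by rewrite (le_trans _ NL6).
by rewrite (le_trans _ N4)// divr_ge0// expR_ge0.
Qed.

Let w_ge : rN / 2 <= w.
Proof.
rewrite -(@ler_pXn2r _ 2) ?nnegrE ?sqrtr_ge0 ?divr_ge0 ?(ltW rN0)// w2.
by rewrite expr_div_n -NE; move: NL6 N4; lra.
Qed.

Let w0 : 0 < w.
Proof. by rewrite (lt_le_trans _ w_ge)// divr_gt0. Qed.

Let p2 : p ^+ 2 = N - 1.
Proof. by rewrite sqr_sqrtr//; move: N4 (expR_ge0 L); rewrite -/N; lra. Qed.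

Let p0 : 0 <= p. Proof. exact: sqrtr_ge0. Qed.

Let drift0 : R := t - (ln L + ln (4 * pi)) / 2.

Let levelB : B * level t L = 2 * L + drift0.
Proof.
rewrite /level -/B -B2 /drift0; field; exact: lt0r_neq0.
Qed.

Let drift16 : `|drift0| <= L / 16.
Proof. exact: le_trans (level_drift_le _ ln1) lnL. Qed.

Let sqrt_var : Num.sqrt (smooth_var + m%:R * sg ^+ 2) = sg * w.
Proof.
have -> : smooth_var + m%:R * sg ^+ 2 = (sg * w) ^+ 2.
  by rewrite exprMn w2 mE /smooth_var -/N; ring.
by rewrite sqrtr_sqr ger0_norm// mulr_ge0 ?(ltW sg0) ?(ltW w0).
Qed.

Let ratio_le : `|p / w - 1| <= 4 / L ^+ 6.
Proof.
have pw0 : 0 <= p / w by rewrite divr_ge0// ltW.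
have h : `|p / w - 1| <= `|(p / w) ^+ 2 - 1|.
  rewrite subr_sqr_1 normrM ler_peMr// ger0_norm ?addr_ge0//.
  by rewrite lerDr.
apply: (le_trans h).
have L60 : 0 < L ^+ 6 by rewrite exprn_gt0.
have w20 : 0 < w ^+ 2 by rewrite exprn_gt0.
have -> : (p / w) ^+ 2 - 1 = (1 - N / L ^+ 6) / w ^+ 2.
  rewrite expr_div_n p2 -[X in _ - X](divff (lt0r_neq0 w20)) -mulrBl w2.
  by congr (_ / _); ring.
rewrite normrM normfV (gtr0_norm w20) ler0_norm ?subr_le0// ler_pdivrMr//.
apply: (@le_trans _ _ (N / L ^+ 6)); first by rewrite opprB gerBl.
rewrite mulrAC ler_wpM2r ?invr_ge0 ?(ltW L60)// w2.
by move: NL6 N4; lra.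
Qed.

(** Three effects move the argument: the change of normalization from p to w (16 / L), the term c (1
    / L) and the window (2 / L); 19 is their sum. *)
Lemma cutoff_shift (e : R) : `|e| <= 1 ->
  `|B * ((cutoff + e * window) / Num.sqrt (smooth_var + m%:R * sg ^+ 2)
      - level t L)| <= 19 / L.
Proof.
move=> e1; rewrite sqrt_var.
have -> : B * ((cutoff + e * window) / (sg * w) - level t L) =
    (p / w - 1) * (B * level t L) + B * c / (sg * w) +
    e * (B * rN / (L ^+ 2 * w)).
  rewrite /cutoff /window; field.
  by rewrite !gt_eqF.
have L20 : 0 < L ^+ 2 by rewrite exprn_gt0.
have h1 : `|(p / w - 1) * (B * level t L)| <= 16 / L.
  rewrite normrM levelB.
  have d : `|2 * L + drift0| <= 4 * L.
    rewrite (le_trans (ler_normD _ _))// ger0_norm ?mulr_ge0 ?(ltW L0)//.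
    by move: drift16 L0; lra.
  rewrite (le_trans (ler_pM _ _ ratio_le d))//.
  have -> : 4 / L ^+ 6 * (4 * L) = 16 / L ^+ 5.
    by field; rewrite gt_eqF.
  rewrite ler_wpM2l// lef_pV2 ?posrE ?exprn_gt0//.
  by rewrite -{1}(expr1 L) ler_weXn2l.
have h2 : `|B * c / (sg * w)| <= 1 / L.
  have sw : 0 < sg * w by rewrite mulr_gt0.
  rewrite normrM normfV (gtr0_norm sw) ler_pdivrMr// normrM (gtr0_norm B0).
  apply: (@le_trans _ _ (L * 2^-1)); first by rewrite ler_pM// ltW.
  rewrite mulrAC ler_pdivlMr// mul1r.
  apply: (@le_trans _ _ (L^-1 * (L ^+ 3 / 2))).
    by rewrite le_eqVlt; apply/orP; left; apply/eqP; field; rewrite gt_eqF.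
  apply: ler_pM; rewrite ?invr_ge0 ?(ltW L0)//.
  - by rewrite divr_ge0// exprn_ge0// ltW.
  - by rewrite -[L^-1]mul1r ler_pdivrMr.
  - by rewrite (le_trans _ w_ge)// ler_wpM2r// rN_ge.
have h3 : `|e * (B * rN / (L ^+ 2 * w))| <= 2 / L.
  have Lw : 0 < L ^+ 2 * w by rewrite mulr_gt0.
  rewrite normrM [`|_ / _|]ger0_norm; last first.
    by rewrite divr_ge0 ?(ltW Lw)// mulr_ge0// ltW.
  apply: (@le_trans _ _ (1 * (B * rN / (L ^+ 2 * w)))).
    by rewrite ler_wpM2r// divr_ge0 ?(ltW Lw)// mulr_ge0// ltW.
  rewrite mul1r ler_pdivrMr//.
  have -> : 2 / L * (L ^+ 2 * w) = L * (2 * w) by field; rewrite gt_eqF.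
  apply: ler_pM => //; rewrite ?(ltW B0) ?(ltW rN0)//.
  by move: w_ge; lra.
rewrite (le_trans (ler_normD _ _))// (le_trans (lerD (ler_normD _ _) (lexx _)))//.
rewrite (le_trans (lerD (lerD h1 h2) h3))//.
by rewrite -!mulrDl ler_wpM2r// ?invr_ge0 ?(ltW L0)//; lra.
Qed.

Lemma smooth_var_ge1 : 1 <= smooth_var.
Proof.
rewrite /smooth_var ler_pdivlMr ?exprn_gt0// mul1r.
have sgL2 : 1 <= sg ^+ 2 * L ^+ 2 by rewrite -exprMn exprn_ege1.
have L80 : 0 < L ^+ 8 by rewrite exprn_gt0.
have N8 : L ^+ 8 <= N.
  rewrite (le_trans (@rN_ge 8 _))// NE; move: rN_sq rN64; lra.
apply: (@le_trans _ _ (sg ^+ 2 * L ^+ 8)).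
  by rewrite (_ : sg ^+ 2 * L ^+ 8 = (sg ^+ 2 * L ^+ 2) * L ^+ 6);
    [rewrite ler_peMl// exprn_ge0// ltW|ring].
by rewrite ler_wpM2l// sqr_ge0.
Qed.

Let sgi : sg^-1 <= L.
Proof. by rewrite -[sg^-1]mul1r ler_pdivrMr// mulrC. Qed.

Let isg k : (sg ^- k <= L ^+ k).
Proof. by rewrite -exprVn lerXn2r// nnegrE ?invr_ge0 ltW. Qed.

Lemma tilt_param_itv : 0 <= tilt_param <= 1.
Proof.
have sr : 0 < sg * rN by rewrite mulr_gt0.
rewrite /tilt_param divr_ge0 ?(ltW B0) ?(ltW sr)//= ler_pdivrMr// mul1r.
rewrite (le_trans BL)// (@le_trans _ _ (sg * L * L))//.
  by rewrite ler_peMl// ltW.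
rewrite -mulrA ler_wpM2l ?(ltW sg0)//.
by rewrite (le_trans _ (@rN_ge 2 _)).
Qed.

Let var_le : smooth_var + m%:R * sg ^+ 2 <= 2 * (sg * rN) ^+ 2.
Proof.
have N0 : 0 <= N by exact: expR_ge0.
have i1 : (L ^+ 6)^-1 <= 1 by rewrite invf_le1 ?exprn_gt0// exprn_ege1.
rewrite mE -/N /smooth_var exprMn -NE.
have q : 0 <= sg ^+ 2 * (N - N / L ^+ 6).
  by rewrite mulr_ge0 ?sqr_ge0// subr_ge0 ler_piMr.
by have := sqr_ge0 sg; move: q; lra.
Qed.

Lemma tilt_param_sqrt :
  tilt_param * Num.sqrt (smooth_var + m%:R * sg ^+ 2) <= 2 * B.
Proof.
have sr : 0 < sg * rN by rewrite mulr_gt0.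
rewrite /tilt_param mulrAC ler_pdivrMr// mulrAC mulrC ler_wpM2r ?(ltW B0)//.
rewrite -(@ler_pXn2r _ 2) ?nnegrE ?sqrtr_ge0 ?mulr_ge0 ?(ltW rN0) ?(ltW sg0)//.
rewrite sqr_sqrtr; last first.
  apply: addr_ge0; first exact: le_trans ler01 smooth_var_ge1.
  by rewrite mulr_ge0 ?sqr_ge0.
by rewrite (le_trans var_le)// exprMn; have := sqr_ge0 (sg * rN); lra.
Qed.

Lemma sqrt_smooth_var : Num.sqrt smooth_var = sg * rN / L ^+ 3.
Proof.
have -> : smooth_var = (sg * rN / L ^+ 3) ^+ 2.
  by rewrite /smooth_var NE; field; rewrite gt_eqF.
rewrite sqrtr_sqr ger0_norm//; apply: divr_ge0.
  by rewrite mulr_ge0// ltW.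
by rewrite exprn_ge0// ltW.
Qed.

Lemma window_ratio : window / Num.sqrt smooth_var = L.
Proof.
by rewrite sqrt_smooth_var /window; field; rewrite !gt_eqF.
Qed.

Lemma window_gt0 : 0 < window.
Proof. by rewrite /window divr_gt0 ?mulr_gt0 ?exprn_gt0. Qed.

Lemma sqrt_smooth_var_le : Num.sqrt smooth_var <= window.
Proof.
rewrite -[leLHS]mul1r -ler_pdivlMr ?window_ratio//.
by rewrite sqrtr_gt0 (lt_le_trans _ smooth_var_ge1).
Qed.

(** The main term is B * level = 2L + drift, with a drift of at most L / 16; the ratio p / rN, the
    term c and the window lose at most 1 each. *)
Let tilt_cut (e : R) : `|e| <= 1 ->
  2 * L - L / 16 - 3 <= tilt_param * (cutoff + e * window).
Proof.
move=> e1.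
have -> : tilt_param * (cutoff + e * window) =
    (B * level t L) * (p / rN) + (B / (sg * rN)) * c + e * (B / L ^+ 2).
  by rewrite /tilt_param /cutoff /window; field; rewrite !gt_eqF.
have sr : 0 < sg * rN by rewrite mulr_gt0.
have /andP[th0 th1] := tilt_param_itv; rewrite -/tilt_param.
have h1 : 2 * L - L / 16 - 1 <= (B * level t L) * (p / rN).
  rewrite levelB.
  have pr : 1 - (rN ^+ 2)^-1 <= p / rN.
    have p1 : p / rN <= 1.
      rewrite ler_pdivrMr// mul1r -(@ler_pXn2r _ 2) ?nnegrE ?(ltW rN0)// p2 NE.
      by lra.
    have pr0 : 0 <= p / rN by rewrite divr_ge0// ltW.
    have -> : 1 - (rN ^+ 2)^-1 = (p / rN) ^+ 2.
      by rewrite expr_div_n p2 NE; field; rewrite gt_eqF.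
    by move: p1 pr0; move: (p / rN) => q; nra.
  have i1 : 2 * L * (rN ^+ 2)^-1 <= 2^-1.
    rewrite ler_pdivrMr ?exprn_gt0//.
    by have := @rN_ge 1 isT; move: rN64; rewrite expr1; nra.
  have i0 : 0 <= (rN ^+ 2)^-1 by rewrite invr_ge0 sqr_ge0.
  move: drift16; rewrite ler_norml => /andP[d1 d2].
  have q0 : 0 <= 2 * L + drift0 by move: d1 L0; lra.
  apply: le_trans (ler_wpM2l q0 pr).
  by move: d1 d2 i0 i1 L0; move: ((rN ^+ 2)^-1) => q; nra.
have h2 : -1 <= tilt_param * c.
  move: c2; rewrite ler_norml => /andP[c2l _].
  by move: th0 th1 c2l; move: tilt_param => th; nra.
have h3 : -1 <= e * (B / L ^+ 2).
  have b1 : B / L ^+ 2 <= 1.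
    rewrite ler_pdivrMr ?exprn_gt0// mul1r (le_trans BL)//.
    by rewrite -{1}(expr1 L) ler_weXn2l.
  have b0 : 0 <= B / L ^+ 2 by rewrite divr_ge0 ?exprn_ge0 ?(ltW L0) ?(ltW B0).
  move: e1; rewrite ler_norml => /andP[e1 _].
  by move: e1 b0 b1; move: (B / _) => q; nra.
by move: h1 h2 h3; lra.
Qed.

Let tilt_sq : tilt_param ^+ 2 = 2 * L / (sg ^+ 2 * N).
Proof. by rewrite /tilt_param expr_div_n B2 exprMn -NE. Qed.

Let iL6 : L / L ^+ 6 <= 1.
Proof.
rewrite ler_pdivrMr ?exprn_gt0// mul1r.
by rewrite -{1}(expr1 L) ler_weXn2l.
Qed.

Let tilt_smooth : tilt_param ^+ 2 * smooth_var <= 2.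
Proof.
have -> : tilt_param ^+ 2 * smooth_var = 2 * (L / L ^+ 6).
  rewrite tilt_sq /smooth_var; field.
  by rewrite !gt_eqF ?expR_gt0.
by move: iL6; lra.
Qed.

Let tilt_var : m%:R * (tilt_param ^+ 2 * sg ^+ 2 / 2) <= L.
Proof.
have -> : m%:R * (tilt_param ^+ 2 * sg ^+ 2 / 2) = L * (m%:R / N).
  rewrite tilt_sq; field.
  by rewrite !gt_eqF ?expR_gt0.
rewrite ler_piMr ?(ltW L0)// ler_pdivrMr ?expR_gt0// mE mul1r -/N.
by lra.
Qed.

Let tilt_cube : m%:R * tilt_param ^+ 3 <= 1.
Proof.
have r3 : 0 < rN ^+ 3 by rewrite exprn_gt0.
have b3 : B ^+ 3 <= L ^+ 3 by rewrite lerXn2r// nnegrE ltW.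
have -> : m%:R * tilt_param ^+ 3 = (m%:R * B ^+ 3) * (sg ^- 3) / rN ^+ 3.
  by rewrite /tilt_param expr_div_n exprMn; field; rewrite !gt_eqF.
rewrite ler_pdivrMr// mul1r.
apply: (@le_trans _ _ ((rN ^+ 2 * L ^+ 3) * L ^+ 3)).
  apply: ler_pM; rewrite ?isg//.
  - by rewrite mulr_ge0// exprn_ge0// ltW.
  - by rewrite invr_ge0 exprn_ge0// ltW.
  - apply: ler_pM => //; first by rewrite exprn_ge0// ltW.
    by rewrite mE -/N NE; lra.
rewrite -mulrA -exprD [leRHS]exprSr ler_wpM2l ?sqr_ge0//.
exact: rN_ge.
Qed.

(** Up to powers of L the left side is n * n * n^(-3/2) * exp(Q). Here Q is about L - 2L, of which
    -3L/4 is kept, so exp(-L/4) remains to absorb L^15: L^3 from (1 + 2B)^3, L^3 from sg^-3 and L^9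
    from the smoothing variance. One more power of L gives the rate and explains the exponent 16 in
    the hypothesis on L. *)
Lemma cutoff_clt_err (e : R) : `|e| <= 1 ->
  expR L * clt_err (sg ^+ 2) (2 * B) smooth_var tilt_param m (cutoff + e * window)
   <= 54 * expR (9 / 2) * expR 1 / L.
Proof.
move=> e1; rewrite /clt_err /heat_err.
set Q := - _ + _ + _.
have Q34 : Q <= - (3 / 4 * L).
  have -> : Q = - (tilt_param * (cutoff + e * window)) +
      tilt_param ^+ 2 * smooth_var / 2 +
      m%:R * (tilt_param ^+ 2 * sg ^+ 2 / 2) + m%:R * tilt_param ^+ 3.
    by rewrite /Q; ring.
  have := tilt_cut e1; have := tilt_smooth; have := tilt_var; have := tilt_cube.
  by move: L64; lra.
rewrite sqrt_smooth_var.
set K := expR (9 / 2) * expR 1.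
have K0 : 0 <= K by rewrite mulr_ge0 ?expR_ge0.
have -> : 54 * expR (9 / 2) * expR 1 / L = 2 * K * (27 / L) by rewrite /K; ring.
have -> : expR L * (m%:R * (2 * (K * (1 + 2 * B) ^+ 3 /
    (smooth_var * (sg * rN / L ^+ 3))) * expR Q)) =
    2 * K * (m%:R / rN ^+ 2 * (1 + 2 * B) ^+ 3 * sg ^- 3 * L ^+ 9 *
      (rN * expR Q)).
  rewrite -/N /smooth_var NE; field.
  by rewrite !gt_eqF.
rewrite ler_wpM2l ?mulr_ge0//.
have rQ : rN * expR Q <= expR (- (4^-1 * L)).
  by rewrite /rN -expRD ler_expR; move: Q34; lra.
have m1 : m%:R / rN ^+ 2 <= 1.
  by rewrite ler_pdivrMr ?exprn_gt0// mul1r mE -/N NE; lra.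
have m0 : 0 <= m%:R / rN ^+ 2 by rewrite divr_ge0// sqr_ge0.
have b3 : (1 + 2 * B) ^+ 3 <= 27 * L ^+ 3.
  have -> : 27 * L ^+ 3 = (3 * L) ^+ 3 by ring.
  by rewrite lerXn2r ?nnegrE//; move: BL B0 L1; lra.
have b0 : 0 <= (1 + 2 * B) ^+ 3.
  by rewrite exprn_ge0// addr_ge0// mulr_ge0// ltW.
have s0 : 0 <= sg ^- 3 by rewrite invr_ge0 exprn_ge0// ltW.
have l9 : 0 <= L ^+ 9 by rewrite exprn_ge0// ltW.
apply: (@le_trans _ _ (1 * (27 * L ^+ 3) * L ^+ 3 * L ^+ 9 *
   expR (- (4^-1 * L)))).
  have x0 : 0 <= m%:R / rN ^+ 2 * (1 + 2 * B) ^+ 3 by rewrite mulr_ge0.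
  have x1 : m%:R / rN ^+ 2 * (1 + 2 * B) ^+ 3 <= 1 * (27 * L ^+ 3).
    exact: ler_pM.
  have y0 : 0 <= m%:R / rN ^+ 2 * (1 + 2 * B) ^+ 3 * sg ^- 3.
    exact: mulr_ge0.
  have y1 : m%:R / rN ^+ 2 * (1 + 2 * B) ^+ 3 * sg ^- 3 <=
      1 * (27 * L ^+ 3) * L ^+ 3 by exact: ler_pM.
  apply: ler_pM rQ; [exact: mulr_ge0| |exact: ler_wpM2r].
  by rewrite mulr_ge0 ?expR_ge0// ltW.
have -> : 1 * (27 * L ^+ 3) * L ^+ 3 * L ^+ 9 * expR (- (4^-1 * L)) =
   27 * (L ^+ 15 * expR (- (4^-1 * L))) by ring.
rewrite ler_wpM2l// expRN ler_pdivrMr ?expR_gt0// ler_pdivlMl// -exprS.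
Qed.

(** The window is L standard deviations of the smoothing, so the first factor is exp(-L^2 / 4),
    which outweighs [expR L]. *)
Lemma cutoff_gauss_err :
  expR L * (expR (- window ^+ 2 / (4 * smooth_var)) *
    expR (- (tilt_param * (cutoff + window)) + tilt_param ^+ 2 * smooth_var +
      m%:R * (tilt_param ^+ 2 * sg ^+ 2 / 2 + tilt_param ^+ 3))) <= 1 / L.
Proof.
have e1 : `|1 : R| <= 1 by rewrite normr1.
have := tilt_cut e1; rewrite mul1r => h1.
have -> : window ^+ 2 = L ^+ 2 * smooth_var.
  have sq0 : 0 < Num.sqrt smooth_var.
    by rewrite sqrtr_gt0 (lt_le_trans _ smooth_var_ge1).
  have -> : window = L * Num.sqrt smooth_var.
    by rewrite -{1}window_ratio divfK// gt_eqF.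
  rewrite exprMn sqr_sqrtr//; exact: le_trans ler01 smooth_var_ge1.
have -> : - (L ^+ 2 * smooth_var) / (4 * smooth_var) = - (L ^+ 2 / 4).
  by field; rewrite gt_eqF// (lt_le_trans _ smooth_var_ge1).
rewrite -!expRD.
apply: (@le_trans _ _ (expR (- L))).
  rewrite ler_expR.
  have L2 : 64 * L <= L ^+ 2 by rewrite expr2 ler_wpM2r ?(ltW L0).
  have := tilt_smooth; have := tilt_var; have := tilt_cube.
  by move: h1 L64; lra.
rewrite expRN mul1r lef_pV2 ?posrE ?expR_gt0//.
by have := expR_ge1Dx L; lra.
Qed.

End scaling.

(** Applied with X = n P(S > z), T = e^-t, i = 1 / L, and g1, g2 equal to n times the Gaussian tails
    at the two ends of the window. Passing from (1 - i) X to X costs the factor 1 + 2i, which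
    requires i <= 1/2. *)
Lemma tail_sandwich (R : realType) (X E1 E2 G g1 g2 T C0 K2 del i gd : R) :
  0 <= T -> 0 <= X -> 0 <= C0 -> 0 <= K2 -> 0 <= i -> i <= 2^-1 -> i <= del ->
  gd <= i -> (1 - gd) * X <= g1 + E1 -> g2 <= X + E2 + G ->
  E1 <= K2 * i -> E2 <= K2 * i -> G <= i ->
  `|g1 - T| <= C0 * del -> `|g2 - T| <= C0 * del ->
  `|X - T| <= (2 * T + 2 * (C0 + K2) + 1) * del.
Proof.
move=> T0 X0 C00 K20 i0 i2 id gdi ub lb E1i E2i Gi.
rewrite !ler_norml => /andP[g1l g1u] /andP[g2l g2u].
have d0 : 0 <= del by exact: le_trans id.
have K2d : K2 * i <= K2 * del by rewrite ler_wpM2l.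
have K2d0 : 0 <= K2 * del by rewrite mulr_ge0.
have C0d : 0 <= C0 * del by rewrite mulr_ge0.
have Td : T * i <= T * del by rewrite ler_wpM2l.
have Td0 : 0 <= T * del by rewrite mulr_ge0.
have XL : (1 - i) * X <= T + (C0 + K2) * del.
  apply: (@le_trans _ _ ((1 - gd) * X)).
    by rewrite ler_wpM2r// lerD2l lerN2.
  by lra.
apply/andP; split; first by lra.
have XT : X <= (1 + 2 * i) * (T + (C0 + K2) * del).
  have q0 : 0 < 1 - i by lra.
  rewrite -(ler_pM2l q0); apply: (le_trans XL).
  rewrite mulrA ler_peMl//; last by nra.
  by lra.
apply: (@le_trans _ _ (2 * (T * i) + 2 * ((C0 + K2) * del))); last by lra.
have : 0 <= (1 - 2 * i) * ((C0 + K2) * del) by rewrite mulr_ge0//; lra.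
by lra.
Qed.

Section tail_asymptotics.
Context {R : realType} (nu : probability R R) (sg : R).
Local Notation I01 := [set` `[(0 : R), 1]].
Hypothesis nu01 : nu I01 = 1%E.
Hypothesis nu_mean : \int[nu]_(x in I01) (x - 2^-1) = 0.
Hypothesis nu_var : \int[nu]_(x in I01) ((x - 2^-1) ^+ 2) = sg ^+ 2.
Hypothesis sg0 : 0 < sg.

Lemma tail_asymptotics (t : R) : exists2 C : R, 0 <= C &
  \forall L \near +oo, forall (m : nat) (c : R),
    m%:R = expR L - 2 -> `|c| <= 2^-1 ->
    `|expR L * tail nu m (cutoff t L sg c) - expR (- t)| <= C * (ln L ^+ 2 / L).
Proof.
have [C0 C00 C0P] := level_tail t (ler0n R 19).
pose K2 : R := 54 * expR (9 / 2) * expR 1.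
have K20 : 0 <= K2 by rewrite !mulr_ge0// expR_ge0.
exists (2 * expR (- t) + 2 * (C0 + K2) + 1).
  by rewrite !addr_ge0// mulr_ge0 ?expR_ge0// addr_ge0.
near=> L => m c mE c2.
have L64 : 64 <= L by near: L; exact: nbhs_pinfty_ge (num_real _).
have L0 : 0 < L by rewrite (lt_le_trans _ L64).
have sgL : 1 <= sg * L.
  rewrite -ler_pdivrMl// mulr1; near: L; exact: nbhs_pinfty_ge (num_real _).
have Lexp : L ^+ 16 <= expR (4^-1 * L).
  rewrite -[leLHS]mul1r; near: L; apply: expR_dominates.
  by rewrite invr_gt0.
have ln1 : 1 <= ln L.
  near: L; apply: (near_ln (P := fun x => 1 <= x)).
  exact: nbhs_pinfty_ge (num_real _).
have lnL : drift_bound t * ln L <= L / 16.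
  rewrite ler_pdivlMr// mulrAC -[ln L]expr1.
  rewrite -[leRHS]lnK ?posrE// -[X in expR X]mul1r.
  near: L; apply: (near_ln (P := fun x => drift_bound t * 16 * x ^+ 1 <= expR (1 * x))).
  exact: expR_dominates.
have PL : forall r, `|Num.sqrt (2 * L) * r| <= 19 / L ->
    0 < level t L + r /\
    `|expR L * gtail (level t L + r) - expR (- t)| <= C0 * (ln L ^+ 2 / L).
  by near: L; exact: C0P.
set S := smooth_var L sg + m%:R * sg ^+ 2.
(* The values e = -1 and e = 1 are the shifted cutoffs of [tail_ub] and [tail_lb]. *)
have gt_e (e : R) : `|e| <= 1 ->
    `|expR L * gtail ((cutoff t L sg c + e * window L sg) / Num.sqrt S) - expR (- t)|
      <= C0 * (ln L ^+ 2 / L).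
  move=> e1; have := cutoff_shift sg0 mE c2 L64 sgL Lexp ln1 lnL e1.
  by rewrite -/S => /PL[_]; rewrite subrKC.
have s1 := smooth_var_ge1 L64 sgL Lexp.
have t01 := tilt_param_itv sg0 L64 sgL Lexp.
have w0 := window_gt0 sg0 L64.
have tV := tilt_param_sqrt sg0 mE L64 sgL Lexp; rewrite -/S in tV.
have V0 : 0 <= 2 * Num.sqrt (2 * L) by rewrite mulr_ge0 ?sqrtr_ge0.
have e1 : `|1 : R| <= 1 by rewrite normr1.
have e2 : `|- 1 : R| <= 1 by rewrite normrN normr1.
have err e : `|e| <= 1 -> expR L * clt_err (sg ^+ 2) (2 * Num.sqrt (2 * L))
    (smooth_var L sg) (tilt_param L sg) m (cutoff t L sg c + e * window L sg) <= K2 / L.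
  exact: (cutoff_clt_err sg0 mE c2 L64 sgL Lexp ln1 lnL).
have gerr := cutoff_gauss_err sg0 mE c2 L64 sgL Lexp ln1 lnL.
have ub := tail_ub nu01 nu_mean nu_var (cutoff t L sg c) s1 t01 w0 tV V0.
have lb := tail_lb nu01 nu_mean nu_var (cutoff t L sg c) s1 t01
  (sqrt_smooth_var_le sg0 L64 sgL Lexp) tV V0.
rewrite (window_ratio sg0 L64) in ub.
have NL : 0 <= expR L by exact: expR_ge0.
have := ler_wpM2l NL ub; have := ler_wpM2l NL lb.
have := gt_e _ e1; have := gt_e _ e2; have := err _ e1; have := err _ e2.
rewrite -/S mulN1r mul1r; move: gerr.
set G := expR (- window L sg ^+ 2 / _) * _; set X := tail _ _ _.
set T := expR (- t); set E1 := clt_err _ _ _ _ _ _.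
set E2 := clt_err _ _ _ _ _ _; set g1 := gtail _; set g2 := gtail _.
move=> GL E1L E2L g1T g2T lb' ub'.
have lbE : expR L * g2 <= expR L * X + expR L * E2 + expR L * G.
  by rewrite -!mulrDr.
have ubE : (1 - gdensity L / L) * (expR L * X) <= expR L * g1 + expR L * E1.
  by rewrite -mulrDr mulrCA.
pose del := ln L ^+ 2 / L.
have iL : L^-1 <= del by rewrite ler_peMl ?invr_ge0 ?(ltW L0)// exprn_ege1.
have iL2 : L^-1 <= 2^-1 by rewrite lef_pV2 ?posrE// (le_trans _ L64)// ler_nat.
have iL0 : 0 <= L^-1 by rewrite invr_ge0 ltW.
have gd : gdensity L / L <= L^-1.
  rewrite ler_piMl// (le_trans (gdensity_le_expR _))// expR_le1.
  by rewrite mulNr oppr_le0 divr_ge0 ?sqr_ge0.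
have NX0 : 0 <= expR L * X by rewrite mulr_ge0 ?expR_ge0// tail_ge0.
rewrite mul1r in GL.
exact: tail_sandwich (expR_ge0 _) NX0 C00 K20 iL0 iL2 iL gd ubE lbE E1L E2L GL g1T g2T.
Unshelve. all: by end_near. Qed.

End tail_asymptotics.

(** * Poisson approximation *)

Section stein_solution.
Context {R : realType} (lam : R).
Hypothesis lam0 : 0 < lam.
Implicit Types (f : nat -> R) (k m : nat).

Let pm := poisson_pmf lam.

Lemma poisson_pmf_gt0 k : 0 < pm k.
Proof.
rewrite /pm /poisson_pmf lam0 !mulr_gt0 ?exprn_gt0 ?expR_gt0//.
Qed.

Lemma poisson_pmfS k : pm k.+1 * k.+1%:R = pm k * lam.
Proof.
rewrite /pm /poisson_pmf lam0 exprS factS natrM; field.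
by rewrite nat1r !pnatr_eq0 -!lt0n ?fact_gt0.
Qed.

(** Essentially (k + 1 + i)! >= k! i!. Summed over i, the Poisson mass beyond k is a bounded
    multiple of pm k. *)
Let pm_shift k i : pm (k.+1 + i) <= pm k * lam * exp_coeff lam i.
Proof.
have pS j : pm j.+1 = pm j * lam / j.+1%:R.
  by rewrite -poisson_pmfS mulfK// pnatr_eq0.
elim: i => [|i ih].
  rewrite addn0 /exp_coeff/= expr0 fact0 divr1 mulr1 pS ler_pdivrMr ?ltr0n//.
  by rewrite ler_peMr ?ler1n// mulr_ge0 ?(ltW lam0)// ltW// poisson_pmf_gt0.
have -> : exp_coeff lam i.+1 = exp_coeff lam i * lam / i.+1%:R.
  rewrite /exp_coeff/= exprS factS natrM; field.
  by rewrite nat1r !pnatr_eq0 -!lt0n ?fact_gt0.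
rewrite addnS pS 2!(mulrA (pm k * lam)); apply: ler_pM.
- by rewrite mulr_ge0 ?(ltW lam0)// ltW// poisson_pmf_gt0.
- by rewrite invr_ge0 ler0n.
- apply: (ler_wpM2r (ltW lam0)); exact: ih.
- by rewrite lef_pV2 ?posrE ?ltr0n// ler_nat ltnS leq_addl.
Qed.

Let series_le m : \sum_(0 <= i < m) exp_coeff lam i <= expR lam.
Proof.
apply: nondecreasing_cvgn_le (is_cvg_series_exp_coeff lam) m.
apply/nondecreasing_seqP => n; rewrite /series/= big_nat_recr//= lerDl.
by rewrite exp_coeff_ge0// ltW.
Qed.

Let mass m := \sum_(0 <= j < m) pm j.

Let mass_cvg : mass @ \oo --> (1 : R).
Proof.
have -> : mass = (fun m => series (exp_coeff lam) m * expR (- lam)).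
  apply/funext => m; rewrite /mass /series/= mulr_suml.
  by apply: eq_bigr => i _; rewrite /pm /poisson_pmf lam0.
rewrite -(expRxMexpNx_1 lam); apply: cvgMl.
exact: is_cvg_series_exp_coeff.
Qed.

Section solution.
Variables (f : nat -> R) (N : nat).
Hypothesis f1 : forall k, `|f k| <= 1.
Hypothesis fN : forall k, (N <= k)%N -> f k = 0.

Let mean := \sum_(0 <= k < N) f k * pm k.

Let mean1 : `|mean| <= 1.
Proof.
rewrite (le_trans (ler_norm_sum _ _ _))//.
apply: (@le_trans _ _ (mass N)).
  apply: ler_sum => i _; rewrite normrM (gtr0_norm (poisson_pmf_gt0 i)).
  by rewrite ler_piMl// ltW// poisson_pmf_gt0.
rewrite -(cvg_lim _ mass_cvg)//; apply: nondecreasing_cvgn_le.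
  apply/nondecreasing_seqP => n; rewrite /mass big_nat_recr//= lerDl.
  by rewrite ltW// poisson_pmf_gt0.
by apply/cvg_ex; exists 1.
Qed.

Let T k := \sum_(0 <= j < k.+1) (f j - mean) * pm j.

(** The solution of the Stein-Chen equation for the test function f; the equation leaves the value
    at 0 free. *)
Definition stein_sol k : R := if k is k'.+1 then T k' / (lam * pm k') else 0.

Lemma stein_equation k :
  lam * stein_sol k.+1 - k%:R * stein_sol k = f k - mean.
Proof.
have pm0 j : pm j != 0 by rewrite gt_eqF// poisson_pmf_gt0.
have l0 : lam != 0 by rewrite gt_eqF.
case: k => [|k].
  rewrite /= mul0r subr0 /T big_nat1; field.
  by rewrite pm0.
rewrite /= {1}/T big_nat_recr//= -/(T k).
have e : lam * pm k = pm k.+1 * k.+1%:R by rewrite poisson_pmfS mulrC.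
rewrite -[X in k.+1%:R * (_ / X)]/(lam * pm k) e.
by field; rewrite pm0 l0 nat1r pnatr_eq0.
Qed.

Let T_tail m : (N <= m.+1)%N -> T m = mean * (1 - mass m.+1).
Proof.
move=> Nm; rewrite /T.
under eq_bigr do rewrite mulrBl.
rewrite sumrB -mulr_sumr mulrBr mulr1; congr (_ - _).
rewrite (big_cat_nat _ Nm)//= [X in _ + X]big_nat_cond [X in _ + X]big1 ?addr0//.
by move=> i /andP[/andP[Ni _] _]; rewrite fN// mul0r.
Qed.

(** T tends to 0, so up to an arbitrary e it is minus the sum of its terms beyond k. By [pm_shift]
    that sum is a multiple of pm k, which cancels the denominator of [stein_sol]. *)
Let T_le k : `|T k| <= 2 * (lam * pm k * expR lam).
Proof.
apply/ler_addgt0Pr => e e0.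
have : \forall m \near \oo, `|1 - mass m.+1| <= e.
  move/cvgr_dist_le : mass_cvg => /(_ _ e0).
  move=> [M _ HM]; exists M => // m /= Mm; rewrite HM//=; exact: leqW.
move=> [M _ HM].
pose i := maxn M N.
have := HM (k + i)%N (leq_trans (leq_maxl M N) (leq_addl _ _)) => /= h.
have Tki : T (k + i) = T k + \sum_(0 <= j < i) (f (k.+1 + j)%N - mean) * pm (k.+1 + j).
  rewrite /T -addSn (@big_cat_nat _ _ _ k.+1)//= ?leq_addr//; congr (_ + _).
  by rewrite -{1}[k.+1]add0n big_addn addKn; apply: eq_bigr => j _; rewrite addnC.
have -> : T k = T (k + i) - \sum_(0 <= j < i) (f (k.+1 + j)%N - mean) * pm (k.+1 + j).
  by rewrite Tki addrK.
rewrite (le_trans (ler_normB _ _))// addrC lerD//.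
  rewrite (le_trans (ler_norm_sum _ _ _))//.
  apply: (@le_trans _ _ (\sum_(0 <= j < i) 2 * (pm k * lam * exp_coeff lam j))).
    apply: ler_sum => j _; rewrite normrM; apply: ler_pM => //.
      by rewrite (le_trans (ler_normB _ _))// (le_trans (lerD (f1 _) mean1)).
    by rewrite gtr0_norm ?poisson_pmf_gt0// pm_shift.
  rewrite -!mulr_sumr ler_wpM2l// [pm k * _]mulrC ler_wpM2l ?series_le//.
  by rewrite mulr_ge0 ?(ltW lam0)// ltW// poisson_pmf_gt0.
rewrite T_tail; last first.
  by rewrite (leq_trans (leq_maxr M N))// leqW// leq_addl.
rewrite normrM -[leRHS]mul1r; exact: ler_pM.
Qed.

Lemma stein_sol_bound k : `|stein_sol k| <= 2 * expR lam.
Proof.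
case: k => [|k] /=; first by rewrite normr0 mulr_ge0// expR_ge0.
have lp : 0 < lam * pm k by rewrite mulr_gt0// poisson_pmf_gt0.
rewrite normrM normfV (gtr0_norm lp) ler_pdivrMr// (le_trans (T_le k))//.
by rewrite [lam * pm k * _]mulrC mulrA.
Qed.

End solution.

End stein_solution.

Section bounded_expectation.
Context {R : realType} d (T : measurableType d) (P : probability T R).
Implicit Types (f g : T -> R) (b : T -> bool).

Definition Ex f : R := \int[P]_w f w.

(** Stable under all operations used below and sufficient for integrability, so that expectations
    can be handled as real numbers. *)
Definition bdd_meas f := measurable_fun setT f /\ exists M, forall w, `|f w| <= M.

Lemma bdd_meas_integrable f : bdd_meas f -> P.-integrable setT (EFin \o f).
Proof.
move=> [mf [M fM]]; apply: measurable_bounded_integrable => //.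
  by rewrite (le_lt_trans (probability_le1 P _)) ?ltry.
exists M; split; first exact: num_real.
by move=> N MN x _; exact: le_trans (fM x) (ltW MN).
Qed.

Lemma bdd_meas_cst (c : R) : bdd_meas (fun=> c).
Proof. by split; [exact: measurable_cst|exists `|c|]. Qed.

Lemma bdd_measD f g : bdd_meas f -> bdd_meas g ->
  bdd_meas (fun w => f w + g w).
Proof.
move=> [mf [M fM]] [mg [N gN]]; split; first exact: measurable_funD.
by exists (M + N) => w; rewrite (le_trans (ler_normD _ _))// lerD.
Qed.

Lemma bdd_measM f g : bdd_meas f -> bdd_meas g ->
  bdd_meas (fun w => f w * g w).
Proof.
move=> [mf [M fM]] [mg [N gN]]; split; first exact: measurable_funM.
by exists (M * N) => w; rewrite normrM ler_pM.
Qed.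

Lemma bdd_measB f g : bdd_meas f -> bdd_meas g ->
  bdd_meas (fun w => f w - g w).
Proof.
move=> bf bg; have := bdd_measD bf (bdd_measM (bdd_meas_cst (-1)) bg).
by under [X in bdd_meas X -> _]eq_fun do rewrite mulN1r.
Qed.

Lemma bdd_meas_sum (I : Type) (s : seq I) (p : pred I) (F : I -> T -> R) :
  (forall i, bdd_meas (F i)) -> bdd_meas (fun w => \sum_(i <- s | p i) F i w).
Proof.
move=> bF; elim: s => [|i s ih].
  by under [X in bdd_meas X]eq_fun do rewrite big_nil; exact: bdd_meas_cst.
under [X in bdd_meas X]eq_fun do rewrite big_cons.
by case: (p i) => //; exact: bdd_measD.
Qed.

Lemma bdd_meas_bool b : measurable_fun setT b -> bdd_meas (fun w => (b w)%:R).
Proof.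
move=> mb; split; last by exists 1 => w; case: (b w); rewrite ?normr1 ?normr0.
rewrite (_ : (fun w => _) = fun w => if b w then 1 else 0); last first.
  by apply/funext => w; case: (b w).
exact: measurable_fun_ifT.
Qed.

Lemma bdd_meas_nat (W : T -> nat) (phi : nat -> R) n : measurable_fun setT W ->
  (forall w, (W w <= n)%N) -> bdd_meas (fun w => phi (W w)).
Proof.
move=> mW Wn; split; first exact: (@measurableT_comp _ _ _ _ _ _ phi).
exists (\sum_(k < n.+1) `|phi k|) => w.
rewrite (bigD1 (inord (W w)))//= inordK ?ltnS// lerDl.
by rewrite sumr_ge0.
Qed.

Lemma Ex_cst (c : R) : Ex (fun=> c) = c.
Proof. by rewrite /Ex Rintegral_cst// [X in fine X]probability_setT mulr1. Qed.

Lemma ExD f g : bdd_meas f -> bdd_meas g -> Ex (fun w => f w + g w) = Ex f + Ex g.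
Proof. by move=> bf bg; rewrite /Ex RintegralD//; exact: bdd_meas_integrable. Qed.

Lemma ExB f g : bdd_meas f -> bdd_meas g -> Ex (fun w => f w - g w) = Ex f - Ex g.
Proof. by move=> bf bg; rewrite /Ex RintegralB//; exact: bdd_meas_integrable. Qed.

Lemma ExZ (c : R) f : bdd_meas f -> Ex (fun w => c * f w) = c * Ex f.
Proof. by move=> bf; rewrite /Ex RintegralZl//; exact: bdd_meas_integrable. Qed.

Lemma Ex_sum (I : Type) (s : seq I) (p : pred I) (F : I -> T -> R) :
  (forall i, bdd_meas (F i)) ->
  Ex (fun w => \sum_(i <- s | p i) F i w) = \sum_(i <- s | p i) Ex (F i).
Proof.
move=> bF; elim: s => [|i s ih].
  by under [X in Ex X]eq_fun do rewrite big_nil; rewrite Ex_cst big_nil.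
under [X in Ex X]eq_fun do rewrite big_cons.
rewrite big_cons; case: (p i) => //.
by rewrite ExD ?ih//; exact: bdd_meas_sum.
Qed.

Lemma Ex_le f g : bdd_meas f -> bdd_meas g -> (forall w, f w <= g w) -> Ex f <= Ex g.
Proof. by move=> bf bg fg; apply: le_Rintegral => //; exact: bdd_meas_integrable. Qed.

Lemma Ex_ge0 f : (forall w, 0 <= f w) -> 0 <= Ex f.
Proof. by move=> f0; exact: Rintegral_ge0. Qed.

Lemma Ex_norm_le f g : bdd_meas f -> bdd_meas g -> (forall w, `|f w| <= g w) ->
  `|Ex f| <= Ex g.
Proof.
move=> bf bg fg; rewrite ler_norml; apply/andP; split.
  rewrite -mulN1r -ExZ//; apply: Ex_le => //.
    exact: bdd_measM (bdd_meas_cst _) bg.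
  by move=> w; have := fg w; rewrite mulN1r ler_norml => /andP[].
by apply: Ex_le => // w; rewrite (le_trans (ler_norm _)).
Qed.

Lemma Ex_bool b : measurable_fun setT b -> Ex (fun w => (b w)%:R) = fine (P [set w | b w]).
Proof.
move=> mb; rewrite /Ex /Rintegral; congr fine.
have mS : measurable [set w | b w].
  by rewrite -[X in measurable X]setTI; exact: (mb measurableT [set true]).
rewrite -[in RHS](setIT [set w | b w]) -integral_indic//.
apply: eq_integral => w _; rewrite indicE; have [bw|bw] := boolP (b w).
  by rewrite mem_set.
by rewrite memNset//; exact/negP.
Qed.

End bounded_expectation.

Section poisson_approximation.
Context {R : realType} d (T : measurableType d) (P : probability T R) (lam : R).
Hypothesis lam0 : 0 < lam.

(* The second argument of [poisson_prob] is ignored by its definition. *)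
Lemma dTV_poisson_le (W : {RV P >-> nat}) n (eps : R) :
  (forall w, (W w <= n)%N) ->
  (forall g : nat -> R, (forall k, `|g k| <= 2 * expR lam) ->
    Ex P (fun w => lam * g (W w).+1 - (W w)%:R * g (W w)) <= eps) ->
  (dTV (distribution P W) (poisson_prob lam 0%N) <= (2^-1 * eps)%:E)%E.
Proof.
move=> Wn steinW; rewrite /dTV [leRHS]EFinM lee_pmul2l//.
apply: lime_le; first exact: is_cvg_nneseries.
near=> N.
pose p k := Ex P (fun w => (W w == k)%:R).
have mW : measurable_fun setT W by [].
have mWk k : measurable_fun setT (fun w => W w == k).
  exact: (@measurableT_comp _ _ _ _ _ _ (fun j => j == k)).
have pE k : distribution P W [set k] = (p k)%:E.
  rewrite /p Ex_bool// /distribution /pushforward/= fineK; last first.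
    apply: fin_num_measure; rewrite -[X in measurable X]setTI.
    exact: (mWk k measurableT [set true]).
  by congr (P _); apply/seteqP; split => w /=; [move=> ->|move=> /eqP].
have qE k : poisson_prob lam 0%N [set k] = (poisson_pmf lam k)%:E.
  by rewrite /poisson_prob/= lam0 esum_set1// lee_fin poisson_pmf_ge0.
(* This test function turns the partial sum of the distances into E f(W) - mean; the cut at N
   provides the finite support that [stein_sol] requires. *)
pose f k : R := if (k < N)%N then Num.sg (p k - poisson_pmf lam k) else 0.
have f1 k : `|f k| <= 1.
  by rewrite /f; case: ifP; rewrite ?normr0// normr_sg; case: (_ == _).
have fN k : (N <= k)%N -> f k = 0 by rewrite /f ltnNge => ->.
pose mean := \sum_(0 <= k < N) f k * poisson_pmf lam k.
have bWk k : bdd_meas (fun w => (W w == k)%:R : R) by exact: bdd_meas_bool.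
have fW w : f (W w) = \sum_(0 <= k < N) f k * (W w == k)%:R.
  rewrite /f; have [WN|WN] := ltnP (W w) N.
    rewrite big_mkord (bigD1 (Ordinal WN))//= eqxx mulr1 WN big1 ?addr0//.
    move=> i iW; rewrite [_ == _ :> nat]eq_sym.
    by rewrite -[W w]/(val (Ordinal WN)) val_eqE (negbTE iW) mulr0.
  rewrite big_nat big1// => i /andP[_ iN].
  by rewrite gtn_eqF ?mulr0// (leq_trans iN).
have ExfW : Ex P (fun w => f (W w)) = \sum_(0 <= k < N) f k * p k.
  under [X in Ex P X]eq_fun do rewrite fW.
  rewrite Ex_sum; first by apply: eq_bigr => k _; rewrite ExZ.
  by move=> k; apply: bdd_measM => //; exact: bdd_meas_cst.
rewrite (eq_bigr (fun k => `|p k - poisson_pmf lam k|%:E)); last first.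
  move=> k _; transitivity (`|(p k)%:E - (poisson_pmf lam k)%:E|)%E => //.
  by congr (`|_ - _|)%E; [exact: pE|exact: qE].
rewrite sumEFin lee_fin.
have -> : \sum_(0 <= k < N) `|p k - poisson_pmf lam k| =
    Ex P (fun w => f (W w)) - mean.
  rewrite ExfW -sumrB; rewrite !big_nat; apply: eq_bigr => k /andP[_ kN].
  by rewrite -mulrBr /f kN normrEsg.
rewrite -(Ex_cst P mean) -ExB; last 2 first.
- exact: (bdd_meas_nat _ mW Wn).
- exact: bdd_meas_cst.
apply: le_trans (steinW _ (stein_sol_bound lam0 f1 fN)).
rewrite le_eqVlt; apply/orP; left; apply/eqP; congr Ex; apply/funext => w.
by rewrite stein_equation.
Unshelve. all: by end_near. Qed.

End poisson_approximation.

Lemma measurable_nsum d (T : measurableType d) n (Q : pred 'I_n) (F : 'I_n -> T -> bool) :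
  (forall j, Q j -> measurable_fun setT (F j)) ->
  measurable_fun setT (fun w => \sum_(j < n | Q j) F j w)%N.
Proof.
move=> mF; elim: (index_enum _) => [|j s ih].
  by rewrite (_ : (fun _ => _) = cst 0%N)//; apply/funext => w; rewrite big_nil.
have [Qj|Qj] := boolP (Q j); last first.
  rewrite [X in measurable_fun _ X](_ : _ = fun w => \sum_(j <- s | Q j) F j w)%N //.
  by apply/funext => w; rewrite big_cons (negbTE Qj).
rewrite [X in measurable_fun _ X](_ : _ =
    fun w => (F j w + \sum_(j <- s | Q j) F j w)%N); last first.
  by apply/funext => w; rewrite big_cons Qj.
apply: measurable_fun_addn => //.
by apply: (measurableT_comp (f := nat_of_bool)) => //; exact: mF.
Qed.

(* [I i]: player [i] exceeds the threshold; [J i j] and [H i j]: player [j] does so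
   when his reward against [i] is replaced by 0 and by 1, respectively. *)
Section dissociated_sums.
Context {R : realType} d (T : measurableType d) (P : probability T R) (n : nat).
Variables (I : 'I_n -> T -> bool) (J H : 'I_n -> 'I_n -> T -> bool).
Variables (lo hi M D lam : R) (g : nat -> R).
Hypothesis mI : forall i, measurable_fun setT (I i).
Hypothesis mJ : forall i j, j != i -> measurable_fun setT (J i j).
Hypothesis mH : forall i j, j != i -> measurable_fun setT (H i j).
Hypothesis JI : forall i j w, j != i -> J i j w -> I j w.
Hypothesis IH : forall i j w, j != i -> I j w -> H i j w.

Let W w := (\sum_(i < n) I i w)%N.
Let Wt i w := (\sum_(j < n | j != i) J i j w)%N.

Hypothesis indepW : forall i (phi : nat -> R),
  Ex P (fun w => (I i w)%:R * phi (Wt i w)) =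
  Ex P (fun w => (I i w)%:R) * Ex P (fun w => phi (Wt i w)).
Hypothesis indepJ : forall i j, j != i ->
  Ex P (fun w => (I i w)%:R * (J i j w)%:R) =
  Ex P (fun w => (I i w)%:R) * Ex P (fun w => (J i j w)%:R).
Hypothesis indepH : forall i j, j != i ->
  Ex P (fun w => (I i w)%:R * (H i j w)%:R) =
  Ex P (fun w => (I i w)%:R) * Ex P (fun w => (H i j w)%:R).
Hypothesis ExJ : forall i j, j != i -> Ex P (fun w => (J i j w)%:R) = lo.
Hypothesis ExH : forall i j, j != i -> Ex P (fun w => (H i j w)%:R) = hi.
Hypothesis n2 : (2 <= n)%N.
Hypothesis gM : forall k, `|g k| <= M.
Hypothesis Dlo : `|lam - n%:R * lo| <= D.
Hypothesis Dhi : `|lam - n%:R * hi| <= D.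

Let p i := Ex P (fun w => (I i w)%:R).

Let other (i : 'I_n) : {j : 'I_n | j != i}.
Proof.
have [i0|i0] := eqVneq (i : nat) 0%N.
  by exists (Ordinal (leq_trans (ltnSn 1) n2)); rewrite -val_eqE /= i0.
by exists (Ordinal (ltnW n2)); rewrite -val_eqE /= eq_sym.
Qed.

Let bI i : bdd_meas (fun w => (I i w)%:R : R). Proof. exact: bdd_meas_bool. Qed.
Let bJ i j : j != i -> bdd_meas (fun w => (J i j w)%:R : R).
Proof. by move=> ji; apply: bdd_meas_bool; exact: mJ. Qed.
Let bH i j : j != i -> bdd_meas (fun w => (H i j w)%:R : R).
Proof. by move=> ji; apply: bdd_meas_bool; exact: mH. Qed.

Let p_lo i : lo <= p i.
Proof.
have [j ji] := other i; rewrite eq_sym in ji.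
rewrite -(ExJ ji); apply: Ex_le => // [|w]; first exact: bJ.
by rewrite ler_nat; case: (J j i w) (@JI _ _ w ji) => // /(_ isT) ->.
Qed.

Let p_hi i : p i <= hi.
Proof.
have [j ji] := other i; rewrite eq_sym in ji.
rewrite -(ExH ji); apply: Ex_le => // [|w]; first exact: bH.
by rewrite ler_nat; case: (I i w) (@IH _ _ w ji) => // /(_ isT) ->.
Qed.

Let lo0 : 0 <= lo.
Proof.
have [j ji] := other (Ordinal (ltnW n2)).
by rewrite -(ExJ ji); apply: Ex_ge0 => w.
Qed.

Let M0 : 0 <= M. Proof. exact: le_trans (gM 0%N). Qed.

Let mW : measurable_fun setT W. Proof. exact: measurable_nsum. Qed.
Let mWt i : measurable_fun setT (Wt i).
Proof. by apply: measurable_nsum => j ji; exact: mJ. Qed.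

Let W_le w : (W w <= n)%N.
Proof.
rewrite /W -[leqRHS]card_ord -sum1_card; apply: leq_sum => i _.
by case: (I i w).
Qed.

Let Wt_leW i w : (Wt i w <= W w)%N.
Proof.
rewrite /Wt /W big_mkcond; apply: leq_sum => j _; case: ifP => // ji.
by case: (J i j w) (@JI _ _ w ji) => // /(_ isT) ->.
Qed.

Let Wt_le i w : (Wt i w <= n)%N.
Proof. exact: leq_trans (Wt_leW i w) (W_le w). Qed.

Let bW (phi : nat -> R) : bdd_meas (fun w => phi (W w)).
Proof. exact: bdd_meas_nat mW W_le. Qed.
Let bWt (phi : nat -> R) i : bdd_meas (fun w => phi (Wt i w)).
Proof. exact: bdd_meas_nat (mWt i) (Wt_le i). Qed.

(** Distinct integers differ by at least 1, so boundedness alone yields a Lipschitz constant. *)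
Let g_diff (a b : nat) : (b <= a)%N -> `|g a - g b| <= 2 * M * (a%:R - b%:R).
Proof.
move=> ab; have [->|nab] := eqVneq a b; first by rewrite !subrr normr0 mulr0.
have : 1 <= a%:R - b%:R :> R.
  by rewrite -natrB// ler1n subn_gt0 ltn_neqAle eq_sym nab.
have := gM a; have := gM b; have := ler_normB (g a) (g b); have := M0.
by nra.
Qed.

(** Both terms are compared with E g(Wt + 1), since Wt is independent of [I i]. Replacing W by Wt
    costs E(W - Wt) <= n (hi - lo) + lo. On the event [I i], W - 1 counts the other players, and it
    exceeds Wt by at most the sum of [H i j] - [J i j], which is uncorrelated with [I i]. *)
Let term_le i :
  `|p i * Ex P (fun w => g (W w).+1) - Ex P (fun w => (I i w)%:R * g (W w))| <=
  hi * (2 * M) * (2 * n%:R * (hi - lo) + lo).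
Proof.
have hi0 : 0 <= hi by rewrite (le_trans lo0)// (le_trans (p_lo i)).
have lohi : lo <= hi by exact: le_trans (p_lo i) (p_hi i).
have p0 : 0 <= p i by exact: le_trans (p_lo i).
have -> : p i * Ex P (fun w => g (W w).+1) - Ex P (fun w => (I i w)%:R * g (W w)) =
   p i * Ex P (fun w => g (W w).+1 - g (Wt i w).+1) +
   Ex P (fun w => (I i w)%:R * (g (Wt i w).+1 - g (W w))).
  rewrite ExB; [|exact: (bW (fun k => g k.+1))|exact: (bWt (fun k => g k.+1))].
  under [X in _ = _ + Ex P X]eq_fun do rewrite mulrBr.
  rewrite ExB; last 2 first.
  - by apply: bdd_measM => //; exact: (bWt (fun k => g k.+1)).
  - by apply: bdd_measM.
  rewrite (indepW i (fun k => g k.+1)) /p; ring.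
have E1 : `|Ex P (fun w => g (W w).+1 - g (Wt i w).+1)| <=
    2 * M * (n%:R * (hi - lo) + lo).
  apply: (@le_trans _ _ (Ex P (fun w => 2 * M * ((W w)%:R - (Wt i w)%:R)))).
    apply: Ex_norm_le.
    - by apply: bdd_measB; [exact: (bW (fun k => g k.+1))|exact: (bWt (fun k => g k.+1))].
    - apply: bdd_measM; first exact: bdd_meas_cst.
      by apply: bdd_measB; [exact: (bW (fun k => k%:R))|exact: (bWt (fun k => k%:R))].
    - move=> w; rewrite (le_trans (g_diff _))// ?ltnS//.
      by rewrite ler_wpM2l ?mulr_ge0// -!natr1; lra.
  rewrite ExZ; last first.
    by apply: bdd_measB; [exact: (bW (fun k => k%:R))|exact: (bWt (fun k => k%:R))].
  rewrite ler_wpM2l ?mulr_ge0//.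
  rewrite ExB; [|exact: (bW (fun k => k%:R))|exact: (bWt (fun k => k%:R))].
  have -> : Ex P (fun w => (W w)%:R) = \sum_(j < n) p j.
    rewrite -Ex_sum//; congr Ex; apply/funext => w.
    by rewrite /W natr_sum.
  have -> : Ex P (fun w => (Wt i w)%:R) = \sum_(j < n | j != i) lo.
    rewrite [RHS]big_mkcond/=.
    rewrite (_ : (fun w => _) = fun w => \sum_(j < n) (if j != i then (J i j w)%:R else 0)).
      rewrite Ex_sum; last first.
        by move=> j; have [ji|_] := boolP (j != i); [exact: bJ|exact: bdd_meas_cst].
      apply: eq_bigr => j _; have [ji|_] := boolP (j != i); first exact: ExJ.
      exact: Ex_cst.
    by apply/funext => w; rewrite /Wt natr_sum big_mkcond.
  have sp : \sum_(j < n) p j <= n%:R * hi.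
    rewrite (le_trans (ler_sum _ (fun j _ => p_hi j)))//.
    by rewrite sumr_const card_ord mulr_natl.
  have sl : \sum_(j < n | j != i) lo = n%:R * lo - lo.
    have -> : n%:R * lo = \sum_(j < n) lo by rewrite sumr_const card_ord mulr_natl.
    by rewrite [in RHS](bigD1 i)//= addrAC subrr add0r.
  by rewrite sl; lra.
have E2 : `|Ex P (fun w => (I i w)%:R * (g (Wt i w).+1 - g (W w)))| <=
    2 * M * (p i * (n%:R * (hi - lo))).
  pose S w : R := \sum_(j < n) if j != i then (H i j w)%:R - (J i j w)%:R else 0.
  have bS : bdd_meas S.
    apply: bdd_meas_sum => j; have [ji|_] := boolP (j != i); last exact: bdd_meas_cst.
    by apply: bdd_measB; [exact: bH|exact: bJ].
  apply: (@le_trans _ _ (Ex P (fun w => 2 * M * ((I i w)%:R * S w)))).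
    apply: Ex_norm_le.
    - apply: bdd_measM => //.
      by apply: bdd_measB => //; exact: (bWt (fun k => g k.+1)).
    - by apply: bdd_measM; [exact: bdd_meas_cst|exact: bdd_measM].
    - move=> w; have [Ii|_] := boolP (I i w); last by rewrite !mul0r normr0 mulr0.
      rewrite !mul1r.
      have WE : W w = (\sum_(j < n | j != i) I j w).+1.
        by rewrite /W (bigD1 i)//= Ii.
      have WtW : (Wt i w <= \sum_(j < n | j != i) I j w)%N.
        apply: leq_sum => j ji.
        by case: (J i j w) (@JI _ _ w ji) => // /(_ isT) ->.
      rewrite distrC (le_trans (g_diff _))// ?WE ?ltnS// ler_wpM2l ?mulr_ge0//.
      have -> : S w = \sum_(j < n | j != i) (H i j w)%:R - (Wt i w)%:R.
        by rewrite /S -big_mkcond/= sumrB /Wt natr_sum.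
      rewrite -!natr1 opprD addrACA subrr addr0 lerD2r natr_sum.
      apply: ler_sum => j ji; rewrite ler_nat.
      by case: (I j w) (@IH _ _ w ji) => // /(_ isT) ->.
  rewrite ExZ; last exact: bdd_measM.
  rewrite ler_wpM2l ?mulr_ge0//.
  have -> : Ex P (fun w => (I i w)%:R * S w) =
      \sum_(j < n) if j != i then p i * (hi - lo) else 0.
    rewrite (_ : (fun w => _) = fun w => \sum_(j < n)
      if j != i then (I i w)%:R * (H i j w)%:R - (I i w)%:R * (J i j w)%:R else 0).
      rewrite Ex_sum; last first.
        move=> j; have [ji|_] := boolP (j != i); last exact: bdd_meas_cst.
        by apply: bdd_measB; apply: bdd_measM; rewrite ?bI//; [exact: bH|exact: bJ].
      apply: eq_bigr => j _; have [ji|_] := boolP (j != i); last exact: Ex_cst.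
      rewrite ExB; [|by apply: bdd_measM => //; exact: bH|by apply: bdd_measM => //; exact: bJ].
      by rewrite indepH// indepJ// ExH// ExJ// -mulrBr.
    apply/funext => w; rewrite mulr_sumr; apply: eq_bigr => j _.
    by case: ifP => _; rewrite ?mulr0// mulrBr.
  apply: (@le_trans _ _ (\sum_(j < n) p i * (hi - lo))).
    by apply: ler_sum => j _; case: ifP => // _; rewrite mulr_ge0// subr_ge0.
  by rewrite sumr_const card_ord -[leLHS]mulr_natl [leLHS]mulrCA lexx.
rewrite (le_trans (ler_normD _ _))// normrM ger0_norm//.
rewrite (le_trans (lerD (ler_wpM2l p0 E1) E2))//.
have q0 : 0 <= 2 * n%:R * (hi - lo) + lo.
  by rewrite addr_ge0// mulr_ge0 ?subr_ge0// mulr_ge0.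
apply: (@le_trans _ _ (p i * (2 * M) * (2 * n%:R * (hi - lo) + lo))).
  by rewrite le_eqVlt; apply/orP; left; apply/eqP; ring.
by apply: ler_wpM2r => //; apply: ler_wpM2r; rewrite ?mulr_ge0// p_hi.
Qed.

(** D enters twice: n lo <= sum p_i <= n hi gives |lam - sum p_i| <= D, and n (hi - lo) <= 2D bounds
    the effect of the dependence. *)
Lemma dissociated_stein_le :
  Ex P (fun w => lam * g (W w).+1 - (W w)%:R * g (W w)) <=
  M * D + (`|lam| + D) * (2 * M) * (4 * D + lo).
Proof.
have nn0 : 0 <= n%:R :> R by [].
have i0 := Ordinal (ltnW n2).
have lohi : lo <= hi by exact: le_trans (p_lo i0) (p_hi i0).
set G := Ex P (fun w => g (W w).+1).
have bg1 : bdd_meas (fun w => g (W w).+1) by exact: (bW (fun k => g k.+1)).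
have -> : Ex P (fun w => lam * g (W w).+1 - (W w)%:R * g (W w)) =
   (lam - \sum_(i < n) p i) * G +
   \sum_(i < n) (p i * G - Ex P (fun w => (I i w)%:R * g (W w))).
  rewrite ExB; last 2 first.
  - by apply: bdd_measM => //; exact: bdd_meas_cst.
  - by apply: bdd_measM; [exact: (bW (fun k => k%:R))|].
  rewrite ExZ// -/G sumrB -mulr_suml mulrBl addrA subrK; congr (_ - _).
  rewrite -Ex_sum; last by move=> i; exact: bdd_measM.
  by congr Ex; apply/funext => w; rewrite /W natr_sum mulr_suml.
have GM : `|G| <= M.
  rewrite -(Ex_cst P M); apply: Ex_norm_le => //; exact: bdd_meas_cst.
have D0 : 0 <= D by exact: le_trans Dlo.
move: Dlo Dhi; rewrite !ler_norml => /andP[lo1 lo2] /andP[hi1 hi2].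
have sp : `|lam - \sum_(i < n) p i| <= D.
  have s1 : \sum_(i < n) p i <= n%:R * hi.
    by rewrite (le_trans (ler_sum _ (fun j _ => p_hi j)))// sumr_const card_ord mulr_natl.
  have s2 : n%:R * lo <= \sum_(i < n) p i.
    by rewrite (le_trans _ (ler_sum _ (fun j _ => p_lo j)))// sumr_const card_ord mulr_natl.
  by rewrite ler_norml; move: s1 s2; lra.
apply: lerD.
  by rewrite (le_trans (ler_norm _))// normrM mulrC ler_pM.
apply: (@le_trans _ _ (\sum_(i < n) hi * (2 * M) * (2 * n%:R * (hi - lo) + lo))).
  by apply: ler_sum => i _; exact: le_trans (ler_norm _) (term_le i).
rewrite sumr_const card_ord -[leLHS]mulr_natl.
set Q := 2 * n%:R * (hi - lo) + lo.
have -> : n%:R * (hi * (2 * M) * Q) = (n%:R * hi) * (2 * M) * Q by ring.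
have nhi : n%:R * hi <= `|lam| + D by have := ler_norm lam; lra.
have nhi0 : 0 <= n%:R * hi by rewrite mulr_ge0// (le_trans lo0).
apply: ler_pM.
- by rewrite mulr_ge0// mulr_ge0.
- by rewrite addr_ge0// mulr_ge0 ?subr_ge0// mulr_ge0.
- by rewrite ler_wpM2r// mulr_ge0.
- by rewrite /Q; lra.
Qed.

End dissociated_sums.

(** * Independence and laws of the rewards *)

Section sigma_independence.
Context {R : realType} d (T : measurableType d) (P : probability T R).
Local Open Scope ereal_scope.

(** Dynkin's pi-lambda argument. Measurability of E belongs to the conclusion because complements
    and unions in the Dynkin system need it. *)
Lemma indep_g_sigma (G : set (set T)) (F : set T) :
  setI_closed G -> G `<=` measurable -> measurable F ->
  (forall E, G E -> P (E `&` F) = P E * P F) ->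
  forall E, <<s G >> E -> measurable E /\ P (E `&` F) = P E * P F.
Proof.
move=> GI Gm mF GF E; rewrite -setI_closed_g_dynkin_g_sigma_algebra//.
move: E; apply: smallest_sub; last by move=> E GE; split; [exact: Gm|exact: GF].
split=> /=.
- by split; [exact: measurableT|rewrite setTI probability_setT mul1e].
- move=> E [mE EF]; split; first exact: measurableC.
  rewrite setIC -setDE measureD//; last by rewrite (le_lt_trans (probability_le1 P _)) ?ltry.
  rewrite setIC [X in _ - X]EF probability_setC// muleBl//.
    by rewrite mul1e.
  by rewrite fin_num_measure.
- move=> E tE EF; have mE i : measurable (E i) by have [] := EF i.
  split; first exact: bigcup_measurable.
  rewrite setI_bigcupl measure_bigcup//; last 2 first.
  + by move=> i _; exact: measurableI.
  + by under eq_fun do rewrite setIC; exact: trivIset_setIl.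
  have PF : P F = (fine (P F))%:E by rewrite fineK// fin_num_measure.
  rewrite measure_bigcup// muleC PF -nneseriesZl//; apply: eq_eseriesr => i _.
  by have [_ e] := EF i; rewrite muleC -PF; exact: e.
Qed.

End sigma_independence.

Section cylinders.
Context {R : realType} d d' (T : measurableType d) (T' : measurableType d').
Context (P : probability T R) (I : finType) (A : {pred I}) (Y : I -> T -> T').
Hypothesis mY : forall i, i \in A -> measurable_fun setT (Y i).
Hypothesis indepY : mutually_independent P A Y.
Implicit Types K : {set I}.

Definition cylinders K : set (set T) :=
  [set E | exists2 B : I -> set T', (forall i, measurable (B i)) &
     E = \bigcap_(i in [set` K]) (Y i @^-1` B i)].

Lemma cylinders_setI K : setI_closed (cylinders K).
Proof.
move=> _ _ [B mB ->] [B' mB' ->]; exists (fun i => B i `&` B' i).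
  by move=> i; exact: measurableI.
by rewrite -bigcapI; apply: eq_bigcapr => i _; rewrite preimage_setI.
Qed.

Lemma cylinders_measurable K : K \subset A -> cylinders K `<=` measurable.
Proof.
move=> KA _ [B mB ->]; apply: fin_bigcap_measurable; first exact: finite_finset.
move=> i /= iK; rewrite -[X in measurable X]setTI; have iA := fintype.subsetP KA _ iK.
exact: mY.
Qed.

Lemma cylinders_indep K K' E E' : K \subset A -> K' \subset A -> disjoint (mem K) (mem K') ->
  cylinders K E -> cylinders K' E' -> P (E `&` E') = (P E * P E')%E.
Proof.
move=> KA KA' dK [B mB ->] [B' mB' ->].
pose C i := if i \in K then B i else B' i.
have mC i : measurable (C i) by rewrite /C; case: ifP.
have CB : \bigcap_(i in [set` K]) (Y i @^-1` B i) =
    \bigcap_(i in [set` K]) (Y i @^-1` C i).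
  by apply: eq_bigcapr => i /= iK; rewrite /C iK.
have CB' : \bigcap_(i in [set` K']) (Y i @^-1` B' i) =
    \bigcap_(i in [set` K']) (Y i @^-1` C i).
  apply: eq_bigcapr => i /= iK; rewrite /C ifN//.
  by rewrite disjoint_sym in dK; rewrite (disjointFr dK).
rewrite CB CB' -bigcap_setU.
have -> : [set` K] `|` [set` K'] = [set` K :|: K'].
  by apply/seteqP; split => i /=; rewrite inE => /orP.
have KUA : K :|: K' \subset A.
  apply/fintype.subsetP => i; rewrite finset.inE.
  by move=> /orP[]; [exact: (fintype.subsetP KA)|exact: (fintype.subsetP KA')].
rewrite !indepY//.
rewrite -bigU//; apply: eq_bigl => i.
by rewrite finset.inE.
Qed.

Lemma sigma_indep K K' E E' : K \subset A -> K' \subset A -> disjoint (mem K) (mem K') ->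
  <<s cylinders K >> E -> <<s cylinders K' >> E' ->
  P (E `&` E') = (P E * P E')%E.
Proof.
move=> KA KA' dK sE sE'.
have mE : measurable E.
  by apply: sE; split; [exact: sigma_algebra_measurable|exact: cylinders_measurable].
have h F : cylinders K' F -> P (E `&` F) = (P E * P F)%E.
  move=> cF.
  have mF : measurable F by exact: cylinders_measurable cF.
  apply: (indep_g_sigma (@cylinders_setI K) (cylinders_measurable KA) mF _ sE).2.
  by move=> G cG; exact: cylinders_indep cG cF.
rewrite setIC muleC.
apply: (indep_g_sigma (@cylinders_setI K') (cylinders_measurable KA') mE _ sE').2.
by move=> F cF; rewrite setIC muleC; exact: h.
Qed.

End cylinders.

Section fubini_avg.
Context {R : realType} d (T : measurableType d) (P : probability T R).
Variables (nu : probability R R) (S : T -> R) (X : {RV P >-> R}).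
Hypothesis mS : measurable_fun setT S.
Hypothesis lawX : forall B, measurable B -> distribution P X B = nu B.
Hypothesis indepSX : forall A B, measurable A -> measurable B ->
  P (S @^-1` A `&` X @^-1` B) = (P (S @^-1` A) * P (X @^-1` B))%E.

(** By independence the joint law of S and X is the product of the law of S and [nu], and Tonelli's
    theorem integrates over the reward first. *)
Lemma integral_avg (u : R -> \bar R) : nnm u ->
  (\int[P]_w u (S w + (X w - 2^-1))%R = \int[P]_w avg nu u (S w))%E.
Proof.
move=> [u0 mu].
pose S' : {mfun T >-> R} := HB.pack S (isMeasurableFun.Build _ _ _ _ S mS).
have mSX : measurable_fun setT (fun w => (S w, X w)).
  exact: measurable_fun_pair.
pose SX : {mfun T >-> (R * R)%type} :=
  HB.pack (fun w => (S w, X w)) (isMeasurableFun.Build _ _ _ _ _ mSX).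
pose f (z : R * R) := u (z.1 + (z.2 - 2^-1))%R.
have mf : measurable_fun setT f.
  apply: (measurableT_comp mu).
  by apply: measurable_funD => //; apply: measurable_funB.
have navg : nnm (avg nu u) by exact: nnm_avg.
have -> : (\int[P]_w avg nu u (S w) = \int[distribution P S']_s avg nu u s)%E.
  rewrite /distribution ge0_integral_pushforward ?preimage_setT//.
  - by have [] := navg.
  - by move=> y _; have [+ _] := navg.
have -> : (\int[P]_w u (S w + (X w - 2^-1))%R = \int[distribution P SX]_z f z)%E.
  rewrite /distribution ge0_integral_pushforward ?preimage_setT//.
  by move=> z _; exact: u0.
have -> : (\int[distribution P S']_s avg nu u s =
    \int[distribution P S' \x nu]_z f z)%E.
  by rewrite fubini_tonelli1// => z; exact: u0.
apply: eq_measure_integral => Z mZ _; apply/esym.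
apply: product_measure_unique => // B C mB mC.
rewrite /distribution /pushforward.
transitivity (P (S @^-1` B) * P (X @^-1` C))%E; first exact: indepSX.
by congr (_ * _)%E; exact: lawX.
Qed.

End fubini_avg.

Section tournament.
Context {R : realType} (D : set R) (nu : probability R R).
Context d (T : measurableType d) (P : probability T R) (n : nat).
Variable X : 'I_n -> 'I_n -> {RV P >-> R}.
Hypothesis model : round_robin D nu X.
Implicit Types (i j : 'I_n) (K : {set 'I_n * 'I_n}).

(** For i <> j, the index of their game in [reward_indep], where pairs are increasing. *)
Definition pair_of i j := if (i < j)%N then (i, j) else (j, i).

Let A := [pred ij : 'I_n * 'I_n | (ij.1 < ij.2)%N].
Let Y (ij : 'I_n * 'I_n) w := (X ij.1 ij.2 w, X ij.2 ij.1 w).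

Let mY ij : ij \in A -> measurable_fun setT (Y ij).
Proof. by move=> _; exact: measurable_fun_pair. Qed.

(** The sample space with the sigma-algebra generated by the games in K. Dependence on these games
    only becomes measurability on this type and is proved by the usual measurability lemmas. *)
Definition gen K := g_sigma_algebraType (cylinders Y K).

Lemma measurable_reward K i j : i != j -> pair_of i j \in K ->
  measurable_fun (setT : set (gen K)) (X i j : gen K -> R).
Proof.
move=> ij ijK _ B mB; rewrite setTI; apply: sub_gen_smallest.
(* Only the coordinate of the game between i and j is constrained, in the component that holds the
   reward of i. *)
exists (fun p => if p == pair_of i j then
    if (i < j)%N then B `*` setT else setT `*` B else setT).
  move=> p; case: ifP => _; last exact: measurableT.
  by case: ifP => _; apply: measurableX.
apply/seteqP; split => w /=.
  move=> Bw p /= pK; have [->|_] := eqVneq p (pair_of i j); last by [].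
  by rewrite /pair_of /Y; case: ifP.
move=> /(_ _ ijK) /=; rewrite eqxx /pair_of /Y.
by case: ifP => _ [].
Qed.

Lemma gen_measurable K d' (T' : measurableType d') (f : T -> T') : K \subset A ->
  measurable_fun (setT : set (gen K)) (f : gen K -> T') -> measurable_fun setT f.
Proof.
move=> KA mf _ B mB; have := mf measurableT B mB; rewrite !setTI => s.
by apply: s; split; [exact: sigma_algebra_measurable|exact: (cylinders_measurable mY KA)].
Qed.

Lemma gen_indep K K' d1 d2 (T1 : measurableType d1) (T2 : measurableType d2)
    (f1 : T -> T1) (f2 : T -> T2) B1 B2 :
  K \subset A -> K' \subset A -> disjoint (mem K) (mem K') ->
  measurable_fun (setT : set (gen K)) (f1 : gen K -> T1) ->
  measurable_fun (setT : set (gen K')) (f2 : gen K' -> T2) ->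
  measurable B1 -> measurable B2 ->
  P (f1 @^-1` B1 `&` f2 @^-1` B2) = (P (f1 @^-1` B1) * P (f2 @^-1` B2))%E.
Proof.
move=> KA KA' dK m1 m2 mB1 mB2.
apply: (@sigma_indep _ _ _ _ _ _ _ A Y mY (reward_indep model) K K') => //.
  by have := m1 measurableT B1 mB1; rewrite setTI.
by have := m2 measurableT B2 mB2; rewrite setTI.
Qed.

Lemma Ex_indep_bool K K' (b b' : T -> bool) :
  K \subset A -> K' \subset A -> disjoint (mem K) (mem K') ->
  measurable_fun (setT : set (gen K)) (b : gen K -> bool) ->
  measurable_fun (setT : set (gen K')) (b' : gen K' -> bool) ->
  Ex P (fun w => (b w)%:R * (b' w)%:R) =
  Ex P (fun w => (b w)%:R) * Ex P (fun w => (b' w)%:R).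
Proof.
move=> KA KA' dK mb mb'.
have Mb := gen_measurable KA mb; have Mb' := gen_measurable KA' mb'.
have -> : (fun w => (b w)%:R * (b' w)%:R) = (fun w => (b w && b' w)%:R : R).
  by apply/funext => w; rewrite -natrM mulnb.
rewrite !Ex_bool//; last exact: measurable_and.
have := gen_indep KA KA' dK mb mb' (B1 := [set true]) (B2 := [set true]).
move=> /(_ _ _)/wrap[]// => e.
have -> : [set w | b w && b' w] = b @^-1` [set true] `&` b' @^-1` [set true].
  by apply/seteqP; split => w /=; [move=> /andP[]|move=> [-> ->]].
rewrite [X in fine X]e fineM//; apply: fin_num_measure.
  by rewrite -[X in measurable X]setTI; exact: Mb.
by rewrite -[X in measurable X]setTI; exact: Mb'.
Qed.

(** W has finitely many values, so phi(W) is a finite combination of indicators, to which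
    [Ex_indep_bool] applies. *)
Lemma Ex_indep_nat K K' (b : T -> bool) (W : T -> nat) (phi : nat -> R) m :
  K \subset A -> K' \subset A -> disjoint (mem K) (mem K') ->
  measurable_fun (setT : set (gen K)) (b : gen K -> bool) ->
  measurable_fun (setT : set (gen K')) (W : gen K' -> nat) ->
  (forall w, (W w <= m)%N) ->
  Ex P (fun w => (b w)%:R * phi (W w)) =
  Ex P (fun w => (b w)%:R) * Ex P (fun w => phi (W w)).
Proof.
move=> KA KA' dK mb mW Wm.
have Mb := gen_measurable KA mb; have MW := gen_measurable KA' mW.
have mWk (k : 'I_m.+1) : measurable_fun (setT : set (gen K'))
    ((fun w => W w == k) : gen K' -> bool).
  exact: (@measurableT_comp _ _ _ _ _ _ (fun l => l == k :> nat)).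
have MWk (k : 'I_m.+1) := gen_measurable KA' (mWk k).
have phiE w : phi (W w) = \sum_(k < m.+1) phi k * (W w == k)%:R.
  have Ww : (W w < m.+1)%N by rewrite ltnS.
  rewrite (bigD1 (Ordinal Ww))//= eqxx mulr1 big1 ?addr0// => k kW.
  rewrite eq_sym -[W w]/(val (Ordinal Ww)) val_eqE (negbTE kW) mulr0 //.
have bphi (k : 'I_m.+1) : bdd_meas (fun w => phi k * (W w == k)%:R).
  by apply: bdd_measM; [exact: bdd_meas_cst|exact: bdd_meas_bool].
have -> : Ex P (fun w => phi (W w)) = \sum_(k < m.+1) phi k * Ex P (fun w => (W w == k)%:R).
  rewrite (_ : (fun w => _) = fun w => \sum_(k < m.+1) phi k * (W w == k)%:R); last first.
    by apply/funext => w; exact: phiE.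
  by rewrite Ex_sum//; apply: eq_bigr => k _; rewrite ExZ//; exact: bdd_meas_bool.
rewrite (_ : (fun w => _) =
    fun w => \sum_(k < m.+1) phi k * ((b w)%:R * (W w == k)%:R)); last first.
  by apply/funext => w; rewrite phiE mulr_sumr; apply: eq_bigr => k _; rewrite mulrCA.
have bb (k : 'I_m.+1) : bdd_meas (fun w => (b w)%:R * (W w == k)%:R : R).
  by apply: bdd_measM; exact: bdd_meas_bool.
rewrite Ex_sum; last by move=> k; apply: bdd_measM => //; exact: bdd_meas_cst.
rewrite mulr_sumr; apply: eq_bigr => k _.
by rewrite ExZ// mulrCA (Ex_indep_bool KA KA' dK mb (mWk k)).
Qed.

End tournament.

Section reward_sums.
Context {R : realType} (D : set R) (nu : probability R R).
Context d (T : measurableType d) (P : probability T R) (n : nat).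
Variable X : 'I_n -> 'I_n -> {RV P >-> R}.
Hypothesis model : round_robin D nu X.
Implicit Types (i j : 'I_n) (J : {set 'I_n}).

Let A := [pred ij : 'I_n * 'I_n | (ij.1 < ij.2)%N].

Definition pairs i J : {set 'I_n * 'I_n} := [set pair_of i j | j in J]%SET.

Lemma pair_of_A i j : i != j -> pair_of i j \in A.
Proof.
move=> ij; rewrite /pair_of; case: ltnP => [//|ji]; rewrite inE/=.
by rewrite ltn_neqAle ji andbT eq_sym.
Qed.

Lemma pair_of_inj i : injective (pair_of i).
Proof.
by move=> j k; rewrite /pair_of; case: ltnP => ij; case: ltnP => ik [] // *;
  apply/val_inj; congruence.
Qed.

Lemma pairs_A i J : i \notin J -> pairs i J \subset A.
Proof.
move=> iJ; apply/fintype.subsetP => p /finset.imsetP[j jJ ->].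
by apply: pair_of_A; apply: contraNneq iJ => ->.
Qed.

Definition centered_sum i J w : R := \sum_(j in J) (X i j w - 2^-1).

Lemma gen_measurable_sum i (Q : pred 'I_n) (K : {set 'I_n * 'I_n}) (c : R) :
  (forall j, Q j -> i != j) -> (forall j, Q j -> pair_of i j \in K) ->
  measurable_fun (setT : set (gen X K))
    ((fun w => \sum_(j < n | Q j) (X i j w - c)) : gen X K -> R).
Proof.
move=> Qi QK.
rewrite (_ : (fun w => _) = fun w => \sum_(j < n) if Q j then X i j w - c else 0); last first.
  by apply/funext => w; rewrite big_mkcond.
apply: measurable_sum => j; have [Qj|_] := boolP (Q j); last exact: measurable_cst.
apply: measurable_funB => //; apply: measurable_reward; [exact: Qi|exact: QK].
Qed.

(** Integrating out the reward against one opponent k turns u into [avg nu u]; the induction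
    therefore runs over all u. *)
Lemma integral_centered_sum m i J (u : R -> \bar R) :
  i \notin J -> #|J| = m -> nnm u ->
  (\int[P]_w u (centered_sum i J w) = iter m (avg nu) u 0%R)%E.
Proof.
elim: m J u => [|m ih] J u iJ Jm nu_u.
  move/eqP : Jm; rewrite finset.cards_eq0 => /eqP ->.
  rewrite /centered_sum (_ : (fun w => _) = cst (u 0%R)); last first.
    by apply/funext => w; rewrite finset.big_set0.
  by rewrite integral_cst//= probability_setT mule1.
have /finset.set0Pn[k kJ] : J != finset.set0 by rewrite -finset.cards_eq0 Jm.
pose J' := (J :\ k)%SET.
have J'm : #|J'| = m by move: Jm; rewrite (finset.cardsD1 k) kJ add1n => -[].
have iJ' : i \notin J' by rewrite finset.in_setD1 (negbTE iJ) andbF.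
have ik : i != k by apply: contraNneq iJ => ->.
have kJ' : k \notin J' by rewrite finset.in_setD1 eqxx.
rewrite iterSr -(ih J' _ iJ' J'm); last exact: nnm_avg.
have m1 : measurable_fun (setT : set (gen X (pairs i J')))
    (centered_sum i J' : gen X (pairs i J') -> R).
  apply: gen_measurable_sum => [j jJ'|j jJ']; last exact: finset.imset_f.
  by apply: contraNneq iJ' => ->.
have m2 : measurable_fun (setT : set (gen X (pairs i [set k]%SET)))
    (X i k : gen X (pairs i [set k]%SET) -> R).
  by apply: measurable_reward => //; apply: finset.imset_f; rewrite finset.in_set1.
have ik1 : i \notin [set k]%SET by rewrite finset.in_set1.
have dis : disjoint (mem (pairs i J')) (mem (pairs i [set k]%SET)).
  rewrite -finset.setI_eq0 -finset.subset0; apply/fintype.subsetP => p.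
  rewrite finset.inE => /andP[/finset.imsetP[j jJ' ->]].
  move=> /finset.imsetP[l]; rewrite finset.in_set1 => /eqP -> /pair_of_inj jk.
  by rewrite -jk jJ' in kJ'.
rewrite -(@integral_avg _ _ _ P nu (centered_sum i J') (X i k)).
- apply: eq_integral => w _; congr u.
  by rewrite /centered_sum (finset.big_setD1 k kJ)/= addrC.
- exact: (gen_measurable (pairs_A iJ') m1).
- by move=> B mB; exact: (reward_law model).
- move=> B C mB mC.
  exact: (gen_indep model (pairs_A iJ') (pairs_A ik1) dis m1 m2).
- by [].
Qed.

Lemma Ex_centered_sum i J (z : R) : i \notin J ->
  Ex P (fun w => (z < centered_sum i J w)%R%:R) = tail nu #|J| z.
Proof.
move=> iJ; rewrite /Ex /tail -(integral_centered_sum iJ erefl (nnm_above z)).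
rewrite /Rintegral; congr fine; apply: eq_integral => w _.
by rewrite /above; case: ifP.
Qed.

End reward_sums.

Section moments.
Context {R : realType} (D : set R) (nu : probability R R).
Context d (T : measurableType d) (P : probability T R) (n : nat).
Variable X : 'I_n -> 'I_n -> {RV P >-> R}.
Hypothesis model : round_robin D nu X.
Hypothesis D_sub : D `<=` `[0, 1].
Hypothesis D_gt1 : exists a b : R, [/\ D a, D b & a <> b].
Variables (i j : 'I_n).
Hypothesis ij : i != j.
Variables mu sigma : R.
Hypothesis mu_def : mu = fine 'E_P[X i j].
Hypothesis sigma_def : sigma = Num.sqrt (fine 'V_P[X i j]).
Local Notation I01 := [set` `[(0 : R), 1]].

Let X01 (k l : 'I_n) w : k != l -> 0 <= X k l w <= 1.
Proof. by move=> kl; have := D_sub (reward_valued model kl w); rewrite /= in_itv. Qed.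

Let bX (k l : 'I_n) : k != l -> bdd_meas (X k l).
Proof.
move=> kl; split=> //; exists 1 => w.
by have /andP[x0 x1] := X01 w kl; rewrite ger0_norm.
Qed.

Let preX : X i j @^-1` I01 = setT.
Proof. by apply/seteqP; split => // w _ /=; rewrite in_itv/= X01. Qed.

Lemma reward_law_unit : nu I01 = 1%E.
Proof.
rewrite -(reward_law model ij)//= /distribution /pushforward preX.
exact: probability_setT.
Qed.

Let Rintegral_reward (f : R -> R) : measurable_fun setT f -> bdd_meas (f \o X i j) ->
  \int[nu]_(x in I01) f x = Ex P (fun w => f (X i j w)).
Proof.
move=> mf bf.
have -> : \int[nu]_(x in I01) f x = \int[distribution P (X i j)]_(x in I01) f x.
  congr fine; apply: eq_measure_integral => B mB _; apply/esym.
  exact: (reward_law model).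
rewrite /Ex /Rintegral /distribution; congr fine.
rewrite (@integral_pushforward _ _ _ _ _ (X i j)) ?preX//.
- exact/measurable_EFinP.
- exact: bdd_meas_integrable.
Qed.

(** The two rewards of a game have the same law and sum to 1. *)
Let Ex_reward : Ex P (X i j) = 2^-1.
Proof.
have ji : j != i by rewrite eq_sym.
have e : Ex P (X i j) = Ex P (X j i).
  rewrite /Ex /Rintegral; congr fine.
  transitivity (\int[distribution P (X i j)]_(x in setT) (x%:E))%E.
    rewrite /distribution integral_pushforward ?preimage_setT//.
    exact: bdd_meas_integrable (bX ij).
  transitivity (\int[distribution P (X j i)]_(x in setT) (x%:E))%E.
    apply: eq_measure_integral => B mB _.
    transitivity (nu B); first exact: (reward_law model).
    by apply/esym; exact: (reward_law model).
  rewrite /distribution integral_pushforward ?preimage_setT//.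
  exact: bdd_meas_integrable (bX ji).
have : Ex P (fun w => X i j w + X j i w) = 1.
  rewrite -[RHS](Ex_cst P); congr Ex; apply/funext => w.
  exact: (reward_sum model).
by rewrite ExD; [rewrite -e; lra|exact: bX|exact: bX].
Qed.

Let bdev : bdd_meas (fun w => X i j w - 2^-1).
Proof. by apply: bdd_measB; [exact: bX|exact: bdd_meas_cst]. Qed.

Lemma reward_mean : mu = 2^-1.
Proof. by rewrite mu_def -Ex_reward unlock. Qed.

Lemma reward_law_mean : \int[nu]_(x in I01) (x - 2^-1) = 0.
Proof.
rewrite (@Rintegral_reward (fun x => x - 2^-1)) ?ExB//.
- by rewrite Ex_reward Ex_cst subrr.
- exact: bX.
- exact: bdd_meas_cst.
- exact: measurable_funB.
Qed.

Let bdev2 : bdd_meas (fun w => (X i j w - 2^-1) ^+ 2).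
Proof. by have := bdd_measM bdev bdev. Qed.

Let sigmaE : sigma = Num.sqrt (Ex P (fun w => (X i j w - 2^-1) ^+ 2)).
Proof.
rewrite sigma_def; congr Num.sqrt.
rewrite /variance covariance.unlock expectation.unlock /Ex /Rintegral; congr fine.
apply: eq_integral => w _.
have -> : fine (\int[P]_w (X i j w)%:E) = 2^-1 by exact: Ex_reward.
by rewrite !fctE expr2.
Qed.

Lemma reward_law_var : \int[nu]_(x in I01) ((x - 2^-1) ^+ 2) = sigma ^+ 2.
Proof.
rewrite (@Rintegral_reward (fun x => (x - 2^-1) ^+ 2)) => [|//|//].
  by rewrite sigmaE sqr_sqrtr//; apply: Ex_ge0 => w; exact: sqr_ge0.
by apply: measurable_funX; exact: measurable_funB.
Qed.

(** D has a point a other than 1/2, and the variance is at least (a - 1/2)^2 times the positive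
    probability of a. *)
Lemma reward_sd_gt0 : 0 < sigma.
Proof.
have [a Da a2] : exists2 a, D a & a != 2^-1.
  have [a [b [Da Db /eqP ab]]] := D_gt1.
  have [ea|na] := eqVneq a 2^-1; last by exists a.
  by exists b => //; apply: contra ab => /eqP ->; rewrite ea.
rewrite sigmaE sqrtr_gt0.
have mXa : measurable_fun setT (fun w => X i j w == a).
  exact: measurable_fun_eqr.
have p0 : 0 < Ex P (fun w => (X i j w == a)%:R).
  rewrite Ex_bool//.
  have -> : [set w | X i j w == a] = [set w | X i j w = a].
    by apply/seteqP; split => w /= /eqP.
  have h := reward_charge model ij Da.
  rewrite -lte_fin fineK//; apply: fin_num_measure.
  have mX : measurable_fun setT (X i j) by [].
  by have := mX measurableT [set a] (measurable_set1 a); rewrite setTI.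
apply: (@lt_le_trans _ _ ((a - 2^-1) ^+ 2 * Ex P (fun w => (X i j w == a)%:R))).
  by rewrite mulr_gt0// exprn_even_gt0//= subr_eq0.
rewrite -ExZ; last exact: bdd_meas_bool.
apply: Ex_le => //.
  by apply: bdd_measM; [exact: bdd_meas_cst|exact: bdd_meas_bool].
move=> w; have [->|_] := eqVneq (X i j w) a; first by rewrite mulr1.
by rewrite mulr0 sqr_ge0.
Qed.

End moments.

(** * Poisson approximation of the number of exceedances *)

Section exceedances_approximation.
Context {R : realType} (D : set R) (nu : probability R R).
Context d (T : measurableType d) (P : probability T R) (n : nat).
Variable X : 'I_n -> 'I_n -> {RV P >-> R}.
Hypothesis model : round_robin D nu X.
Hypothesis D_sub : D `<=` `[0, 1].
Hypothesis n2 : (2 <= n)%N.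
Variables (sigma t : R).
Hypothesis sigma0 : 0 < sigma.
Implicit Types (i j : 'I_n).

Let A := [pred ij : 'I_n * 'I_n | (ij.1 < ij.2)%N].
Let z : R := Num.sqrt (n%:R - 1) * sigma * threshold n t.
Let I i w := threshold n t < norm_score X 2^-1 sigma i w.
Let rest i j : {set 'I_n} := [set k | (k != i) && (k != j)]%SET.
Let CS i j w := centered_sum X j (rest i j) w.
(** A reward 0 against i contributes -1/2 to the centered score of j, hence the cutoff z + 1/2; a
    reward 1 contributes 1/2 and gives z - 1/2 for [H]. *)
Let J i j w := z + 2^-1 < CS i j w.
Let H i j w := z - 2^-1 < CS i j w.

Let X01 i j w : i != j -> 0 <= X i j w <= 1.
Proof. by move=> ij; have := D_sub (reward_valued model ij w); rewrite /= in_itv. Qed.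

Let score_split i j w : j != i ->
  score X j w - (n%:R - 1) * 2^-1 = (X j i w - 2^-1) + CS i j w.
Proof.
move=> ji; have -> : score X j w - (n%:R - 1) * 2^-1 =
    \sum_(k < n | k != j) (X j k w - 2^-1).
  rewrite sumrB; congr (_ - _).
  have e : n%:R * 2^-1 = \sum_(k < n) 2^-1 :> R.
    by rewrite sumr_const card_ord mulr_natl.
  by rewrite mulrBl mul1r e (bigD1 j)//= addrAC subrr add0r.
rewrite (bigD1 i)/=; last by rewrite eq_sym.
congr (_ + _); apply: eq_bigl => k.
by rewrite finset.inE andbC.
Qed.

Let rest_card i j : j != i -> #|rest i j| = (n - 2)%N.
Proof.
move=> ji; have -> : rest i j = (~: [set i; j])%SET.
  by apply/finset.setP => k; rewrite !finset.inE negb_or.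
by rewrite finset.cardsCs finset.setCK finset.cards2 card_ord eq_sym ji.
Qed.

Let rest_notin i j : j \notin rest i j.
Proof. by rewrite finset.inE eqxx andbF. Qed.

Let I_score i w : I i w = (z < score X i w - (n%:R - 1) * 2^-1).
Proof.
rewrite /I /norm_score /z ltr_pdivlMr; first by rewrite mulrC.
rewrite mulr_gt0// sqrtr_gt0 subr_gt0 ltr1n.
exact: n2.
Qed.

(** The games of player i; K' consists of the games without i. [I i] depends on the former only, all
    [J i j] and [H i j] on the latter, whence the independence required by
    [dissociated_stein_le]. *)
Let K i := pairs i (~: [set i])%SET.
Let K' i := [set p : 'I_n * 'I_n | (p.1 < p.2)%N && ((p.1 != i) && (p.2 != i))]%SET.

Let KA i : K i \subset A.
Proof. by apply: pairs_A; rewrite !finset.inE eqxx. Qed.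

Let K'A i : K' i \subset A.
Proof. by apply/fintype.subsetP => p; rewrite finset.inE => /andP[]. Qed.

Let dK i : disjoint (mem (K i)) (mem (K' i)).
Proof.
rewrite -finset.setI_eq0 -finset.subset0; apply/fintype.subsetP => p.
rewrite finset.inE => /andP[/finset.imsetP[j _ ->]].
by rewrite finset.inE /pair_of; case: ifP => _ /=; rewrite eqxx ?andbF.
Qed.

Let gen_I i : measurable_fun (setT : set (gen X (K i))) (I i : gen X (K i) -> bool).
Proof.
apply: measurable_fun_ltr => //; apply: measurable_funM => //.
apply: measurable_funB => //.
rewrite (_ : score X i = fun w => \sum_(j < n | j != i) (X i j w - 0)); last first.
  by apply/funext => w; apply: eq_bigr => j _; rewrite subr0.
apply: gen_measurable_sum => j ji; first by rewrite eq_sym.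
by apply: finset.imset_f; rewrite !finset.inE.
Qed.

Let gen_CS i j : j != i ->
  measurable_fun (setT : set (gen X (K' i))) (CS i j : gen X (K' i) -> R).
Proof.
move=> ji; apply: gen_measurable_sum => k; rewrite finset.inE => /andP[ki kj].
  by rewrite eq_sym.
rewrite /pair_of; case: ltnP => jk; rewrite finset.inE/= ?jk ji ki//.
by rewrite ltn_neqAle jk val_eqE kj.
Qed.

Let gen_J i j : j != i ->
  measurable_fun (setT : set (gen X (K' i))) (J i j : gen X (K' i) -> bool).
Proof. by move=> ji; apply: measurable_fun_ltr => //; exact: gen_CS. Qed.

Let gen_H i j : j != i ->
  measurable_fun (setT : set (gen X (K' i))) (H i j : gen X (K' i) -> bool).
Proof. by move=> ji; apply: measurable_fun_ltr => //; exact: gen_CS. Qed.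

Lemma exceedances_stein_le (lam M B : R) (g : nat -> R) :
  (forall k, `|g k| <= M) ->
  `|lam - n%:R * tail nu (n - 2) (z + 2^-1)| <= B ->
  `|lam - n%:R * tail nu (n - 2) (z - 2^-1)| <= B ->
  Ex P (fun w => lam * g (exceedances X 2^-1 sigma t w).+1 -
    (exceedances X 2^-1 sigma t w)%:R * g (exceedances X 2^-1 sigma t w)) <=
  M * B + (`|lam| + B) * (2 * M) * (4 * B + tail nu (n - 2) (z + 2^-1)).
Proof.
move=> gM Blo Bhi.
apply: (@dissociated_stein_le _ _ _ P n I J H _ (tail nu (n - 2) (z - 2^-1))) => //.
- by move=> i; exact: (gen_measurable (@KA i) (@gen_I i)).
- by move=> i j ji; exact: (gen_measurable (@K'A i) (gen_J ji)).
- by move=> i j ji; exact: (gen_measurable (@K'A i) (gen_H ji)).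
- move=> i j w ji; rewrite /J I_score (score_split _ ji).
  by have /andP[x0 x1] := X01 w ji; lra.
- move=> i j w ji; rewrite /H I_score (score_split _ ji).
  by have /andP[x0 x1] := X01 w ji; lra.
- move=> i phi.
  apply: (Ex_indep_nat model phi (@KA i) (@K'A i) (@dK i) (@gen_I i) (m := n)).
    by apply: measurable_nsum => j; exact: gen_J.
  move=> w; rewrite -[leqRHS]card_ord -sum1_card big_mkcond; apply: leq_sum => j _.
  by case: ifP => // _; case: (J i j w).
- move=> i j ji.
  exact: (Ex_indep_bool model (@KA i) (@K'A i) (@dK i) (@gen_I i) (gen_J ji)).
- move=> i j ji.
  exact: (Ex_indep_bool model (@KA i) (@K'A i) (@dK i) (@gen_I i) (gen_H ji)).
- move=> i j ji; rewrite -(rest_card ji).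
  exact: (Ex_centered_sum model _ (rest_notin i j)).
- move=> i j ji; rewrite -(rest_card ji).
  exact: (Ex_centered_sum model _ (rest_notin i j)).
Qed.

End exceedances_approximation.

Theorem theorem1 (R : realType) (D : set R) (nu : probability R R)
    (d : nat -> measure_display) (T : forall n : nat, measurableType (d n))
    (P : forall n : nat, probability (T n) R)
    (X : forall n : nat, 'I_n -> 'I_n -> {RV (P n) >-> R})
    (mu sigma : R)
    (D_sub : D `<=` `[0, 1]) (D_count : countable D)
    (D_gt1 : exists a b : R, [/\ D a, D b & a <> b])
    (model : forall n : nat, round_robin D nu (X n))
    (mu_def : forall (n : nat) (i j : 'I_n), i != j ->
       mu = fine 'E_(P n)[X n i j])
    (sigma_def : forall (n : nat) (i j : 'I_n), i != j ->
       sigma = Num.sqrt (fine 'V_(P n)[X n i j])) :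
  forall t : R, exists C : R, \forall n \near \oo,
    (dTV (distribution (P n) (exceedances (X n) mu sigma t))
         (poisson_prob (expR (- t)) 0%N)
       <= (C * ((ln (ln n%:R)) ^+ 2 / ln n%:R))%:E)%E.
Proof.
move=> t.
(* The law [nu], mu and sigma are common to all n, so their properties can be read off the
   tournament of two players. *)
have ij : (ord0 : 'I_2) != ord_max by [].
have nu01 := reward_law_unit (model 2%N) D_sub ij.
have nu_mean := reward_law_mean (model 2%N) D_sub ij.
have nu_var := reward_law_var (model 2%N) D_sub ij (sigma_def _ _ _ ij).
have sigma0 := reward_sd_gt0 (model 2%N) D_sub D_gt1 ij (sigma_def _ _ _ ij).
have muE := reward_mean (model 2%N) D_sub ij (mu_def _ _ _ ij).
have [C0 C00 C0P] := tail_asymptotics nu01 nu_mean nu_var sigma0 t.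
pose lam : R := expR (- t); have lam0 : 0 < lam by exact: expR_gt0.
pose M : R := 2 * expR lam; have M0 : 0 <= M by rewrite mulr_ge0 ?expR_ge0.
(* The bound of [exceedances_stein_le] with B = C0 del <= C0 and a tail probability of at most (lam
   + C0) / n <= (lam + C0) del; M is the bound of the Stein solutions. *)
pose C := M * C0 + (lam + C0) * (2 * M) * (4 * C0 + (lam + C0)).
exists (2^-1 * C).
have cvg_ln : @ln R n%:R @[n --> \oo] --> +oo.
  apply: (@cvg_comp _ _ _ (fun n : nat => n%:R : R) (@ln R) \oo +oo%R).
    exact: cvgr_idn.
  exact: cvg_ln_pinfty.
near=> n.
have n3 : (3 <= n)%N by near: n; exact: nbhs_infty_ge.
have n0 : 0 < n%:R :> R by rewrite ltr0n (leq_trans _ n3).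
set L := ln n%:R.
have NE : expR L = n%:R by rewrite /L lnK.
have tailL : forall (m : nat) (c : R), m%:R = expR L - 2 -> `|c| <= 2^-1 ->
    `|expR L * tail nu m (cutoff t L sigma c) - expR (- t)| <= C0 * (ln L ^+ 2 / L).
  rewrite /L; near: n; exact: cvg_ln C0P.
have ln1 : 1 <= ln L.
  rewrite /L; near: n; apply: (cvg_ln [set L | 1 <= ln L]).
  by apply: (near_ln (P := fun x => 1 <= x)); exact: nbhs_pinfty_ge (num_real _).
have L0 : 0 < L.
  rewrite /L; near: n; apply: (cvg_ln [set L | 0 < L]).
  exact: nbhs_pinfty_gt (num_real _).
have ln2 : ln L ^+ 2 <= L.
  rewrite -[leRHS]lnK ?posrE// -[ln L ^+ 2]mul1r -[X in expR X]mul1r.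
  rewrite /L; near: n; apply: (cvg_ln [set L | 1 * ln L ^+ 2 <= expR (1 * ln L)]).
  apply: (near_ln (P := fun x => 1 * x ^+ 2 <= expR (1 * x))).
  exact: expR_dominates.
pose del := ln L ^+ 2 / L.
have del0 : 0 <= del by rewrite divr_ge0 ?sqr_ge0 ?(ltW L0).
have del1 : del <= 1 by rewrite ler_pdivrMr// mul1r.
have ndel : n%:R^-1 <= del.
  apply: (@le_trans _ _ L^-1).
    by rewrite lef_pV2 ?posrE// ltW// ln_sublinear.
  by rewrite /del ler_peMl ?invr_ge0 ?(ltW L0)// exprn_ege1.
have mE : (n - 2)%:R = expR L - 2 :> R.
  by rewrite NE natrB// (leq_trans _ n3).
have c1 : `|2^-1 : R| <= 2^-1 by rewrite ger0_norm.
have c2 : `|- 2^-1 : R| <= 2^-1 by rewrite normrN ger0_norm.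
have := tailL _ _ mE c1; have := tailL _ _ mE c2.
rewrite /cutoff NE -/del -/lam => hi lo.
set z := Num.sqrt (n%:R - 1) * sigma * threshold n t.
have Blo : `|lam - n%:R * tail nu (n - 2) (z + 2^-1)| <= C0 * del.
  by rewrite distrC.
have Bhi : `|lam - n%:R * tail nu (n - 2) (z - 2^-1)| <= C0 * del.
  by rewrite distrC.
set q := tail nu (n - 2) (z + 2^-1) in Blo.
have C0del : C0 * del <= C0 by rewrite ler_piMr.
have C0del0 : 0 <= C0 * del by rewrite mulr_ge0.
have q0 : 0 <= q by exact: tail_ge0.
have qdel : q <= (lam + C0) * del.
  apply: (@le_trans _ _ ((lam + C0) * n%:R^-1)); last first.
    by rewrite ler_wpM2l// addr_ge0// ltW.
  rewrite ler_pdivlMr// mulrC.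
  by move: Blo C0del; rewrite ler_norml => /andP[b _]; lra.
rewrite muE -mulrA -/L -/del.
have Wn w : (exceedances (X n) 2^-1 sigma t w <= n)%N.
  rewrite -[leqRHS]card_ord -sum1_card; apply: leq_sum => i _.
  by case: (_ < _).
apply: (dTV_poisson_le lam0 Wn) => g gM.
apply: le_trans (exceedances_stein_le (model n) D_sub (ltnW n3) sigma0 gM Blo Bhi) _.
have -> : C * del = M * (C0 * del) +
    (lam + C0) * (2 * M) * ((4 * C0 + (lam + C0)) * del) by rewrite /C; ring.
rewrite -/q (gtr0_norm lam0) lerD2l.
apply: ler_pM.
- by rewrite mulr_ge0 ?addr_ge0 ?(ltW lam0)// mulr_ge0.
- by rewrite addr_ge0// mulr_ge0.
- by rewrite ler_wpM2r ?mulr_ge0// lerD2l.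
- by rewrite [leRHS]mulrDl -mulrA lerD2l.
Unshelve. all: by end_near. Qed.
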